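(* Let $t$ be a non-negative real number other than $\gamma^-$ and $\gamma^+$. Let $d$ be a positive integer and $n$ an integer at most $d$ satisfying $$ n\geq\max\biggl\{124,\;e^{6t^2}\frac{74+84t}{\bigl|1-24t^2+48t^4\bigr|}\biggr\}. $$ Let $H$ be a hyperplane of $\mathbb{R}^d$ whose distance to the center of the hypercube $[0,1]^d$ is equal to $t$. When $H$ is orthogonal to a diagonal of an $n$-dimensional face of $[0,1]^d$, the $(d-1)$-dimensional volume of $H\cap[0,1]^d$ is (i) strictly locally maximal if $t<\gamma^-$ or $\gamma^+<t$ and $n$ is equal to $d$, (ii) strictly locally minimal if $\gamma^-<t<\gamma^+$ and $n$ is equal to $d$, and (iii) never locally extremal if $n$ is less than $d$.
   Context: The numbers $\gamma^\pm$ are $\gamma^\pm=\frac{1}{2}\sqrt{1\pm\sqrt{2/3}}$ (the non-negative roots of $1-24t^2+48t^4$). Local extremality is understood as follows. The number $t$ is fixed and the volume is considered a function of the hyperplane. By the symmetries of the hypercube, one may consider only the hyperplanes $H_a=\{x\in\mathbb{R}^d:a\cdot x=\sigma(a)/2-t\}$ where $a$ belongs to $\mathbb{S}^{d-1}\cap[0,+\infty[^d$ and $\sigma(a)$ is the sum of the coordinates of $a$. Let $V(a)$ be the $(d-1)$-dimensional volume of $H_a\cap[0,1]^d$. A diagonal of a face (or of the hypercube itself, the case $n=d$) is a segment joining two opposite vertices of that face; $H_a$ is orthogonal to a diagonal of an $n$-dimensional face of $[0,1]^d$ when $a$ has $n$ coordinates equal to $1/\sqrt{n}$ and $d-n$ coordinates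 equal to $0$ (up to symmetry of the hypercube). The volume is strictly locally maximal (respectively minimal) at $H_a$ if $V(b)<V(a)$ (respectively $V(b)>V(a)$) for every $b\neq a$ in some neighborhood of $a$ in $\mathbb{S}^{d-1}\cap[0,+\infty[^d$. It is not locally extremal at $H_a$ if every neighborhood of $a$ in $\mathbb{S}^{d-1}\cap[0,+\infty[^d$ contains points $b$ and $b'$ with $V(b)<V(a)<V(b')$. *)

(* Defs.v *)
From HB Require Import structures.
From mathcomp Require Import all_boot all_order all_algebra.
From mathcomp Require Import all_classical all_reals all_analysis.

Set Implicit Arguments.
Unset Strict Implicit.
Unset Printing Implicit Defensive.

Import Order.TTheory GRing.Theory Num.Theory.
Import numFieldNormedType.Exports.

Local Open Scope classical_set_scope.
Local Open Scope ring_scope.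

Definition cons_tuple (R : realType) (m : nat) (p : R * m.-tuple R) :
  m.+1.-tuple R := [tuple of p.1 :: p.2].

(* Lebesgue measure on R^n: the n-fold product of the Lebesgue measure on R,
   with R * R^m identified with R^m.+1 by [cons_tuple]; it is shown below to be
   a sigma-finite measure. *)
Fixpoint lebesgue_tuple (R : realType) (n : nat) : set (n.-tuple R) -> \bar R :=
  match n with
  | 0 => \d_([tuple] : 0.-tuple R)
  | m.+1 => pushforward (@lebesgue_measure R \x @lebesgue_tuple R m)%E
              (@cons_tuple R m)
  end.

Section lebesgue_tuple_measure.
Variable R : realType.

Lemma measurable_cons_tuple m : measurable_fun setT (@cons_tuple R m).
Proof. by apply: measurable_cons. Qed.

Lemma measurable_uncons_tuple m :
  measurable_fun [set: m.+1.-tuple R]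
    (fun x => (thead x, [tuple of behead x])).
Proof.
apply/measurable_fun_pairP; split; last exact: measurable_behead.
exact: measurable_tnth.
Qed.

Section cons_step.
Context {m : nat}.
Variable mu : {sigma_finite_measure set (m.-tuple R) -> \bar R}.

Let prodm := (@lebesgue_measure R \x mu)%E.

Definition lebesgue_cons := pushforward prodm (@cons_tuple R m).

HB.instance Definition _ := Measure.copy lebesgue_cons
  (measure_function_pushforward__canonical__measure_function_Measure
     prodm (@measurable_cons_tuple m)).

Let lebesgue_cons_sigma_finite : sigma_finite setT lebesgue_cons.
Proof.
have /sigma_finiteP[F [TF ndF Foo]] := sigma_finiteT (@lebesgue_measure R).
have /sigma_finiteP[G [TG ndG Goo]] := sigma_finiteT mu.
pose un (x : m.+1.-tuple R) : R * m.-tuple R := (thead x, [tuple of behead x]).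
have FG i : measurable (F i `*` G i) /\ (prodm (F i `*` G i) < +oo)%E.
  have [? ?] := Foo i; have [? ?] := Goo i.
  split; first exact: measurableX.
  by rewrite /prodm product_measure1E// lte_mul_pinfty// ge0_fin_numE.
exists (fun i => un @^-1` (F i `*` G i)).
  apply/esym; rewrite -subTset => x _.
  have [i _ Fi] : (\bigcup_i F i) (thead x) by rewrite -TF.
  have [j _ Gj] : (\bigcup_i G i) [tuple of behead x] by rewrite -TG.
  exists (maxn i j) => //; split => /=.
  - by move: Fi; exact/subsetPset/ndF/leq_maxl.
  - by move: Gj; exact/subsetPset/ndG/leq_maxr.
move=> i; have [mFG FGoo] := FG i; split.
  by rewrite -[X in measurable X]setTI; exact: measurable_uncons_tuple.
rewrite /lebesgue_cons /pushforward -comp_preimage (_ : un \o _ = id) //.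
by apply/funext => -[x y]; congr pair; exact/val_inj.
Qed.

HB.instance Definition _ :=
  Measure_isSigmaFinite.Build _ _ _ lebesgue_cons lebesgue_cons_sigma_finite.

End cons_step.

Lemma lebesgue_tupleE n :
  exists mu : {sigma_finite_measure set (n.-tuple R) -> \bar R},
    @lebesgue_tuple R n = mu.
Proof.
elim: n => [|m [mu muE]]; first by exists (\d_([tuple] : 0.-tuple R)).
by exists (lebesgue_cons mu); rewrite /= muE.
Qed.

Section instances.
Variable n : nat.
Let leb := @lebesgue_tuple R n.

Let leb0 : leb set0 = 0%E.
Proof. by rewrite /leb; have [mu ->] := lebesgue_tupleE n; exact: measure0. Qed.

Let leb_ge0 A : (0 <= leb A)%E.
Proof. by rewrite /leb; have [mu ->] := lebesgue_tupleE n. Qed.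

Let leb_sigma_additive : semi_sigma_additive leb.
Proof.
rewrite /leb; have [mu ->] := lebesgue_tupleE n.
exact: measure_semi_sigma_additive.
Qed.

HB.instance Definition _ := isMeasure.Build _ _ _ (@lebesgue_tuple R n)
  leb0 leb_ge0 leb_sigma_additive.

Let leb_sigma_finite : sigma_finite setT (@lebesgue_tuple R n).
Proof.
by have [mu ->] := lebesgue_tupleE n; exact: sigma_finiteT.
Qed.

HB.instance Definition _ := Measure_isSigmaFinite.Build _ _ _
  (@lebesgue_tuple R n) leb_sigma_finite.

End instances.
End lebesgue_tuple_measure.

Section hypercube_sections.
Variable R : realType.

(* [(p, U)] parametrizes the hyperplane H of R^d isometrically by R^(d-1) via
   y |-> p + y U: the rows of U are an orthonormal basis of the direction
   of H. *)
Definition isometric_param (d : nat) (H : set 'rV[R]_d)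
    (pU : 'rV[R]_d * 'M[R]_(d.-1, d)) : Prop :=
  pU.2 *m pU.2^T = 1%:M /\ range (fun y : 'rV[R]_d.-1 => pU.1 + y *m pU.2) = H.

(* (d-1)-dimensional volume of a subset A of a hyperplane H of R^d. The
   parametrization is an arbitrary one; the value does not depend on it since
   the Lebesgue measure on R^(d-1) is invariant under isometries. *)
Definition hyperplane_volume (d : nat) (H A : set 'rV[R]_d) : \bar R :=
  let pU := get (isometric_param H) in
  lebesgue_tuple [set y : d.-1.-tuple R |
    A (pU.1 + (\row_(i < d.-1) tnth y i) *m pU.2)].

Definition hypercube (d : nat) : set 'rV[R]_d :=
  [set x | forall i, 0 <= x 0 i <= 1].

Definition sphere_orthant (d : nat) : set 'rV[R]_d :=
  [set a | \sum_i a 0 i ^+ 2 = 1 /\ forall i, 0 <= a 0 i].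

Definition section_hyperplane (d : nat) (t : R) (a : 'rV[R]_d) :
    set 'rV[R]_d :=
  [set x | \sum_i a 0 i * x 0 i = (\sum_i a 0 i) / 2 - t].

Definition section_volume (d : nat) (t : R) (a : 'rV[R]_d) : \bar R :=
  let H := section_hyperplane t a in hyperplane_volume H (H `&` @hypercube d).

Definition strictly_locally_maximal (d : nat) (V : 'rV[R]_d -> \bar R)
    (a : 'rV[R]_d) : Prop :=
  \forall b \near a, sphere_orthant b -> b <> a -> (V b < V a)%E.

Definition strictly_locally_minimal (d : nat) (V : 'rV[R]_d -> \bar R)
    (a : 'rV[R]_d) : Prop :=
  \forall b \near a, sphere_orthant b -> b <> a -> (V a < V b)%E.

Definition not_locally_extremal (d : nat) (V : 'rV[R]_d -> \bar R)
    (a : 'rV[R]_d) : Prop :=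
  forall N : set 'rV[R]_d, nbhs a N ->
    exists b b' : 'rV[R]_d,
      [/\ N b /\ sphere_orthant b, N b' /\ sphere_orthant b',
          (V b < V a)%E & (V a < V b')%E].

(* For a in the nonnegative orthant of the sphere: the hyperplanes with normal
   vector a are orthogonal to a diagonal of an n-dimensional face. *)
Definition normal_along_face_diagonal (d n : nat) (a : 'rV[R]_d) : Prop :=
  exists I : {set 'I_d},
    #|I| = n /\ forall i, a 0 i = if i \in I then (Num.sqrt n%:R)^-1 else 0.

Definition gamma_minus : R := 2^-1 * Num.sqrt (1 - Num.sqrt (2 / 3)).
Definition gamma_plus : R := 2^-1 * Num.sqrt (1 + Num.sqrt (2 / 3)).

End hypercube_sections.

Arguments gamma_minus {R}.
Arguments gamma_plus {R}.

(* Main.v *)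
Require Import Defs.
From HB Require Import structures.
From mathcomp Require Import all_boot all_order all_algebra.
From mathcomp Require Import all_classical all_reals all_analysis.
From mathcomp Require Import measurable_realfun.
From mathcomp Require Import ring lra zify.

(* Put [x_k = b_k ^ 2].  Parametrizing the hyperplane by all coordinates but one
   turns its section into a slab of a smaller cube, and Fourier inversion gives
     [section_volume t b = c * \int cos (2 t u) \prod_k sinc (sqrt (x_k) u) du]
   with [c > 0] independent of [b] and [t]; the integral is [Phi t x] below.
   Move two coordinates [m - D, m + D] of [x] to [m - D', m + D'], where
   [0 <= D' < D] and the other coordinates are about [1 / n].  Divided by
   [D ^ 2 - D' ^ 2], the integrand changes by about
   [- u ^ 4 / 90 * exp (- u ^ 2 / 6) * cos (2 t u)], whose integral is a positive multiple
   of [- (1 - 24 t ^ 2 + 48 t ^ 4) exp (- 6 t ^ 2)]; the hypothesis on [n] makes the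
   error smaller than this main term.  Hence equalizing two coordinates moves the volume
   in a direction prescribed by the sign of [1 - 24 t ^ 2 + 48 t ^ 4].
   For [n = d] the diagonal point is reached from any nearby point by such moves.
   For [n < d] such a move between a positive and a vanishing coordinate leads from the
   diagonal point to a nearby one, and a move between two positive coordinates leads from
   a nearby point to the diagonal point, whence both signs. *)

Set Implicit Arguments.
Unset Strict Implicit.
Unset Printing Implicit Defensive.

Import Order.TTheory GRing.Theory Num.Theory.
Import numFieldNormedType.Exports.

Local Open Scope classical_set_scope.
Local Open Scope ring_scope.

(** * Linear changes of variables for the Lebesgue measure on tuples *)

Section lebesgue_affine.
Variable R : realType.
Local Notation mu := (@lebesgue_measure R).

(** In the squared coordinates [x_k] the sphere becomes the condition [\sum x_k = 1], and the
    integrand is a product of values of [s z = sin (sqrt z) / sqrt z], which is analytic on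
    [z >= 0]. Exact two-coordinate moves replace the Hessian of the volume: they reach points with
    vanishing coordinates, where the square roots are not differentiable, without a separate
    boundary argument. The product [s ((m - D) v) * s ((m + D) v)] is even in [D], hence the
    division by [D ^ 2 - D' ^ 2]; with [v = u ^ 2], the quotient is close to
    [v ^ 2 * (s s'' - s' ^ 2)] at 0, that is [v ^ 2 * (1/60 - 1/36) = - v ^ 2 / 90]. A single factor
    [s] is not absolutely integrable in [u], so two positive coordinates are always kept. The
    Gaussian comparison is made for [u ^ 2 <= 2 n] only; beyond, the decay of the factors takes
    over, and [n >= 124] makes it strong enough. With [K = sqrt (6 pi)], the main term is
    [27 / 90 = 3 / 10] times [|1 - 24 t ^ 2 + 48 t ^ 4| exp (- 6 t ^ 2) K], the error is below
    [22.155 K / n], and [22.155 < 3 / 10 * 74]. *)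

Lemma measurable_affine (a b : R) : measurable_fun [set: R] (fun x => a * x + b).
Proof. by apply: measurable_funD => //; apply: measurable_funM. Qed.

Lemma preimage_affine_itvoc (a b u v : R) : 0 < a ->
  (fun x => a * x + b) @^-1` `]u, v] = `](u - b) / a, (v - b) / a]%classic.
Proof.
move=> a0; apply/seteqP; split => x /=; rewrite !in_itv/= ltr_pdivrMr// ler_pdivlMr//;
  by rewrite ltrBlDr lerBrDr mulrC.
Qed.

Lemma preimage_affine_itvoc_neg (a b u v : R) : a < 0 ->
  (fun x => a * x + b) @^-1` `]u, v] = `[(v - b) / a, (u - b) / a[%classic.
Proof.
move=> a0; apply/seteqP; split => x /=; rewrite !in_itv/= ltr_ndivlMr// ler_ndivrMr//;
  by rewrite ltrBlDr lerBrDr mulrC andbC.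
Qed.

(** Scaled by [|a|], the pushforward under the affine map agrees with the Lebesgue measure on the
    intervals []u, v]], hence everywhere. A negative [a] reverses these intervals and closes the
    other end. *)
Lemma lebesgue_measure_affine (a b : R) (A : set R) : a != 0 -> measurable A ->
  mu ((fun x => a * x + b) @^-1` A) = (`|a|^-1%:E * mu A)%E.
Proof.
move=> a0 mA.
have ma : @measurable_fun _ _ (measurableTypeR R) (measurableTypeR R) setT
  (fun x : R => a * x + b) := measurable_affine a b.
pose nu : {measure set (measurableTypeR R) -> \bar R} := mscale (NngNum (normr_ge0 a))
  (measure_function_pushforward__canonical__measure_function_Measure mu ma).
have nuE : mu A = nu A.
  apply: (lebesgue_measure_unique (mu := nu)) => // _ [[u v] _ <-] /=.
  rewrite /nu /mscale/= /pushforward.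
  case: (ltgtP a 0) a0 => // a0 _.
  - rewrite preimage_affine_itvoc_neg// !lebesgue_measure_itv/= !lte_fin.
    rewrite ltr_ndivrMr// divfK ?lt_eqF// ltrD2r.
    case: ifPn => uv; last by rewrite mule0.
    rewrite -!EFinD -EFinM; congr EFin; rewrite ltr0_norm//; field; by rewrite lt_eqF.
  - rewrite preimage_affine_itvoc// !lebesgue_measure_itv/= !lte_fin.
    rewrite ltr_pdivrMr// divfK ?gt_eqF// ltrD2r.
    case: ifPn => uv; last by rewrite mule0.
    rewrite -!EFinD -EFinM; congr EFin; rewrite gtr0_norm//; field; by rewrite gt_eqF.
rewrite nuE /nu /mscale/= /pushforward muleA -EFinM mulVf ?mul1e//.
by rewrite normr_eq0.
Qed.

Lemma ge0_integral_affine (a b : R) (f : R -> \bar R) : a != 0 ->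
  measurable_fun [set: R] f -> (forall x, 0 <= f x)%E ->
  (\int[mu]_x f (a * x + b)%R = `|a|^-1%:E * \int[mu]_x f x)%E.
Proof.
move=> a0 mf f0.
have ma : @measurable_fun _ _ (measurableTypeR R) (measurableTypeR R) setT
  (fun x : R => a * x + b) := measurable_affine a b.
have H := @ge0_integral_pushforward _ _ (measurableTypeR R) (measurableTypeR R) _ _ ma mu setT f measurableT mf (fun x _ => f0 x).
rewrite preimage_setT in H.
rewrite /comp in H; rewrite -H.
rewrite (@eq_measure_integral _ (measurableTypeR R) R setT
  (mscale (NngNum (normr_ge0 (a^-1)%R)) mu)); last first.
  move=> A mA _; have := lebesgue_measure_affine b a0 mA.
  by rewrite -normfV.
by rewrite ge0_integral_mscale//= normfV.
Qed.

End lebesgue_affine.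

Section lebesgue_tuple_affine.
Variable R : realType.
Local Notation mu := (@lebesgue_measure R).
Local Notation leb n := (@lebesgue_tuple R n).

Lemma lebesgue_tupleS n (A : set (n.+1.-tuple R)) :
  leb n.+1 A = (\int[mu]_x leb n [set y | A (Defs.cons_tuple (x : R, y : n.-tuple R))])%E.
Proof.
rewrite /= /pushforward/= /product_measure1.
by apply: eq_integral => x _; rewrite /= xsectionE.
Qed.

(** The other order of integration, by uniqueness of the product measure. It serves for shears that
    move the first coordinate by an amount depending on the others. *)
Lemma lebesgue_tupleS' n (A : set (n.+1.-tuple R)) : measurable A ->
  leb n.+1 A = (\int[leb n]_y mu [set x | A (Defs.cons_tuple (x : R, y : n.-tuple R))])%E.
Proof.
move=> mA.
have mB : measurable (@Defs.cons_tuple R n @^-1` A).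
  by rewrite -[X in measurable X]setTI; exact: measurable_cons_tuple.
have -> : leb n.+1 A = (mu \x^ leb n)%E (@Defs.cons_tuple R n @^-1` A).
  have := @product_measure_unique _ _ _ _ _ mu (leb n) (mu \x^ leb n)%E.
  move=> /(_ _ _ mB) <- //.
  by move=> A1 A2 mA1 mA2; exact: product_measure2E.
rewrite /product_measure2.
by apply: eq_integral => x _; rewrite /= ysectionE.
Qed.

Lemma measurable_xsection_tuple n (A : set (n.+1.-tuple R)) x : measurable A ->
  measurable [set y | A (Defs.cons_tuple (x : R, y : n.-tuple R))].
Proof.
move=> mA.
have mB : measurable (@Defs.cons_tuple R n @^-1` A).
  by rewrite -[X in measurable X]setTI; exact: measurable_cons_tuple.
by have := measurable_xsection x mB; rewrite xsectionE.
Qed.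

Lemma measurable_ysection_tuple n (A : set (n.+1.-tuple R)) y : measurable A ->
  measurable [set x | A (Defs.cons_tuple (x : R, y : n.-tuple R))].
Proof.
move=> mA.
have mB : measurable (@Defs.cons_tuple R n @^-1` A).
  by rewrite -[X in measurable X]setTI; exact: measurable_cons_tuple.
by have := measurable_ysection y mB; rewrite ysectionE.
Qed.

Lemma measurable_fun_lebesgue_xsection n (A : set (n.+1.-tuple R)) : measurable A ->
  measurable_fun [set: R] (fun x => leb n [set y | A (Defs.cons_tuple (x : R, y : n.-tuple R))]).
Proof.
move=> mA.
have mB : measurable (@Defs.cons_tuple R n @^-1` A).
  by rewrite -[X in measurable X]setTI; exact: measurable_cons_tuple.
have := measurable_fun_xsection (leb n) mB.
by apply: eq_measurable_fun => x _ /=; rewrite xsectionE.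
Qed.

Lemma measurable_fun_lebesgue_ysection n (A : set (n.+1.-tuple R)) : measurable A ->
  measurable_fun [set: n.-tuple R] (fun y => mu [set x | A (Defs.cons_tuple (x : R, y : n.-tuple R))]).
Proof.
move=> mA.
have mB : measurable (@Defs.cons_tuple R n @^-1` A).
  by rewrite -[X in measurable X]setTI; exact: measurable_cons_tuple.
have := measurable_fun_ysection mu mB.
by apply: eq_measurable_fun => x _ /=; rewrite ysectionE.
Qed.

Definition row_tuple n (y : n.-tuple R) : 'rV[R]_n := \row_i tnth y i.

Definition affine_tuple n (M : 'M[R]_n) (v : 'rV[R]_n) (y : n.-tuple R) : n.-tuple R :=
  [tuple (row_tuple y *m M + v) 0 i | i < n].

Lemma measurable_affine_tuple n M v : measurable_fun setT (@affine_tuple n M v).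
Proof.
apply/measurable_fun_tnthP => i.
rewrite (_ : _ \o _ = fun y : n.-tuple R => \sum_j tnth y j * M j i + v 0 i); last first.
  apply/funext => y /=; rewrite tnth_mktuple !mxE; congr (_ + _).
  by apply: eq_bigr => j _; rewrite mxE.
apply: measurable_funD => //; apply: measurable_sum => j.
by apply: measurable_funM => //; exact: measurable_tnth.
Qed.

Lemma rshift1_lift n (j : 'I_n) : rshift 1 j = lift ord0 j :> 'I_(1 + n).
Proof. exact/val_inj. Qed.

Lemma lshift1_ord0 n (j : 'I_1) : lshift n j = ord0 :> 'I_(1 + n).
Proof. by apply/val_inj; rewrite /= (ord1 j). Qed.

(** The translation [v] is quantified inside because, once the first coordinate is fixed, the
    remaining ones undergo an affine map whose shift depends on that coordinate. *)
Definition scales_lebesgue n (M : 'M[R]_n) := forall v (A : set (n.-tuple R)), measurable A ->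
  leb n (affine_tuple M v @^-1` A) = (`|\det M|^-1%:E * leb n A)%E.

Lemma affine_tuple_upper n (M : 'M[R]_(1 + n)) (v : 'rV_(1 + n)) x (y : n.-tuple R) :
  dlsubmx M = 0 ->
  affine_tuple M v (Defs.cons_tuple (x : R, y : n.-tuple R)) = Defs.cons_tuple (M ord0 ord0 * x + v ord0 ord0,
    affine_tuple (drsubmx M) (x *: ursubmx M + rsubmx v) y).
Proof.
move=> /matrixP M0; apply/eq_from_tnth => i.
rewrite tnth_mktuple /= !mxE big_ord_recl/= mxE (tnth_nth 0)/= addrC.
case: (unliftP ord0 i) => [j|] ->; last first.
  rewrite (tnth_nth 0)/= big1 ?addr0 1?addrC 1?mulrC// => k _.
  have := M0 k ord0; rewrite !mxE rshift1_lift lshift1_ord0 => ->; exact: mulr0.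
rewrite tnthS tnth_mktuple !mxE !rshift1_lift !lshift1_ord0 addrC -!addrA.
rewrite [RHS]addrCA; congr (_ + _); congr (_ + _).
by apply: eq_bigr => k _; rewrite !mxE tnthS !rshift1_lift.
Qed.

Lemma affine_tuple_lower n (M : 'M[R]_(1 + n)) (v : 'rV_(1 + n)) x (y : n.-tuple R) :
  M ord0 ord0 = 1 -> ursubmx M = 0 -> drsubmx M = 1%:M ->
  affine_tuple M v (Defs.cons_tuple (x : R, y : n.-tuple R)) =
  Defs.cons_tuple (1 * x + ((row_tuple y *m dlsubmx M) ord0 ord0 + v ord0 ord0),
    affine_tuple 1%:M (rsubmx v) y).
Proof.
move=> M1 /matrixP M0 <-; apply/eq_from_tnth => i.
rewrite tnth_mktuple /= !mxE big_ord_recl/= mxE (tnth_nth 0)/=.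
case: (unliftP ord0 i) => [j|] ->; last first.
  rewrite (tnth_nth 0)/= M1 mul1r mulr1 -addrA; congr (_ + (_ + _)).
  by apply: eq_bigr => k _; rewrite !mxE tnthS !rshift1_lift !lshift1_ord0.
rewrite tnthS tnth_mktuple !mxE !rshift1_lift.
have := M0 ord0 j; rewrite !mxE rshift1_lift lshift1_ord0 => ->.
rewrite mulr0 add0r; congr (_ + _).
by apply: eq_bigr => k _; rewrite !mxE tnthS !rshift1_lift.
Qed.

Lemma det_upper n (M : 'M[R]_(1 + n)) : dlsubmx M = 0 ->
  \det M = M ord0 ord0 * \det (drsubmx M).
Proof.
move=> M0; rewrite -[in LHS](submxK M) M0 det_ublock; congr (_ * _).
by rewrite det_mx11 !mxE !lshift1_ord0.
Qed.

Lemma det_lower n (M : 'M[R]_(1 + n)) : ursubmx M = 0 ->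
  \det M = M ord0 ord0 * \det (drsubmx M).
Proof.
move=> M0; rewrite -[in LHS](submxK M) M0 det_lblock; congr (_ * _).
by rewrite det_mx11 !mxE !lshift1_ord0.
Qed.

(** The first output coordinate depends on the first input coordinate only, so slices go to slices:
    the hypothesis scales each slice, and the one-dimensional formula handles the first
    coordinate. *)
Lemma scales_lebesgue_upper n (M : 'M[R]_(1 + n)) : M ord0 ord0 != 0 -> dlsubmx M = 0 ->
  scales_lebesgue (drsubmx M) -> scales_lebesgue M.
Proof.
move=> M00 M0 LM v A mA.
rewrite [LHS]lebesgue_tupleS [X in _ = (_ * X)%E]lebesgue_tupleS.
have sec x : leb n [set y | (affine_tuple M v @^-1` A) (Defs.cons_tuple (x : R, y : n.-tuple R))] =
   (`|\det (drsubmx M)|^-1%:E *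
    leb n [set y | A (Defs.cons_tuple ((M ord0 ord0 * x + v ord0 ord0)%R, y : n.-tuple R))])%E.
  rewrite -(LM (x *: ursubmx M + rsubmx v)); last exact: measurable_xsection_tuple.
  by congr (lebesgue_tuple _); apply/seteqP; split => y /=; rewrite affine_tuple_upper.
under eq_integral do rewrite sec.
have mf := measurable_fun_lebesgue_xsection mA.
rewrite ge0_integralZl//=; last first.
  - apply: (measurableT_comp mf); exact: measurable_affine.
rewrite (ge0_integral_affine (v ord0 ord0) M00 mf)//.
by rewrite det_upper// normrM invfM EFinM muleA [X in (X * _)%E = _]muleC.
Qed.

Lemma ge0_integral_affine_tuple n (M : 'M[R]_n) (v : 'rV[R]_n) (f : n.-tuple R -> \bar R) :
  scales_lebesgue M ->
  measurable_fun [set: n.-tuple R] f -> (forall x, 0 <= f x)%E ->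
  (\int[leb n]_x f (affine_tuple M v x) = `|\det M|^-1%:E * \int[leb n]_x f x)%E.
Proof.
move=> LM mf f0.
have ma := measurable_affine_tuple M v.
have H := @ge0_integral_pushforward _ _ _ _ _ _ ma (leb n) setT f measurableT mf (fun x _ => f0 x).
rewrite preimage_setT /comp in H; rewrite -H.
have c0 : 0 <= `|\det M|^-1 by rewrite invr_ge0.
rewrite (eq_measure_integral (mscale (NngNum c0) (leb n))); last first.
  by move=> A mA _; exact: LM.
by rewrite ge0_integral_mscale.
Qed.

(** With the last coordinates fixed, the first one is merely translated; integrating it first makes
    the shear disappear by translation invariance. *)
Lemma scales_lebesgue_lower n (M : 'M[R]_(1 + n)) :
  M ord0 ord0 = 1 -> ursubmx M = 0 -> drsubmx M = 1%:M ->
  scales_lebesgue (1%:M : 'M[R]_n) -> scales_lebesgue M.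
Proof.
move=> M00 M0 M1 L1 v A mA.
have mA' : measurable (affine_tuple M v @^-1` A).
  by rewrite -[X in measurable X]setTI; exact: (measurable_affine_tuple M v).
rewrite [LHS]lebesgue_tupleS'//.
have sec y : mu [set x | (affine_tuple M v @^-1` A) (Defs.cons_tuple (x : R, y : n.-tuple R))] =
   mu [set x | A (Defs.cons_tuple (x : R, affine_tuple 1%:M (rsubmx v) y))].
  set y' := affine_tuple _ _ y.
  have := lebesgue_measure_affine ((row_tuple y *m dlsubmx M) ord0 ord0 + v ord0 ord0)
     (oner_neq0 R) (measurable_ysection_tuple y' mA).
  rewrite normr1 invr1 mul1e => <-.
  by congr (lebesgue_measure _); apply/seteqP; split => x /=; rewrite affine_tuple_lower.
under eq_integral do rewrite sec.
rewrite (ge0_integral_affine_tuple (rsubmx v) L1 (measurable_fun_lebesgue_ysection mA)); last first.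
  by move=> ?; exact: measure_ge0.
by rewrite det_lower// M00 M1 det1 mulr1 [X in (_ * X)%E = _]/= -[X in (_ * X)%E = _]lebesgue_tupleS'.
Qed.

Lemma scales_lebesgue_mul n (M N : 'M[R]_n) :
  scales_lebesgue M -> scales_lebesgue N -> scales_lebesgue (M *m N).
Proof.
move=> LM LN v A mA.
have -> : affine_tuple (M *m N) v @^-1` A = affine_tuple M 0 @^-1` (affine_tuple N v @^-1` A).
  apply/funext => y; rewrite /preimage/=; congr A.
  apply/eq_from_tnth => i; rewrite !tnth_mktuple.
  rewrite [LHS]mxE [RHS]mxE; congr (_ + _); rewrite mulmxA.
  suff -> : row_tuple y *m M = row_tuple (affine_tuple M 0 y) by [].
  by apply/rowP => k; rewrite [RHS]mxE tnth_mktuple addr0.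
rewrite LM; last first.
  by rewrite -[X in measurable X]setTI; exact: (measurable_affine_tuple N v).
by rewrite LN// muleA det_mulmx normrM invfM EFinM.
Qed.

(** Induction on the dimension through a block LU factorization, after making the pivot nonzero. *)
Lemma scales_lebesgue_unitmx n (M : 'M[R]_n) : M \in unitmx -> scales_lebesgue M.
Proof.
elim: n M => [|n IH] M uM.
  move=> v A mA; rewrite det_mx00 normr1 invr1 mul1e; congr lebesgue_tuple.
  by apply/funext => y; congr A; rewrite [LHS]tuple0 [RHS]tuple0.
have L1 : scales_lebesgue (1%:M : 'M[R]_n) by apply: IH; exact: unitmx1.
move: M uM; rewrite -[n.+1]/(1 + n)%N => M uM.
wlog M00 : M uM / M ord0 ord0 != 0.
  move=> H; have [M00|] := eqVneq (M ord0 ord0) 0; last exact: H.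
  set c := dlsubmx M.
  (* When the pivot vanishes, this shear with [s = 1] replaces it by the sum of the squares of the
     entries of [c]. That sum is nonzero, for otherwise the first column of [M] would vanish. *)
  pose E s : 'M[R]_(1 + n) := block_mx 1%:M (s *: c^T) 0 1%:M.
  have LE s : scales_lebesgue (E s).
    apply: scales_lebesgue_upper.
    - by rewrite -(lshift1_ord0 n ord0) block_mxEul mxE eqxx oner_neq0.
    - by rewrite block_mxKdl.
    - by rewrite block_mxKdr.
  have -> : M = E (-1) *m (E 1 *m M).
    rewrite mulmxA mulmx_block !(mul0mx, mulmx0, mul1mx, mulmx1, add0r, addr0).
    by rewrite !scaleN1r !scale1r addrN -scalar_mx_block mul1mx.
  apply: scales_lebesgue_mul => //; apply: H.
    by rewrite unitmx_mul uM andbT unitmxE det_ublock !det1 mulr1 unitr1.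
  rewrite -[M]submxK mulmx_block -(lshift1_ord0 n ord0) block_mxEul.
  rewrite mul1mx scale1r !mxE lshift1_ord0 M00 add0r.
  apply: contraTN uM => /eqP s0.
  rewrite unitmxE unitfE negbK det_upper ?M00 ?mul0r//.
  apply/matrixP => i j; rewrite [RHS]mxE (ord1 j) => {j}.
  have /psumr_eq0P : forall k : 'I_n, true -> 0 <= c^T ord0 k * c k ord0.
    by move=> k _; rewrite mxE -expr2 sqr_ge0.
  by move=> /(_ s0 i isT) /eqP; rewrite mxE mulf_eq0 orbb => /eqP.
set a := M ord0 ord0; set c := dlsubmx M; set r := ursubmx M.
have ulE : ulsubmx M = a%:M.
  by apply/matrixP => i j; rewrite !mxE !lshift1_ord0 (ord1 i) (ord1 j).
pose Lw : 'M[R]_(1 + n) := block_mx 1%:M 0 (a^-1 *: c) 1%:M.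
(* The lower right block is the Schur complement of the pivot; the induction hypothesis is applied
   to it. *)
pose Up : 'M[R]_(1 + n) := block_mx a%:M r 0 (drsubmx M - a^-1 *: (c *m r)).
have ME : M = Lw *m Up.
  rewrite -[M in LHS]submxK mulmx_block !(mul0mx, mulmx0, mul1mx, mulmx1, add0r, addr0).
  rewrite -ulE -/r -!scalemxAl (addrC (a^-1 *: (c *m r))) subrK.
  by congr block_mx; rewrite ulE mul_mx_scalar scalerA mulVf// scale1r.
have Up00 : Up ord0 ord0 = a by rewrite -(lshift1_ord0 n ord0) block_mxEul mxE eqxx.
have Updl : dlsubmx Up = 0 by rewrite block_mxKdl.
move: uM; rewrite ME unitmx_mul => /andP[_ uU].
apply: scales_lebesgue_mul.
  apply: scales_lebesgue_lower => //.
  - by rewrite -(lshift1_ord0 n ord0) block_mxEul mxE eqxx.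
  - by rewrite block_mxKur.
  - by rewrite block_mxKdr.
apply: scales_lebesgue_upper => //; first by rewrite Up00.
apply: IH; move: uU; rewrite !unitmxE !unitfE det_upper// mulf_eq0 negb_or.
by case/andP.
Qed.

End lebesgue_tuple_affine.

(** * Hyperplane sections as slabs *)

Section section_slab.
Variable R : realType.
Local Notation leb n := (@lebesgue_tuple R n).

(** The shadow of a section of the cube in the coordinates that remain after eliminating one: the
    inequality says that the eliminated coordinate, whose coefficient is [w], lies in [0, 1].
    Coordinates are centred so that [tau] measures the offset from the center of the cube. *)
Definition slab (m : nat) (al : 'I_m -> R) (tau w : R) : set (m.-tuple R) :=
  [set z | (forall i, 0 <= tnth z i <= 1) /\
    `|\sum_i al i * (tnth z i - 2^-1) - tau| <= w / 2].

Lemma measurable_slab m (al : 'I_m -> R) tau w : measurable (slab al tau w).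
Proof.
have -> : slab al tau w = \bigcap_(i in [set: 'I_m]) [set z : m.-tuple R | 0 <= tnth z i <= 1]
   `&` [set z : m.-tuple R | `|\sum_i al i * (tnth z i - 2^-1) - tau| <= w / 2].
  by apply/seteqP; split => z [H1 H2]; split => //= i; [move=> _|]; exact: H1.
apply: measurableI.
  apply: fin_bigcap_measurable => // i _.
  have := measurable_tnth (T := R) i measurableT (measurable_itv `[(0:R), 1]).
  by rewrite setTI; congr measurable; apply/seteqP; split => z /=; rewrite in_itv.
have mf : measurable_fun [set: m.-tuple R] (fun z => `|\sum_i al i * (tnth z i - 2^-1) - tau|).
  apply: measurableT_comp => //; apply: measurable_funB => //.
  apply: measurable_sum => i; apply: measurable_funM => //.
  by apply: measurable_funB => //; exact: measurable_tnth.
have := mf measurableT _ (measurable_itv `]-oo, w / 2]).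
by rewrite setTI; congr measurable; apply/seteqP; split => z /=; rewrite in_itv.
Qed.

Lemma dot_mulmx d (a x : 'rV[R]_d) : \sum_i a 0 i * x 0 i = (x *m a^T) 0 0.
Proof. by rewrite mxE; apply: eq_bigr => i _; rewrite mxE mulrC. Qed.

(* The reflection exchanging [- a] and the first basis vector completes [- a] into an
   orthonormal basis. *)
Lemma orthonormal_completion m (a : 'rV[R]_(1 + m)) : sphere_orthant a ->
  exists U : 'M[R]_(m, 1 + m), [/\ U *m U^T = 1%:M, U *m a^T = 0 & a^T *m a + U^T *m U = 1%:M].
Proof.
move=> [a1 a0].
pose e : 'rV[R]_(1 + m) := delta_mx 0 0.
(* [c] is 2 divided by the squared norm of [w]. Reflecting to [- a] rather than to [a] gives the
   denominator [1 + a 0 0], positive because [a] lies in the non-negative orthant. *)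
pose w := a + e; pose c := (1 + a 0 0)^-1.
have c0 : 1 + a 0 0 != 0 by rewrite gt_eqF// ltr_wpDr.
pose Q : 'M[R]_(1 + m) := 1%:M - c *: (w^T *m w).
have aa : a *m a^T = 1%:M.
  apply/matrixP => i j; rewrite !ord1 mxE [RHS]mxE/= -a1.
  by apply: eq_bigr => k _; rewrite mxE expr2.
have ae : a *m e^T = (a 0 0)%:M.
  apply/matrixP => i j; rewrite !ord1 mxE [RHS]mxE/= (bigD1 0)//= !mxE eqxx mulr1 big1 ?addr0// => k k0.
  by rewrite !mxE/= (negbTE k0) mulr0.
have ee : e *m e^T = 1%:M.
  apply/matrixP => i j; rewrite !ord1 mxE [RHS]mxE/= (bigD1 0)//= !mxE eqxx mulr1 big1 ?addr0// => k k0.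
  by rewrite !mxE/= (negbTE k0) mulr0.
have ea : e *m a^T = (a 0 0)%:M.
  by rewrite -[e]trmxK -trmx_mul ae tr_scalar_mx.
have ww : w *m w^T = (2 * (1 + a 0 0))%:M.
  rewrite /w linearD/= mulmxDl !mulmxDr aa ae ea ee -!raddfD/=; congr (_%:M); ring.
have QT : Q^T = Q.
  by rewrite /Q linearB/= linearZ/= trmx_mul trmxK tr_scalar_mx.
have QQ : Q *m Q = 1%:M.
  rewrite {2}/Q mulmxBr mulmx1 -scalemxAr {1 2}/Q mulmxBl mul1mx -scalemxAl.
  rewrite -mulmxA [w *m (w^T *m w)]mulmxA ww mul_scalar_mx -scalemxAr scalerA.
  have -> : c * (2 * (1 + a 0 0)) = 2 by rewrite /c; field.
  by rewrite scaler_nat mulr2n opprD addrA subrr sub0r scalerN opprK subrK.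
have Qu : usubmx Q = - a.
  apply/matrixP => i j; rewrite !mxE !ord1 big_ord1 !mxE.
  have -> : (lshift m 0 : 'I_(1 + m)) = 0 by apply/val_inj.
  rewrite !eqxx [j == 0]eq_sym /= /c; case: (0 == j) => /=; by field.
exists (dsubmx Q).
have E1 : col_mx (- a) (dsubmx Q) *m row_mx (- a^T) (dsubmx Q)^T = 1%:M.
  by rewrite -Qu -linearN/= -Qu -tr_col_mx vsubmxK QT.
have E2 : row_mx (- a^T) (dsubmx Q)^T *m col_mx (- a) (dsubmx Q) = 1%:M.
  by rewrite -linearN/= -Qu -tr_col_mx vsubmxK QT.
have := E1; rewrite mul_col_row [X in _ = X -> _]scalar_mx_block => /eq_block_mx[_ _ E3 E4].
split => //.
  by apply: oppr_inj; rewrite -mulmxN E3 oppr0.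
by rewrite -E2 mul_row_col mulNmx mulmxN opprK.
Qed.

(** [hyperplane_volume] picks a parametrization with [get], which is meaningful only once one is
    known to exist. The base point used here is the point of the hyperplane closest to the
    origin. *)
Lemma isometric_param_section m (t : R) (a : 'rV[R]_(m.+1)) : sphere_orthant a ->
  exists pU, isometric_param (section_hyperplane t a) pU.
Proof.
move=> sa; have [U [UU Ua aU]] := orthonormal_completion sa.
have [a1 a0] := sa.
set c := (\sum_i a 0 i) / 2 - t.
have aa : a *m a^T = 1%:M.
  apply/matrixP => i j; rewrite !ord1 mxE [RHS]mxE/= -a1.
  by apply: eq_bigr => k _; rewrite mxE expr2.
exists (c *: a, U); split => //=; apply/seteqP; split => x /=.
  move=> [y _ <-]; rewrite /section_hyperplane/= dot_mulmx -/c mulmxDl -scalemxAl aa -mulmxA Ua mulmx0 addr0.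
  by rewrite !mxE eqxx mulr1.
rewrite /section_hyperplane/= dot_mulmx -/c => xa.
exists (x *m U^T) => //.
have xaE : x *m a^T = c%:M by apply/matrixP => i j; rewrite !ord1 xa mxE eqxx.
have -> : c *: a = x *m (a^T *m a) by rewrite mulmxA xaE mul_scalar_mx.
by rewrite -mulmxA -mulmxDr aU mulmx1.
Qed.

(** The parametrization picked by [get] is unknown, so the orthogonality of its directions to [a] is
    recovered by comparing the linear equation at 0 and at the basis vectors. *)
Lemma isometric_param_normal m (t : R) (a : 'rV[R]_(m.+1)) p (U : 'M[R]_(m, m.+1)) :
  isometric_param (section_hyperplane t a) (p, U) ->
  [/\ U *m U^T = 1%:M, U *m a^T = 0 &
     forall y, \sum_i a 0 i * (p + y *m U) 0 i = (\sum_i a 0 i) / 2 - t].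
Proof.
move=> [/= UU rE].
have H y : \sum_i a 0 i * (p + y *m U) 0 i = (\sum_i a 0 i) / 2 - t.
  by have : section_hyperplane t a (p + y *m U) by rewrite -rE; exists y.
split => //.
apply/row_matrixP => i; rewrite row_mul row0.
apply/matrixP => k l; rewrite !ord1 [RHS]mxE.
have := H (delta_mx 0 i); have := H 0.
rewrite !dot_mulmx mul0mx addr0 -rowE mulmxDl => <-.
by rewrite mxE; move=> /eqP; rewrite -subr_eq0 addrAC subrr add0r => /eqP.
Qed.

(** Stacking [a] over [U] gives an orthogonal matrix, whose adjugate is its determinant times its
    transpose. The cofactor of the entry [a 0 j] is, up to sign, the minor of [U] without column
    [j]. *)
Lemma normr_det_col' m (a : 'rV[R]_(m.+1)) (U : 'M[R]_(m, m.+1)) j : sphere_orthant a ->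
  U *m U^T = 1%:M -> U *m a^T = 0 -> `|\det (col' j U)| = a 0 j.
Proof.
move=> [a1 a0] UU Ua.
pose Q : 'M[R]_(1 + m) := col_mx a U.
have aa : a *m a^T = 1%:M.
  apply/matrixP => i k; rewrite !ord1 mxE [RHS]mxE/= -a1.
  by apply: eq_bigr => l _; rewrite mxE expr2.
have aU : a *m U^T = 0 by rewrite -[a]trmxK -trmx_mul Ua trmx0.
have QQ : Q *m Q^T = 1%:M.
  by rewrite /Q tr_col_mx mul_col_row aa aU Ua UU -scalar_mx_block.
have QQ' := mulmx1C QQ.
have d1 : `|\det Q| = 1.
  have : \det Q * \det Q = 1 by rewrite -{2}(det_tr Q) -det_mulmx QQ det1.
  by move=> /(congr1 Num.norm); rewrite normrM normr1 -expr2 => /eqP; rewrite sqrp_eq1// => /eqP.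
have adjE : \adj Q = \det Q *: Q^T.
  have := congr1 (mulmx Q^T) (mul_mx_adj Q).
  by rewrite mulmxA QQ' mul1mx mul_mx_scalar.
have := congr1 (fun M : 'M[R]_(1 + m) => M j 0) adjE.
rewrite [LHS]mxE [RHS]mxE [Q^T _ _]mxE /cofactor.
have -> : row' 0 (col' j Q) = col' j U.
  apply/matrixP => i k; rewrite [LHS]mxE [LHS]mxE [RHS]mxE -rshift1_lift.
  exact: col_mxEd.
move=> /(congr1 Num.norm); rewrite !normrM normrX normrN1 expr1n mul1r d1 mul1r => ->.
have -> : (0 : 'I_(1 + m)) = lshift m 0 by apply/val_inj.
by rewrite col_mxEu ger0_norm.
Qed.

(** Forgetting the coordinate [j] turns the isometric parametrization into an affine bijection of
    determinant [a 0 j] up to sign, and the section into a slab. *)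
Lemma section_volume_slab m (t : R) (a : 'rV[R]_(m.+1)) j : sphere_orthant a -> 0 < a 0 j ->
  section_volume t a =
  ((a 0 j)^-1%:E * leb m (slab (fun i => a ord0 (lift j i)) (- t)%R (a ord0 j)))%E.
Proof.
move=> sa aj0; rewrite /section_volume /hyperplane_volume.
have := getPex (isometric_param_section t sa).
case: (get _) => p U pU /=.
have [UU Ua H] := isometric_param_normal pU.
have dU := normr_det_col' j sa UU Ua.
have uM : col' j U \in unitmx.
  by rewrite unitmxE unitfE -normr_eq0 dU gt_eqF.
rewrite -[X in (X^-1)%:E]dU -(scales_lebesgue_unitmx uM (col' j p) (measurable_slab _ _ _)).
congr (lebesgue_tuple _); apply/seteqP; split => y /=;
  rewrite /hypercube /slab /=; set X := p + _ *m U.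
- have XE i : tnth (affine_tuple (col' j U) (col' j p) y) i = X ord0 (lift j i).
    rewrite tnth_mktuple !mxE addrC; congr (_ + _).
    by apply: eq_bigr => k _; rewrite !mxE.
  have := H (\row_i tnth y i); rewrite -/X !(bigD1_ord j)//= => HX [_ Xc].
  split => [i|]; first by rewrite XE.
  under eq_bigr do rewrite XE mulrBr.
  rewrite sumrB -mulr_suml opprK.
  have /andP[c1 c2] := Xc j.
  (* By the equation of the hyperplane the centred form measures the eliminated coordinate, so the
     width condition of the slab is exactly that this coordinate lies in [0, 1]. *)
  have -> : \sum_i a ord0 (lift j i) * X ord0 (lift j i) - (\sum_i a ord0 (lift j i)) / 2 + t
     = a ord0 j * (2^-1 - X ord0 j) by lra.
  rewrite normrM (gtr0_norm aj0) ler_wpM2l ?(ltW aj0)// ler_norml.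
  by apply/andP; split; lra.
have XE i : tnth (affine_tuple (col' j U) (col' j p) y) i = X ord0 (lift j i).
  rewrite tnth_mktuple !mxE addrC; congr (_ + _).
  by apply: eq_bigr => k _; rewrite !mxE.
have HX0 := H (\row_i tnth y i); have := HX0; rewrite -/X !(bigD1_ord j)//= => HX [Xc].
under eq_bigr do rewrite XE mulrBr.
rewrite sumrB -mulr_suml opprK.
have -> : \sum_i a ord0 (lift j i) * X ord0 (lift j i) - (\sum_i a ord0 (lift j i)) / 2 + t
   = a ord0 j * (2^-1 - X ord0 j) by lra.
rewrite normrM (gtr0_norm aj0) ler_pM2l// ler_norml => /andP[c1 c2].
split; first exact: HX0.
move=> i; case: (unliftP j i) => [k|] ->; first by rewrite -XE.
by apply/andP; split; lra.
Qed.

End section_slab.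

(** * Bounds on the cardinal sine *)

Section derivatives.
Variable R : realType.
Implicit Types x : R.

Lemma is_derive_expn n x : is_derive x 1 (fun y : R => y ^+ n) (n%:R * x ^+ n.-1).
Proof.
apply: DeriveDef; first exact: exprn_derivable.
by rewrite -derive1E exp_derive1 -mulr_natl.
Qed.

Lemma is_derive_fcst (c : R) x : is_derive x 1 (fun=> c) 0.
Proof. exact: is_derive_cst. Qed.

Lemma is_derive_fid x : is_derive x 1 (fun y : R => y) 1.
Proof. exact: is_derive_id. Qed.

Section combinators.
Variables (f g : R -> R) (x a b : R).
Hypotheses (fa : is_derive x 1 f a) (gb : is_derive x 1 g b).

Lemma is_derive_fD : is_derive x 1 (fun y => f y + g y) (a + b).
Proof. exact: is_deriveD. Qed.

Lemma is_derive_fN : is_derive x 1 (fun y => - f y) (- a).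
Proof. exact: is_deriveN. Qed.

Lemma is_derive_fM : is_derive x 1 (fun y => f y * g y) (f x * b + g x * a).
Proof. exact: is_deriveM. Qed.

Lemma is_derive_fV : f x != 0 -> is_derive x 1 (fun y => (f y)^-1) (- f x ^- 2 * a).
Proof. by move=> fx; exact: is_deriveV. Qed.

End combinators.

Lemma is_derive_fcomp (f g : R -> R) x a b : is_derive (g x) 1 f a -> is_derive x 1 g b ->
  is_derive x 1 (fun y => f (g y)) (a * b).
Proof. exact: is_derive1_comp. Qed.

Lemma is_derive_cont (f : R -> R) x a : is_derive x 1 f a -> {for x, continuous f}.
Proof.
move=> fa; apply: differentiable_continuous; apply/derivable1_diffP; exact: ex_derive.
Qed.

Lemma le_of_derive (f g f' g' : R -> R) x : 0 <= x ->
  (forall x, is_derive x 1 f (f' x) /\ is_derive x 1 g (g' x)) ->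
  f 0 = g 0 -> (forall x, 0 <= x -> f' x <= g' x) -> f x <= g x.
Proof.
move=> + dfg fg0 fg'; rewrite le_eqVlt => /predU1P[<-|x0]; first by rewrite fg0.
have dh (y : R) : is_derive y 1 (fun y => g y + - f y) (g' y + - f' y).
  by have [df dg] := dfg y; apply: is_derive_fD => //; exact: is_derive_fN.
have [|c] := @MVT R _ (fun y => g' y - f' y) 0 x x0 (fun y _ => dh y).
  by apply: continuous_subspaceT => y; exact: (is_derive_cont (dh y)).
rewrite in_itv/= => /andP[c0 _]; rewrite fg0 subrr subr0 => E.
by rewrite -subr_ge0 E mulr_ge0// subr_ge0 ?fg' ?ltW.
Qed.

End derivatives.

Ltac der := eapply is_derive_eq;
  [ repeat first [ apply: is_derive_fcst | apply: is_derive_fid | apply: is_derive_expn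
    | apply: is_derive_sin | apply: is_derive_cos
    | eapply is_derive_fD | eapply is_derive_fN | eapply is_derive_fM ]
  | cbn [predn] ].

Section sinc_bounds.
Variable R : realType.
Implicit Types (x z u : R).

Lemma sin_le x : 0 <= x -> sin x <= x.
Proof.
move=> x0; apply: (@le_of_derive R sin id cos (fun=> 1) x x0) => [y| |y _].
- by split; [der; field|der; field].
- by rewrite sin0.
- exact: cos_le1.
Qed.

Lemma cos_ge x : 0 <= x -> 1 - 2^-1 * x ^+ 2 <= cos x.
Proof.
move=> x0; apply: (@le_of_derive R (fun x => 1 - 2^-1 * x ^+ 2) cos (fun x => - x) (fun x => - sin x) x x0) => [y| |y y0].
- by split; [der; field|der; field].
- by rewrite cos0; ring.
- by rewrite lerN2 sin_le.
Qed.

Lemma sin_ge x : 0 <= x -> x - 6^-1 * x ^+ 3 <= sin x.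
Proof.
move=> x0; apply: (@le_of_derive R (fun x => x - 6^-1 * x ^+ 3) sin (fun x => 1 - 2^-1 * x ^+ 2) cos x x0) => [y| |y y0].
- by split; [der; field|der; field].
- by rewrite sin0; ring.
- exact: cos_ge.
Qed.

Lemma cos_le x : 0 <= x -> cos x <= 1 - 2^-1 * x ^+ 2 + 24^-1 * x ^+ 4.
Proof.
move=> x0; apply: (@le_of_derive R cos (fun x => 1 - 2^-1 * x ^+ 2 + 24^-1 * x ^+ 4)
  (fun x => - sin x) (fun x => - (x - 6^-1 * x ^+ 3)) x x0) => [y| |y y0].
- by split; [der; field|der; field].
- by rewrite cos0; ring.
- by rewrite lerN2 sin_ge.
Qed.

Lemma sin_le5 x : 0 <= x -> sin x <= x - 6^-1 * x ^+ 3 + 120^-1 * x ^+ 5.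
Proof.
move=> x0; apply: (@le_of_derive R sin (fun x => x - 6^-1 * x ^+ 3 + 120^-1 * x ^+ 5) cos
  (fun x => 1 - 2^-1 * x ^+ 2 + 24^-1 * x ^+ 4) x x0) => [y| |y y0].
- by split; [der; field|der; field].
- by rewrite sin0; ring.
- exact: cos_le.
Qed.

Lemma cos_ge6 x : 0 <= x ->
  1 - 2^-1 * x ^+ 2 + 24^-1 * x ^+ 4 - 720^-1 * x ^+ 6 <= cos x.
Proof.
move=> x0; apply: (@le_of_derive R
  (fun x => 1 - 2^-1 * x ^+ 2 + 24^-1 * x ^+ 4 - 720^-1 * x ^+ 6) cos
  (fun x => - (x - 6^-1 * x ^+ 3 + 120^-1 * x ^+ 5)) (fun x => - sin x) x x0) => [y| |y y0].
- by split; [der; field|der; field].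
- by rewrite cos0; ring.
- by rewrite lerN2 sin_le5.
Qed.

Lemma sin_ge7 x : 0 <= x ->
  x - 6^-1 * x ^+ 3 + 120^-1 * x ^+ 5 - 5040^-1 * x ^+ 7 <= sin x.
Proof.
move=> x0; apply: (@le_of_derive R
  (fun x => x - 6^-1 * x ^+ 3 + 120^-1 * x ^+ 5 - 5040^-1 * x ^+ 7) sin
  (fun x => 1 - 2^-1 * x ^+ 2 + 24^-1 * x ^+ 4 - 720^-1 * x ^+ 6) cos x x0) => [y| |y y0].
- by split; [der; field|der; field].
- by rewrite sin0; ring.
- exact: cos_ge6.
Qed.

Lemma sin_geN x : 0 <= x -> - x <= sin x.
Proof.
move=> x0; apply: (@le_of_derive R (fun x => - x) sin (fun=> -1) cos x x0) => [y| |y _].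
- by split; [der; field|der; field].
- by rewrite sin0 oppr0.
- exact: cos_geN1.
Qed.

(* [bsin1 x / (2 x^3)] and [bsin2 x / (4 x^5)] are, up to sign, the first two derivatives of
   [sin (sqrt z) / sqrt z] at [z = x^2]. *)
Definition bsin1 x := sin x - x * cos x.
Definition bsin2 x := 3 * bsin1 x - x ^+ 2 * sin x.

Lemma is_derive_bsin1 x : is_derive x 1 bsin1 (x * sin x).
Proof. by der; ring. Qed.

Lemma is_derive_bsin2 x : is_derive x 1 bsin2 (x * bsin1 x).
Proof.
rewrite /bsin2; eapply is_derive_eq.
  eapply is_derive_fD; last eapply is_derive_fN.
    eapply is_derive_fM; [exact: is_derive_fcst|exact: is_derive_bsin1].
  by der.
by rewrite /bsin1/=; ring.
Qed.

Lemma bsin1_le x : 0 <= x -> bsin1 x <= 3^-1 * x ^+ 3.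
Proof.
move=> x0; apply: (@le_of_derive R bsin1 (fun x => 3^-1 * x ^+ 3) (fun x => x * sin x) (fun x => x ^+ 2) x x0) => [y| |y y0].
- by split; [exact: is_derive_bsin1|der; field].
- by rewrite /bsin1 sin0; ring.
- by rewrite expr2 ler_wpM2l// sin_le.
Qed.

Lemma bsin1_geN x : 0 <= x -> - (3^-1 * x ^+ 3) <= bsin1 x.
Proof.
move=> x0; apply: (@le_of_derive R (fun x => - (3^-1 * x ^+ 3)) bsin1 (fun x => - x ^+ 2) (fun x => x * sin x) x x0) => [y| |y y0].
- by split; [der; field|exact: is_derive_bsin1].
- by rewrite /bsin1 sin0; ring.
- by rewrite expr2 -mulrN ler_wpM2l// sin_geN.
Qed.

Lemma bsin1_ge x : 0 <= x -> 3^-1 * x ^+ 3 - 30^-1 * x ^+ 5 <= bsin1 x.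
Proof.
move=> x0; apply: (@le_of_derive R (fun x => 3^-1 * x ^+ 3 - 30^-1 * x ^+ 5) bsin1
  (fun x => x * (x - 6^-1 * x ^+ 3)) (fun x => x * sin x) x x0) => [y| |y y0].
- by split; [der; field|exact: is_derive_bsin1].
- by rewrite /bsin1 sin0; ring.
- by rewrite ler_wpM2l// sin_ge.
Qed.

Lemma bsin2_le x : 0 <= x -> bsin2 x <= 15^-1 * x ^+ 5.
Proof.
move=> x0; apply: (@le_of_derive R bsin2 (fun x => 15^-1 * x ^+ 5) (fun x => x * bsin1 x) (fun x => x * (3^-1 * x ^+ 3)) x x0) => [y| |y y0].
- by split; [exact: is_derive_bsin2|der; field].
- by rewrite /bsin2 /bsin1 sin0; ring.
- by rewrite ler_wpM2l// bsin1_le.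
Qed.

Lemma bsin2_geN x : 0 <= x -> - (15^-1 * x ^+ 5) <= bsin2 x.
Proof.
move=> x0; apply: (@le_of_derive R (fun x => - (15^-1 * x ^+ 5)) bsin2 (fun x => x * - (3^-1 * x ^+ 3)) (fun x => x * bsin1 x) x x0) => [y| |y y0].
- by split; [der; field|exact: is_derive_bsin2].
- by rewrite /bsin2 /bsin1 sin0; ring.
- by rewrite ler_wpM2l// bsin1_geN.
Qed.

Lemma bsin2_ge x : 0 <= x -> 15^-1 * x ^+ 5 - 210^-1 * x ^+ 7 <= bsin2 x.
Proof.
move=> x0; apply: (@le_of_derive R (fun x => 15^-1 * x ^+ 5 - 210^-1 * x ^+ 7) bsin2
  (fun x => x * (3^-1 * x ^+ 3 - 30^-1 * x ^+ 5)) (fun x => x * bsin1 x) x x0) => [y| |y y0].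
- by split; [der; field|exact: is_derive_bsin2].
- by rewrite /bsin2 /bsin1 sin0; ring.
- by rewrite ler_wpM2l// bsin1_ge.
Qed.

(** The cardinal sine as a function of the square of its argument. The value 1 for negative [z] is a
    default that keeps the function continuous on the whole line; it has a corner at 0. *)
Definition sqsinc z : R := if z <= 0 then 1 else sin (Num.sqrt z) / Num.sqrt z.
(** The derivatives of [sqsinc] for positive [z]. At 0 both quotients have the default value 0 and
    not the limits [- 1/6] and [1/60], so the bounds below are for [0 < z]. *)
Definition sqsinc1 z : R := - (bsin1 (Num.sqrt z) / (2 * Num.sqrt z ^+ 3)).
Definition sqsinc2 z : R := bsin2 (Num.sqrt z) / (4 * Num.sqrt z ^+ 5).

Lemma is_derive_sqsinc z : 0 < z -> is_derive z 1 sqsinc (sqsinc1 z).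
Proof.
move=> z0.
have s0 : 0 < Num.sqrt z by rewrite sqrtr_gt0.
apply: (@near_eq_is_derive _ _ _ (fun z => sin (Num.sqrt z) * (Num.sqrt z)^-1)).
- near=> w; rewrite /sqsinc ifF//; apply/negbTE; rewrite -ltNge.
  by near: w; exact: lt_nbhsr.
- eapply is_derive_eq.
    eapply is_derive_fM.
      eapply is_derive_fcomp; [exact: is_derive_sin|exact: is_derive1_sqrt].
    eapply is_derive_fV; [exact: is_derive1_sqrt|by rewrite gt_eqF].
  rewrite /sqsinc1 /bsin1; field; by rewrite gt_eqF.
Unshelve. all: by end_near. Qed.

Lemma is_derive_sqsinc1 z : 0 < z -> is_derive z 1 sqsinc1 (sqsinc2 z).
Proof.
move=> z0.
have s0 : 0 < Num.sqrt z by rewrite sqrtr_gt0.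
rewrite /sqsinc1; eapply is_derive_eq.
  eapply is_derive_fN, is_derive_fM.
    eapply is_derive_fcomp; [exact: is_derive_bsin1|exact: is_derive1_sqrt].
  eapply is_derive_fV; last by rewrite mulf_neq0// expf_neq0// gt_eqF.
  eapply is_derive_fM; first exact: is_derive_fcst.
  eapply (@is_derive_fcomp R (fun y => y ^+ 3)); [exact: is_derive_expn|exact: is_derive1_sqrt].
rewrite /sqsinc2 /bsin2 /bsin1/=; field; by rewrite gt_eqF.
Qed.

Lemma sqsinc0 : sqsinc 0 = 1. Proof. by rewrite /sqsinc lexx. Qed.

Lemma sqsincE x : sqsinc (x ^+ 2) = if x == 0 then 1 else sin x / x.
Proof.
rewrite /sqsinc exprn_even_le0//=; case: eqP => // /eqP x0.
rewrite sqrtr_sqr; have [x1|x1] := leP 0 x; first by rewrite ger0_norm.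
by rewrite ltr0_norm// sinN invrN mulrNN.
Qed.

Lemma sqr_sqrt z : 0 < z -> exists2 x, 0 < x & z = x ^+ 2.
Proof. by move=> z0; exists (Num.sqrt z); rewrite ?sqrtr_gt0// sqr_sqrtr// ltW. Qed.

Lemma sqsinc_norm z : `|sqsinc z| <= 1.
Proof.
rewrite /sqsinc; case: ifPn => [_|]; first by rewrite normr1.
rewrite -ltNge => /sqr_sqrt[x x0 ->]; rewrite sqrtr_sqr (gtr0_norm x0).
rewrite normrM normfV (gtr0_norm x0) ler_pdivrMr// mul1r ler_norml.
by rewrite sin_le ?sin_geN// ltW.
Qed.

Lemma sqsinc_sqr_le z : 0 < z -> sqsinc z ^+ 2 <= z^-1.
Proof.
move=> z0; rewrite /sqsinc [z <= 0]leNgt z0/= expr_div_n (sqr_sqrtr (ltW z0)).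
by rewrite ler_pdivrMr// mulVf ?gt_eqF// sin2cos2 lerBlDr lerDl sqr_ge0.
Qed.

Lemma sqsinc_ge z : 0 <= z -> 1 - 6^-1 * z <= sqsinc z.
Proof.
rewrite le_eqVlt => /predU1P[<-|]; first by rewrite sqsinc0 mulr0 subr0.
move=> z0; rewrite /sqsinc [z <= 0]leNgt z0/=; move: z0 => /sqr_sqrt[x x0 ->].
rewrite sqrtr_sqr (gtr0_norm x0) ler_pdivlMr//; apply: le_trans (sin_ge (ltW x0)).
by rewrite le_eqVlt; apply/orP; left; apply/eqP; ring.
Qed.

Lemma sqsinc_le z : 0 <= z -> sqsinc z <= 1 - 6^-1 * z + 120^-1 * z ^+ 2.
Proof.
rewrite le_eqVlt => /predU1P[<-|]; first by rewrite sqsinc0; lra.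
move=> z0; rewrite /sqsinc [z <= 0]leNgt z0/=; move: z0 => /sqr_sqrt[x x0 ->].
rewrite sqrtr_sqr (gtr0_norm x0) ler_pdivrMr//; apply: le_trans (sin_le5 (ltW x0)) _.
by rewrite le_eqVlt; apply/orP; left; apply/eqP; ring.
Qed.

Lemma sqsinc_ge3 z : 0 <= z ->
  1 - 6^-1 * z + 120^-1 * z ^+ 2 - 5040^-1 * z ^+ 3 <= sqsinc z.
Proof.
rewrite le_eqVlt => /predU1P[<-|]; first by rewrite sqsinc0; lra.
move=> z0; rewrite /sqsinc [z <= 0]leNgt z0/=; move: z0 => /sqr_sqrt[x x0 ->].
rewrite sqrtr_sqr (gtr0_norm x0) ler_pdivlMr//; apply: le_trans (sin_ge7 (ltW x0)).
by rewrite le_eqVlt; apply/orP; left; apply/eqP; ring.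
Qed.

Lemma sqsinc1_bounds z : 0 < z -> - 6^-1 <= sqsinc1 z <= - 6^-1 + 60^-1 * z.
Proof.
rewrite /sqsinc1 => /sqr_sqrt[x x0 ->]; rewrite sqrtr_sqr (gtr0_norm x0).
have c0 : 0 < 2 * x ^+ 3 by rewrite mulr_gt0// exprn_gt0.
apply/andP; split.
  rewrite lerN2 ler_pdivrMr//; apply: le_trans (bsin1_le (ltW x0)) _.
  by rewrite le_eqVlt; apply/orP; left; apply/eqP; field.
rewrite lerNl ler_pdivlMr//; apply: le_trans (bsin1_ge (ltW x0)).
by rewrite le_eqVlt; apply/orP; left; apply/eqP; field.
Qed.

Lemma sqsinc1_norm z : 0 < z -> `|sqsinc1 z| <= 6^-1.
Proof.
rewrite /sqsinc1 => /sqr_sqrt[x x0 ->]; rewrite sqrtr_sqr (gtr0_norm x0).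
have c0 : 0 < 2 * x ^+ 3 by rewrite mulr_gt0// exprn_gt0.
rewrite normrN normrM normfV (gtr0_norm c0) ler_pdivrMr// ler_norml.
have -> : 6^-1 * (2 * x ^+ 3) = 3^-1 * x ^+ 3 by field.
by rewrite bsin1_le ?bsin1_geN// ltW.
Qed.

Lemma sqsinc2_bounds z : 0 < z -> 60^-1 - 840^-1 * z <= sqsinc2 z <= 60^-1.
Proof.
rewrite /sqsinc2 => /sqr_sqrt[x x0 ->]; rewrite sqrtr_sqr (gtr0_norm x0).
have c0 : 0 < 4 * x ^+ 5 by rewrite mulr_gt0// exprn_gt0.
apply/andP; split.
  rewrite ler_pdivlMr//; apply: le_trans (bsin2_ge (ltW x0)).
  by rewrite le_eqVlt; apply/orP; left; apply/eqP; field.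
rewrite ler_pdivrMr//; apply: le_trans (bsin2_le (ltW x0)) _.
by rewrite le_eqVlt; apply/orP; left; apply/eqP; field.
Qed.

Lemma sqsinc2_norm z : 0 < z -> `|sqsinc2 z| <= 60^-1.
Proof.
rewrite /sqsinc2 => /sqr_sqrt[x x0 ->]; rewrite sqrtr_sqr (gtr0_norm x0).
have c0 : 0 < 4 * x ^+ 5 by rewrite mulr_gt0// exprn_gt0.
rewrite normrM normfV (gtr0_norm c0) ler_pdivrMr// ler_norml.
have -> : 60^-1 * (4 * x ^+ 5) = 15^-1 * x ^+ 5 by field.
by rewrite bsin2_le ?bsin2_geN// ltW.
Qed.

Lemma continuous_sqsinc : continuous sqsinc.
Proof.
move=> z; have [z0|z0|->] := ltgtP z 0.
- apply: (near_cst_continuous (1 : R)).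
  near=> w; rewrite /sqsinc ifT//; apply: ltW.
  by near: w; exact: lt_nbhsl.
- exact: is_derive_cont (is_derive_sqsinc z0).
- apply/cvgrPdist_le => e e0; near=> w; rewrite sqsinc0.
  have [w0|w0] := leP w 0; first by rewrite /sqsinc w0 subrr normr0 ltW.
  have we : w <= e.
    have : `|0 - w| <= e by near: w; exact: cvgr_dist_le.
    by rewrite sub0r normrN gtr0_norm.
  have := sqsinc_ge (ltW w0); have := sqsinc_norm w; rewrite !ler_norml => /andP[_ ?] ?.
  by apply/andP; split; lra.
Unshelve. all: by end_near. Qed.

(* Cauchy's mean value theorem in [delta ^+ 2], then the usual one for the bracket
   [s al * s' be - s' al * s be], which vanishes at [be = al]. *)
Lemma sqsinc_pair_MVT (m v d d' : R) : 0 < v -> 0 <= d' -> d' < d -> d <= m ->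
  exists al be : R, [/\ 0 < al, al <= be, be <= 2 * m * v &
   sqsinc ((m - d) * v) * sqsinc ((m + d) * v) - sqsinc ((m - d') * v) * sqsinc ((m + d') * v)
   = (d ^+ 2 - d' ^+ 2) * v ^+ 2 * (sqsinc al * sqsinc2 be - sqsinc1 al * sqsinc1 be)].
Proof.
move=> v0 d'0 d'd dm.
pose F (y : R) := sqsinc ((m - y) * v) * sqsinc ((m + y) * v).
pose F' (y : R) := v * (sqsinc ((m - y) * v) * sqsinc1 ((m + y) * v)
                 - sqsinc1 ((m - y) * v) * sqsinc ((m + y) * v)).
have dF y : y \in `]d', d[ -> is_derive y 1 F (F' y).
  rewrite in_itv/= => /andP[y1 y2]; rewrite /F; eapply is_derive_eq.
    eapply is_derive_fM.
      eapply (@is_derive_fcomp R sqsinc (fun y => (m - y) * v)).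
        by apply: is_derive_sqsinc; rewrite mulr_gt0// subr_gt0 (lt_le_trans y2).
      by der.
    eapply (@is_derive_fcomp R sqsinc (fun y => (m + y) * v)).
      by apply: is_derive_sqsinc; rewrite mulr_gt0//; lra.
    by der.
  by rewrite /F'; ring.
(* At the end point [y = d] the argument [m - d] may be 0, the corner of [sqsinc]; continuity is all
   that the mean value theorem asks there. *)
have cl (e : R) : continuous (fun y : R => sqsinc ((m + e * y) * v)).
  move=> y; apply: (@continuous_comp _ _ _ (fun y : R => (m + e * y) * v) sqsinc).
    by apply: is_derive_cont; der.
  exact: continuous_sqsinc.
have cF : {within `[d', d], continuous F}.
  apply: continuous_subspaceT => y.
  rewrite /F (_ : (fun _ => _) = fun y => sqsinc ((m + -1 * y) * v) * sqsinc ((m + 1 * y) * v)).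
    by apply: cvgM; exact: cl.
  by apply/funext => w; rewrite mulN1r mul1r.
have [|y|y|c] := @cauchy_MVT R F F' (fun y => y ^+ 2) (fun y => 2 * y) d' d d'd cF.
- by apply: continuous_subspaceT => y; apply: (@is_derive_cont R (fun y => y ^+ 2)); der.
- by move=> _; der; field.
- by rewrite in_itv/= => /andP[y1 _]; rewrite mulf_neq0// gt_eqF// (le_lt_trans d'0).
rewrite in_itv/= => /andP[c1 c2] E.
have c0 : 0 < c by apply: le_lt_trans c1.
have dd : d ^+ 2 - d' ^+ 2 != 0.
  by rewrite subr_eq0 gt_eqF// ltr_sqr ?nnegrE//; apply: ltW; apply: le_lt_trans d'd.
set al := (m - c) * v; set be := (m + c) * v.
have al0 : 0 < al by rewrite mulr_gt0// subr_gt0 (lt_le_trans c2).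
have albe : al < be by rewrite ltr_pM2r//; lra.
pose N (y : R) := sqsinc al * sqsinc1 y - sqsinc1 al * sqsinc y.
pose N' (y : R) := sqsinc al * sqsinc2 y - sqsinc1 al * sqsinc1 y.
have dN (y : R) : 0 < y -> is_derive y 1 N (N' y).
  move=> y0; rewrite /N; eapply is_derive_eq.
    eapply is_derive_fD; last eapply is_derive_fN.
      eapply is_derive_fM; [exact: is_derive_fcst|exact: is_derive_sqsinc1].
    eapply is_derive_fM; [exact: is_derive_fcst|exact: is_derive_sqsinc].
  by rewrite /N'; ring.
have dN' (y : R) : y \in `]al, be[ -> is_derive y 1 N (N' y).
  by rewrite in_itv/= => /andP[y1 _]; apply: dN; exact: lt_trans y1.
have cN : {within `[al, be], continuous N}.
  apply: continuous_in_subspaceT => y; rewrite inE/= in_itv/= => /andP[y1 _].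
  have y0 : 0 < y by exact: lt_le_trans y1.
  exact: is_derive_cont (dN y y0).
have [ze] := MVT albe dN' cN.
rewrite in_itv/= => /andP[z1 z2] NE.
exists al, ze; split => //; first exact: ltW.
  by rewrite (le_trans (ltW z2))// ler_pM2r//; lra.
move: E => /(congr1 (fun y => y * (d ^+ 2 - d' ^+ 2))); rewrite divfK// -/(F d) -/(F d') => <-.
have -> : F' c = v * (N be - N al) by rewrite /F' /N -/al -/be; ring.
rewrite NE /N' /be /al; field; by rewrite gt_eqF.
Qed.

End sinc_bounds.

(** * The change of the integrand under a move of two coordinates *)

Section product_bounds.
Variable R : realType.
Implicit Types (v y z m : R).

Lemma is_derive_expRN (x : R) : is_derive x 1 (fun y => expR (- y)) (- expR (- x)).
Proof.
eapply is_derive_eq.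
  eapply is_derive_fcomp; [exact: is_derive_expR|apply: is_derive_fN; exact: is_derive_fid].
by rewrite mulrN1.
Qed.

Lemma expRN_ge1 y : 1 - y <= expR (- y).
Proof. exact: expR_ge1Dx. Qed.

Lemma expRN_le2 y : 0 <= y -> expR (- y) <= 1 - y + 2^-1 * y ^+ 2.
Proof.
move=> y0; apply: (@le_of_derive _ (fun y => expR (- y)) (fun y => 1 - y + 2^-1 * y ^+ 2)
   (fun y => - expR (- y)) (fun y => - (1 - y)) y y0) => [x| |x x0].
- by split; [exact: is_derive_expRN|der; field].
- by rewrite oppr0 expR0; ring.
- by rewrite lerN2 expRN_ge1.
Qed.

Lemma expRN_ge3 y : 0 <= y -> 1 - y + 2^-1 * y ^+ 2 - 6^-1 * y ^+ 3 <= expR (- y).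
Proof.
move=> y0; apply: (@le_of_derive _ (fun y => 1 - y + 2^-1 * y ^+ 2 - 6^-1 * y ^+ 3)
   (fun y => expR (- y)) (fun y => - (1 - y + 2^-1 * y ^+ 2)) (fun y => - expR (- y)) y y0) => [x| |x x0].
- by split; [der; field|exact: is_derive_expRN].
- by rewrite oppr0 expR0; ring.
- by rewrite lerN2 expRN_le2.
Qed.

(** The two Taylor polynomials differ by [z ^ 2 * (1/180 - z / 1296)], which is non-negative up to
    [z = 7.2]. *)
Lemma sqsinc_le_expR z : 0 <= z <= 7 -> sqsinc z <= expR (- (6^-1 * z)).
Proof.
move=> /andP[z0 z7]; apply: le_trans (sqsinc_le z0) _.
apply: le_trans (expRN_ge3 _); last by rewrite mulr_ge0.
rewrite -subr_ge0 [X in 0 <= X](_ : _ = z ^+ 2 * (180^-1 - 1296^-1 * z)); last by field.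
by apply: mulr_ge0; [exact: sqr_ge0|lra].
Qed.

Lemma sqsinc_ge0 z : 0 <= z <= 6 -> 0 <= sqsinc z.
Proof. by move=> /andP[z0 z6]; apply: le_trans (sqsinc_ge z0); lra. Qed.

(** The logarithm of [sqsinc z * exp (z / 6)] starts with [- z ^ 2 / 180]; the coefficient [1/100]
    leaves room for the Taylor remainders. The range [101/50] is twice [101/100], the largest value
    of [x k * v] when [v <= 2 n]. *)
Lemma sqsinc_ge_expR z : 0 <= z <= 101/50 ->
  expR (- (6^-1 * z)) * (1 - 100^-1 * z ^+ 2) <= sqsinc z.
Proof.
move=> /andP[z0 z2]; apply: le_trans (sqsinc_ge3 z0).
have y0 : 0 <= 6^-1 * z by rewrite mulr_ge0.
have p0 : 0 <= 1 - 100^-1 * z ^+ 2 by nra.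
apply: le_trans (ler_wpM2r p0 (expRN_le2 y0)) _.
have h2 : 0 <= z ^+ 2 := sqr_ge0 z.
have h3 : 0 <= 225^-1 - 5040^-1 * z - 600^-1 * z + 7200^-1 * z ^+ 2 by lra.
have H := mulr_ge0 h2 h3.
by rewrite -subr_ge0; apply: le_trans H _; rewrite le_eqVlt; apply/orP; left; apply/eqP; field.
Qed.

(** The Weierstrass product inequality; the induction carries along that the product lies in
    [0, 1]. *)
Lemma prod_ge_1Bsum (I : Type) (r : seq I) (P : pred I) (f : I -> R) :
  (forall k, P k -> 0 <= f k <= 1) ->
  1 - \sum_(k <- r | P k) f k <= \prod_(k <- r | P k) (1 - f k).
Proof.
move=> f01; suff : 0 <= \prod_(k <- r | P k) (1 - f k) <= 1 /\
    1 - \sum_(k <- r | P k) f k <= \prod_(k <- r | P k) (1 - f k) by case.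
elim/big_rec2: _ => [|k p s Pk [/andP[p0 p1] ps]]; first by rewrite subr0 ler01 lexx.
have /andP[f0 f1] := f01 k Pk; split; last by nra.
by apply/andP; split; nra.
Qed.

Variables (d n : nat) (K : pred 'I_d) (x : 'I_d -> R) (m : R).
Hypotheses (n124 : (124 <= n)%N) (m0 : 0 <= m) (mn : m <= 101 / 100 / n%:R).
Hypothesis x_bounds : forall k, K k -> 0 <= x k <= 101 / 100 / n%:R.
Hypothesis x_sum : \sum_(k | K k) x k = 1 - 2 * m.

Let A v := \prod_(k | K k) sqsinc (x k * v).
Let n0 : 0 < n%:R :> R. Proof. by rewrite ltr0n (leq_trans _ n124). Qed.

(** [K] is the set of coordinates left alone by a move and [m] the mean of the two moved ones. Since
    the former sum to [1 - 2 m], multiplying the bounds [exp (- x_k v / 6)] gives the Gaussian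
    weight and the correction [exp (m v / 3)]. *)
Lemma prod_le_expR v : 0 <= v <= 2 * n%:R -> A v <= expR (- (6^-1 * v)) * expR (3^-1 * (m * v)).
Proof.
move=> /andP[v0 vn].
rewrite -expRD (_ : _ + _ = - (6^-1 * ((\sum_(k | K k) x k) * v))); last by rewrite x_sum; field.
rewrite mulr_suml mulr_sumr -sumrN expR_sum; apply: ler_prod => k Kk.
have /andP[x0 x1] := x_bounds Kk.
have b : 0 <= x k * v <= 101 / 50.
  rewrite mulr_ge0//=; apply: le_trans (ler_pM x0 v0 x1 vn) _.
  by rewrite le_eqVlt; apply/orP; left; apply/eqP; field; rewrite gt_eqF.
have /andP[b0 b1] := b.
by rewrite sqsinc_ge0 ?b0/= ?sqsinc_le_expR ?b0//; lra.
Qed.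

Lemma prod_ge0 v : 0 <= v <= 2 * n%:R -> 0 <= A v.
Proof.
move=> /andP[v0 vn]; apply: prodr_ge0 => k Kk.
have /andP[x0 x1] := x_bounds Kk.
apply: sqsinc_ge0; rewrite mulr_ge0//=; apply: le_trans (ler_pM x0 v0 x1 vn) _.
have -> : 101 / 100 / n%:R * (2 * n%:R) = 101 / 50 :> R by field; rewrite gt_eqF.
by lra.
Qed.

Lemma sum_sqr_le : \sum_(k | K k) x k ^+ 2 <= 101 / 100 / n%:R.
Proof.
apply: (@le_trans _ _ (\sum_(k | K k) (101 / 100 / n%:R * x k))).
  apply: ler_sum => k Kk; have /andP[x0 x1] := x_bounds Kk.
  by rewrite expr2 ler_wpM2r.
have c0 : 0 <= 101 / 100 / n%:R :> R by rewrite divr_ge0// ltW.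
rewrite -mulr_sumr x_sum; apply: ler_piMr => //.
by rewrite lerBlDr lerDl mulr_ge0.
Qed.

(** Each factor loses at most [1 - (x_k v) ^ 2 / 100]. The Weierstrass inequality collects these
    losses, and the sum of the [x_k ^ 2] is at most the largest admissible [x_k]. *)
Lemma prod_ge_expR v : 0 <= v <= 2 * n%:R ->
  expR (- (6^-1 * v)) * expR (3^-1 * (m * v)) * (1 - 100^-1 * (101 / 100 / n%:R * v ^+ 2)) <= A v.
Proof.
move=> /andP[v0 vn].
have b k : K k -> 0 <= x k * v <= 101 / 50.
  move=> Kk; have /andP[x0 x1] := x_bounds Kk.
  rewrite mulr_ge0//=; apply: le_trans (ler_pM x0 v0 x1 vn) _.
  by rewrite le_eqVlt; apply/orP; left; apply/eqP; field; rewrite gt_eqF.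
rewrite -expRD (_ : _ + _ = - (6^-1 * ((\sum_(k | K k) x k) * v))); last by rewrite x_sum; field.
rewrite mulr_suml mulr_sumr -sumrN expR_sum.
apply: (@le_trans _ _ (\prod_(k | K k) (expR (- (6^-1 * (x k * v))) * (1 - 100^-1 * (x k * v) ^+ 2)))).
  rewrite big_split/= ler_wpM2l//; first by apply: prodr_ge0 => k _; exact: expR_ge0.
  apply: le_trans (prod_ge_1Bsum _ _); last first.
    by move=> k /b /andP[b0 b1]; apply/andP; split; nra.
  rewrite lerD2l lerN2 -mulr_sumr ler_pM2l//.
  under eq_bigr do rewrite exprMn.
  by rewrite -mulr_suml ler_wpM2r ?sqr_ge0// sum_sqr_le.
apply: ler_prod => k Kk; have /andP[b0 b1] := b k Kk.
rewrite mulr_ge0 ?expR_ge0 ?sqsinc_ge_expR ?b0//=.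
nra.
Qed.

Lemma mv_le v : 0 <= v <= 2 * n%:R -> 0 <= m * v <= 101 / 50.
Proof.
move=> /andP[v0 vn]; rewrite mulr_ge0//=; apply: le_trans (ler_pM m0 v0 mn vn) _.
by rewrite le_eqVlt; apply/orP; left; apply/eqP; field; rewrite gt_eqF.
Qed.

(** The exponent is at most [101/150]; that its exponential is below 2 is checked on the reciprocal
    with the cubic Taylor bound. *)
Lemma expR_mv_le2 v : 0 <= v <= 2 * n%:R -> expR (3^-1 * (m * v)) <= 2.
Proof.
move=> /mv_le /andP[b0 b1].
set y := 3^-1 * (m * v).
have y0 : 0 <= y by rewrite mulr_ge0.
have y1 : y <= 101 / 150 by rewrite /y; lra.
have y1' : 0 <= 101 / 150 :> R by lra.
have := expRN_ge3 y1'.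
rewrite -[expR y]invrK -expRN -[2]invrK lef_pV2 ?posrE ?expR_gt0 ?invr_gt0//.
move=> H; apply: (@le_trans _ _ (expR (- (101/150)))); first by lra.
by rewrite ler_expR lerN2.
Qed.

(** The term in [v] comes from [exp (m v / 3) - 1 <= 2 m v / 3] with [m <= 1.01 / n]. The term in
    [v ^ 2] comes from the lower bound, whose loss [1.01 v ^ 2 / (100 n)] is multiplied by an
    exponential of at most 2. *)
Lemma prod_sub_expR v : 0 <= v <= 2 * n%:R ->
  `|A v - expR (- (6^-1 * v))| <=
  expR (- (6^-1 * v)) * (n%:R^-1 * (101 / 150 * v + 101 / 5000 * v ^+ 2)).
Proof.
move=> b; have /andP[v0 vn] := b.
have := prod_le_expR b; have := prod_ge_expR b.
have := expR_mv_le2 b; have := mv_le b => /andP[c0 c1].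
have := expRN_ge1 (3^-1 * (m * v)); have := expR_ge1Dx (3^-1 * (m * v)).
have := expR_gt0 (- (6^-1 * v)).
have := expRxMexpNx_1 (3^-1 * (m * v)).
rewrite expRN.
set E := expR (3^-1 * (m * v)); set E' := E^-1; set w := expR _.
have -> : 101 / 100 / n%:R * v ^+ 2 = 101 / 100 * (n%:R^-1 * v ^+ 2) by rewrite mulrA.
have mq : m * v <= 101/100 * (n%:R^-1 * v) by rewrite mulrA ler_wpM2r.
have q0 : 0 <= n%:R^-1 * v by rewrite mulr_ge0// invr_ge0 ltW.
have q1 : 0 <= n%:R^-1 * v ^+ 2 by rewrite mulr_ge0 ?sqr_ge0// invr_ge0 ltW.
have -> : n%:R^-1 * (101 / 150 * v + 101 / 5000 * v ^+ 2) =
  101 / 150 * (n%:R^-1 * v) + 101 / 5000 * (n%:R^-1 * v ^+ 2) by ring.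
move: q0 q1 mq; set q := n%:R^-1 * v; set q2 := n%:R^-1 * v ^+ 2; set y := m * v.
move=> q0 q20 yq EE w0 E1 E2 E3 Alo Aup.
have E4 : E - 1 <= 2 * (3^-1 * y).
  have : E * (1 - 3^-1 * y) <= E * E' by rewrite ler_wpM2l// expR_ge0.
  have := mulr_ge0 (c0 : 0 <= y) (_ : 0 <= 2 - E); rewrite subr_ge0 => /(_ E3); rewrite EE; lra.
have y0 : 0 <= y by exact: c0.
rewrite ler_norml; apply/andP; split.
  have H1 : w * (E - 1) >= 0 by apply: mulr_ge0; lra.
  have H2 : w * q2 * (2 - E) >= 0 by rewrite !mulr_ge0 ?subr_ge0 ?(ltW w0).
  have H3 : w * q >= 0 by rewrite mulr_ge0 ?(ltW w0).
  by lra.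
have H1 : 0 <= w * (2 * (3^-1 * (101/100 * q)) - (E - 1)) by apply: mulr_ge0; lra.
have H2 : w * q2 >= 0 by rewrite mulr_ge0 ?(ltW w0).
by lra.
Qed.

(* Pairs of indices bound the product by powers of [(x_k v)^-1], through its square. *)
Lemma prod_tail v (M : nat) :
  (n - 2 <= #|[set k | K k & (99 / 100 / n%:R <= x k)%R]|)%N -> 2 * n%:R < v -> (2 * M <= n - 2)%N ->
  `|A v| <= (n%:R / (99 / 100 * v)) ^+ M.
Proof.
move=> x_big vn Mn.
have v0 : 0 < v by apply: lt_trans vn; rewrite mulr_gt0.
set rho := n%:R / (99 / 100 * v).
have rho0 : 0 <= rho by apply: ltW; rewrite divr_gt0// mulr_gt0.
have rho1 : rho <= 1 by rewrite ler_pdivrMr ?mulr_gt0// mul1r; lra.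
rewrite -(@ler_pXn2r _ 2)// ?nnegrE ?exprn_ge0// -exprM.
rewrite real_normK ?num_real// /A -prodrXl (bigID (fun k => 99 / 100 / n%:R <= x k))/=.
rewrite -[leRHS]mulr1 ler_pM//.
- by apply: prodr_ge0 => k _; exact: sqr_ge0.
- by apply: prodr_ge0 => k _; exact: sqr_ge0.
- apply: (@le_trans _ _ (\prod_(k | K k && (99 / 100 / n%:R <= x k)) rho)).
    apply: ler_prod => k /andP[Kk xk].
    have xk0 : 0 < x k by apply: lt_le_trans xk; rewrite !mulr_gt0// invr_gt0.
    rewrite sqr_ge0/=; apply: le_trans (sqsinc_sqr_le _) _; first by rewrite mulr_gt0.
    have -> : rho = (99 / 100 / n%:R * v)^-1.
      by rewrite /rho; field; rewrite !gt_eqF.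
    rewrite lef_pV2 ?posrE ?mulr_gt0 ?invr_gt0//.
    by rewrite ler_pM2r.
  rewrite (eq_bigl (mem [set k | K k & (99 / 100 / n%:R <= x k)%R])); last first.
    by move=> k; rewrite /= !inE.
  rewrite prodr_const ler_wiXn2l//.
  by apply: leq_trans x_big; rewrite mulnC in Mn.
- apply: prodr_ile1 => k _; rewrite sqr_ge0/=.
  by rewrite -real_normK ?num_real// expr_le1// sqsinc_norm.
Qed.

End product_bounds.

(** * Uniform bound on the divided difference of the integrand *)

(** Used for [v > 2 n], where the geometric decay of the product has to absorb a factor [n ^ 4],
    with [n <= 2 k + 9]. At [k = 58] the base of the quartic is 125, and [125 * r ^ 8 <= 5/4]. *)
Lemma geometric_beats_quartic (R : realType) (r : R) (k : nat) : 0 <= r <= 5 / 9 ->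
  (58 <= k)%N -> (2 * k%:R + 9) ^+ 4 * r ^+ k <= 1.
Proof.
move=> /andP[r0 r1] /subnK <-; elim: (k - 58)%N => {k} [|k IH].
  rewrite add0n.
  have r2 : r ^+ 2 <= 31 / 100 by nra.
  have r4 : r ^+ 4 <= 1 / 10.
    by rewrite (exprM r 2 2) expr2; have := sqr_ge0 r; nra.
  have r8 : r ^+ 8 <= 1 / 100.
    by rewrite (exprM r 4 2) expr2; have := exprn_ge0 4 r0; nra.
  have p8 := exprn_ge0 8 r0.
  have r11 : r <= 1 by lra.
  have -> : (2 * 58 + 9) ^+ 4 * r ^+ 58 = ((2 * 58 + 9) * r ^+ 8) ^+ 4 * (r ^+ 8 * r ^+ 18).
    by set b := 2 * 58 + 9; ring.
  have q1 : 0 <= (2 * 58 + 9) * r ^+ 8 <= 5 / 4 by apply/andP; split; lra.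
  have [q2 q3] := andP q1.
  have q4 : ((2 * 58 + 9) * r ^+ 8) ^+ 4 <= (5 / 4) ^+ 4 by apply: lerXn2r q3; rewrite nnegrE.
  have q5 : r ^+ 8 * r ^+ 18 <= 1 / 100 * 1.
    by apply: ler_pM => //; [exact: exprn_ge0|exact: exprn_ile1].
  have q6 : 0 <= r ^+ 8 * r ^+ 18 by rewrite mulr_ge0 ?exprn_ge0.
  apply: (@le_trans _ _ ((5 / 4) ^+ 4 * (1 / 100 * 1))); last by lra.
  by apply: ler_pM => //; exact: exprn_ge0.
apply: le_trans IH; rewrite addSn (exprS r) mulrA; apply: ler_wpM2r; first exact: exprn_ge0.
set a : R := (k + 58)%:R.
have a0 : 58 <= a by rewrite /a natrD lerDr.
have -> : (k + 58).+1%:R = a + 1 :> R by rewrite -natr1.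
(* Incrementing [k] multiplies the quartic by at most [(9/8) ^ 4], which is less than [9/5]. *)
have h : (8 * (2 * (a + 1) + 9)) ^+ 4 <= (9 * (2 * a + 9)) ^+ 4.
  by rewrite lerXn2r// ?nnegrE; lra.
move: h; rewrite !exprMn.
have : 0 <= (2 * a + 9) ^+ 4 by rewrite exprn_ge0//; lra.
have : 0 <= (2 * (a + 1) + 9) ^+ 4 by rewrite exprn_ge0//; lra.
set p := (2 * a + 9) ^+ 4; set p' := (2 * (a + 1) + 9) ^+ 4 => p'0 p0 h.
apply: (@le_trans _ _ (p' * (5 / 9))); first exact: ler_wpM2l.
lra.
Qed.

(** [M] is the exponent in the tail bound. Three of its factors beat the powers of [v] and the
    remaining [M - 3] beat [n ^ 4]; [n = 124] gives exactly [M = 61] and [M - 3 = 58]. *)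
Lemma half_sub2_bounds (n : nat) : (124 <= n)%N ->
  exists M : nat, [/\ (2 * M <= n - 2)%N, (n <= 2 * (M - 3) + 9)%N, (61 <= M)%N & (58 <= M - 3)%N].
Proof. by exists (n - 2)./2; split; lia. Qed.

Section kappa.
Variable R : realType.

(** [G] is the bracket of the mean value form. Its limit at the origin is [1/60 - 1/36 = - 1/90],
    and it is always bounded by [1/60 + 1/36 = 2/45]. *)
Lemma sqsinc_pair_bound (m v d d' : R) : 0 <= v -> 0 <= d' -> d' < d -> d <= m ->
  exists G : R, [/\
   sqsinc ((m - d) * v) * sqsinc ((m + d) * v) - sqsinc ((m - d') * v) * sqsinc ((m + d') * v)
   = (d ^+ 2 - d' ^+ 2) * v ^+ 2 * G,
   `|G| <= 2 / 45 & m * v <= 101 / 50 -> `|G + 90^-1| <= 90^-1 * (m * v)].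
Proof.
move=> + d'0 d'd dm; rewrite le_eqVlt => /predU1P[<-|v0].
  (* For [v = 0] the identity holds for any [G]; the limit value satisfies both bounds. *)
  exists (- 90^-1); split; first by rewrite !mulr0 expr0n/= mulr0 mul0r subrr.
    by rewrite normrN ger0_norm; lra.
  by rewrite addNr normr0 mulr0.
have [al [be [al0 albe beZ ->]]] := sqsinc_pair_MVT v0 d'0 d'd dm.
have be0 := lt_le_trans al0 albe.
exists (sqsinc al * sqsinc2 be - sqsinc1 al * sqsinc1 be); split => //.
  apply: le_trans (ler_normB _ _) _.
  rewrite (normrM (sqsinc al)) (normrM (sqsinc1 al)).
  have -> : 2 / 45 = 1 * 60^-1 + 6^-1 * 6^-1 :> R by field.
  by rewrite lerD// ler_pM// ?sqsinc_norm ?sqsinc2_norm ?sqsinc1_norm.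
move=> mv.
have := sqsinc_ge (ltW al0); have := sqsinc_norm al; rewrite ler_norml => /andP[_].
have /andP := sqsinc2_bounds be0; have /andP := sqsinc1_bounds be0; have /andP := sqsinc1_bounds al0.
set s := sqsinc al; set s2 := sqsinc2 be; set s1 := sqsinc1 al; set s1' := sqsinc1 be.
move=> [a1 a2] [b1 b2] [c1 c2] e2 e1.
have Z0 : 0 <= m * v by lra.
(* Both intermediate points are at most [2 m v]. The bound [m v <= 101/50] makes the lower bounds of
   the factors non-negative, so that they may be multiplied. *)
have H1 : (1 - 6^-1 * (2 * (m * v))) * (60^-1 - 840^-1 * (2 * (m * v))) <= s * s2.
  by apply: ler_pM; lra.
have H2 : s * s2 <= 1 * 60^-1 by apply: ler_pM; lra.
have H3 : (6^-1 - 60^-1 * (2 * (m * v))) * (6^-1 - 60^-1 * (2 * (m * v))) <= (- s1) * (- s1').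
  by apply: ler_pM; lra.
have H4 : (- s1) * (- s1') <= 6^-1 * 6^-1 by apply: ler_pM; lra.
have Z2 : 0 <= (m * v) ^+ 2 := sqr_ge0 _.
rewrite mulrNN in H3 H4.
rewrite ler_norml; apply/andP; split.
  have -> : s * s2 - s1 * s1' + 90^-1 = (s * s2 - 60^-1) - (s1 * s1' - 36^-1) by field.
  have -> : - (90^-1 * (m * v)) = (1 - 6^-1 * (2 * (m * v))) * (60^-1 - 840^-1 * (2 * (m * v)))
      - 60^-1 - (1260^-1 * (m * v) ^+ 2 + 315^-1 * (m * v)) - 0 by field.
  by lra.
by lra.
Qed.

(** For [v <= 2 n] the product is compared with the Gaussian weight and the bracket with [- 1/90]:
    the errors add up to the cubic coefficient [101 / (150 * 90) + 202 / (100 * 90) < 3/100] and the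
    quartic one [101 / (5000 * 90) < 1/1000]. For [v > 2 n] the two terms are bounded separately:
    the term [(1 + v)^-1] pays for the product, the Gaussian terms for the weight. *)
Lemma pair_kernel_bound (I n : nat) (K : pred 'I_I) (x : 'I_I -> R) (m v d d' : R) :
  (124 <= n)%N -> 0 <= m -> m <= 101 / 100 / n%:R ->
  (forall k, K k -> 0 <= x k <= 101 / 100 / n%:R) ->
  \sum_(k | K k) x k = 1 - 2 * m ->
  (n - 2 <= #|[set k | K k & (99 / 100 / n%:R <= x k)%R]|)%N ->
  0 <= v -> 0 <= d' -> d' < d -> d <= m ->
  `|\prod_(k | K k) sqsinc (x k * v) *
     ((sqsinc ((m - d) * v) * sqsinc ((m + d) * v)
       - sqsinc ((m - d') * v) * sqsinc ((m + d') * v)) / (d ^+ 2 - d' ^+ 2))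
    + expR (- (6^-1 * v)) * (90^-1 * v ^+ 2)| <=
  n%:R^-1 * (expR (- (6^-1 * v)) * (3 / 100 * v ^+ 3 + 1000^-1 * v ^+ 4) + (1 + v)^-1).
Proof.
move=> n124 m0 mn xb xs xbig v0 d'0 d'd dm.
have n0 : 0 < n%:R :> R by rewrite ltr0n (leq_trans _ n124).
have [G [-> G1 G2]] := sqsinc_pair_bound v0 d'0 d'd dm.
have dd : d ^+ 2 - d' ^+ 2 != 0.
  by rewrite subr_eq0 gt_eqF// ltr_sqr ?nnegrE//; apply: ltW; apply: le_lt_trans d'd.
have -> : (d ^+ 2 - d' ^+ 2) * v ^+ 2 * G / (d ^+ 2 - d' ^+ 2) = v ^+ 2 * G by field.
set A := \prod_(k | K k) _; set w := expR _.
have w0 : 0 <= w := expR_ge0 _.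
have q0 : 0 < n%:R^-1 :> R by rewrite invr_gt0.
have r0 : 0 < (1 + v)^-1 by rewrite invr_gt0; lra.
have [vn|vn] := leP v (2 * n%:R).
  have vb : 0 <= v <= 2 * n%:R by rewrite v0.
  have /andP[mv0 mv1] := mv_le n124 m0 mn vb.
  have HA := prod_sub_expR n124 m0 mn xb xs vb.
  have A0 := prod_ge0 n124 xb vb.
  have Aw : A <= 2 * w.
    apply: le_trans (prod_le_expR n124 xb xs vb) _.
    by rewrite mulrC ler_wpM2r// (expR_mv_le2 n124 m0 mn vb).
  have -> : A * (v ^+ 2 * G) + w * (90^-1 * v ^+ 2) =
     - (A - w) * (90^-1 * v ^+ 2) + A * (v ^+ 2 * (G + 90^-1)) by ring.
  apply: le_trans (ler_normD _ _) _; rewrite (normrM (- (A - w))) (normrM A) (normrM (v ^+ 2)) normrN (ger0_norm A0).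
  have v2 : 0 <= v ^+ 2 := sqr_ge0 _.
  have v3 : 0 <= 90^-1 * v ^+ 2 by rewrite mulr_ge0.
  rewrite (ger0_norm v2) (ger0_norm v3).
  have S1 : `|A - w| * (90^-1 * v ^+ 2) <=
     w * (n%:R^-1 * (101 / 150 * v + 101 / 5000 * v ^+ 2)) * (90^-1 * v ^+ 2).
    by rewrite ler_wpM2r// mulr_ge0.
  have S2 : A * (v ^+ 2 * `|G + 90^-1|) <= 2 * w * (v ^+ 2 * (90^-1 * (101 / 100 / n%:R * v))).
    rewrite ler_pM// ?mulr_ge0// ler_wpM2l//; apply: le_trans (G2 mv1) _.
    by rewrite ler_wpM2l// ler_wpM2r.
  apply: le_trans (lerD S1 S2) _.
  have T3 : 0 <= w * n%:R^-1 * v ^+ 3 by rewrite !mulr_ge0 ?exprn_ge0// ltW.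
  have T4 : 0 <= w * n%:R^-1 * v ^+ 4 by rewrite !mulr_ge0 ?exprn_ge0// ltW.
  have T5 : 0 <= n%:R^-1 * (1 + v)^-1 by rewrite mulr_ge0 ?ltW.
  set q := n%:R^-1 in T3 T4 T5 *; set rr := (1 + v)^-1 in T5 *.
  by clear -T3 T4 T5; lra.
have v0' : 0 < v by apply: lt_trans vn; rewrite mulr_gt0.
have [M [Mn nM M61 k58]] := half_sub2_bounds n124.
have At := prod_tail n124 xbig vn Mn.
set rho := n%:R / (99 / 100 * v) in At.
have rho0 : 0 < rho by rewrite divr_gt0// mulr_gt0.
have rho1 : rho <= 5 / 9.
  by rewrite /rho ler_pdivrMr ?mulr_gt0//; lra.
apply: le_trans (ler_normD _ _) _.
rewrite mulrDr [leRHS]addrC lerD//; last first.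
  have v3 : 0 <= 90^-1 * v ^+ 2 by rewrite mulr_ge0 ?sqr_ge0.
  rewrite (normrM w) (ger0_norm w0) (ger0_norm v3) [leRHS]mulrCA; apply: ler_wpM2l => //.
  have T4 : 0 <= n%:R^-1 * v ^+ 4 by apply: mulr_ge0 (ltW q0) (exprn_ge0 _ v0).
  have T2 : 2 <= n%:R^-1 * v by rewrite mulrC ler_pdivlMr// ltW.
  have T3 : 2 * v ^+ 2 <= n%:R^-1 * v ^+ 3.
    have -> : n%:R^-1 * v ^+ 3 = (n%:R^-1 * v) * v ^+ 2 by ring.
    by apply: ler_wpM2r T2; exact: sqr_ge0.
  by have := sqr_ge0 v; clear -T3 T4; set q := n%:R^-1 in T3 T4 *; lra.
rewrite (normrM A); apply: (@le_trans _ _ (rho ^+ M * (v ^+ 2 * (2 / 45)))).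
  by rewrite ler_pM// (normrM (v ^+ 2)) (ger0_norm (sqr_ge0 _)) ler_wpM2l ?sqr_ge0.
(* The cube of [rho] brings [v ^ 2] down to [1 / v] at the cost of [n ^ 3], and [rho ^ k <= n ^ -4]
   turns that cost into [1 / n]. *)
rewrite -(subnK (leq_trans _ M61 : (3 <= M)%N))// exprD.
set k := (M - 3)%N in nM k58 *.
have HR : rho ^+ k * n%:R ^+ 4 <= 1.
  have rb : 0 <= rho <= 5 / 9 by rewrite ltW.
  apply: le_trans (geometric_beats_quartic rb k58).
  rewrite mulrC ler_wpM2r ?exprn_ge0 ?(ltW rho0)//.
  rewrite lerXn2r// ?nnegrE ?(ltW n0)//.
  by rewrite -natrM -natrD ler_nat.
have -> : rho ^+ 3 = (n%:R / v) ^+ 3 * (100 / 99) ^+ 3.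
  by rewrite /rho; field; rewrite gt_eqF.
rewrite -invfM -[leRHS]mul1r ler_pdivlMr ?mulr_gt0//; last by lra.
apply: le_trans HR.
rewrite -subr_ge0 [X in 0 <= X](_ : _ = rho ^+ k * (n%:R ^+ 4 * (1 - (100 / 99) ^+ 3 * (2 / 45) * (1 + v) / v))); last first.
  by field; rewrite gt_eqF.
rewrite mulr_ge0 ?exprn_ge0 ?(ltW rho0)// mulr_ge0 ?exprn_ge0 ?(ltW n0)// subr_ge0.
rewrite ler_pdivrMr// mul1r.
have n1 : 124 <= n%:R :> R by rewrite ler_nat.
by lra.
Qed.

End kappa.

(** * Gaussian integrals *)

Section gauss.
Variable R : realType.
Local Notation mu := (@lebesgue_measure R).
Implicit Types (f g G : R -> R) (t u : R).

(** The one integrability certificate of the whole proof. It also provides the decay at infinity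
    that kills the boundary terms of integrations by parts. *)
Definition dominated f := exists C : R, forall u, `|f u| <= C * (1 + u ^+ 2)^-1.

Lemma oneDsqr_gt0 u : 0 < 1 + u ^+ 2.
Proof. by have := sqr_ge0 u; lra. Qed.

Lemma continuous_oneDsqrV : continuous (fun u : R => (1 + u ^+ 2)^-1).
Proof.
move=> u; have u0 : 1 + u ^+ 2 != 0 by rewrite gt_eqF// oneDsqr_gt0.
have H := is_derive_fV (is_derive_fD (is_derive_fcst 1 u) (is_derive_expn 2 u)) u0.
exact: is_derive_cont H.
Qed.

Lemma integralT_oneDsqrV : (\int[mu]_u ((1 + u ^+ 2)^-1)%:E = pi%:E)%E.
Proof.
rewrite ge0_symfun_integralT; first last.
- by move=> u /=; rewrite sqrrN.
- exact: continuous_oneDsqrV.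
- by move=> u; rewrite invr_ge0 ltW// oneDsqr_gt0.
have := @integral0y_oneDsqr R; rewrite /oneDsqr.
rewrite (_ : `[0%R, +oo[%classic = [set x | 0 <= x]%R) => [->|].
  by rewrite -EFinM mulrCA divff ?mulr1.
by apply/seteqP; split => x /=; rewrite in_itv/= andbT.
Qed.

Lemma integrable_oneDsqrV : mu.-integrable setT (EFin \o (fun u => (1 + u ^+ 2)^-1)).
Proof.
apply/integrableP; split.
  by apply/measurable_EFinP; apply: continuous_measurable_fun; exact: continuous_oneDsqrV.
have -> : (\int[mu]_x `|(EFin \o (fun u => (1 + u ^+ 2)^-1)%R) x| =
    \int[mu]_u ((1 + u ^+ 2)^-1)%:E)%E; last by rewrite integralT_oneDsqrV ltry.
apply: eq_integral => u _ /=.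
by rewrite ger0_norm// invr_ge0 ltW// oneDsqr_gt0.
Qed.

Lemma integrable_dominated f : measurable_fun setT f -> dominated f ->
  mu.-integrable setT (EFin \o f).
Proof.
move=> mf [C fC].
have I : mu.-integrable setT (fun u => (C%:E * ((1 + u ^+ 2)^-1)%:E)%E).
  by apply: integrableZl => //; exact: integrable_oneDsqrV.
apply: le_integrable I => //; first exact/measurable_EFinP.
move=> u _; rewrite /= lee_fin (le_trans (fC u))//.
exact: ler_norm.
Qed.

(** Over growing symmetric intervals the integrals of [g] converge to the full one by dominated
    convergence, and they equal boundary terms of [G] that tend to 0. *)
Lemma Rintegral_derive_eq0 G g : (forall u, is_derive u 1 G (g u)) -> continuous g ->
  dominated g -> dominated G -> \int[mu]_u g u = 0.
Proof.
move=> dG cg bg [C GC].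
have Ig := integrable_dominated (continuous_measurable_fun cg) bg.
pose I (n : nat) : set R := `[- n.+1%:R, n.+1%:R]%classic.
have FTC n : (\int[mu]_u ((g \_ (I n)) u)%:E = (G n.+1%:R - G (- n.+1%:R))%:E)%E.
  have := @continuous_FTC2 R g G (- n.+1%:R) n.+1%:R.
  rewrite integral_mkcond restrict_EFin EFinB => -> //.
  - by rewrite gtrN// ltr0n.
  - exact: continuous_subspaceT.
  - split.
    + by move=> x _; exact: ex_derive.
    + by apply: cvg_at_right_filter; exact: is_derive_cont.
    + by apply: cvg_at_left_filter; exact: is_derive_cont.
  - by move=> x _; rewrite derive1E; exact: derive_val.
have H1 : (\int[mu]_u ((g \_ (I n)) u)%:E)%E @[n --> \oo] --> (\int[mu]_u (g u)%:E)%E.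
  apply: (@dominated_cvg _ _ _ mu setT measurableT (fun n u => ((g \_ (I n)) u)%:E) _ (EFin \o (fun u => `|g u|))) => //.
  - move=> n; have mI : measurable (I n : set (measurableTypeR R)) by exact: measurable_itv.
    apply/measurable_EFinP; apply: (iffLR (measurable_restrictT (g : measurableTypeR R -> R) mI)).
    exact: measurable_funTS (continuous_measurable_fun cg).
  - move=> u _; suff : \forall n \near \oo, ((g \_ (I n)) u)%:E = (g u)%:E by exact: cvg_near_cst.
    near=> n.
    rewrite patchE mem_set// /I/= in_itv/= -ler_norml.
    apply: ltW; apply: (@lt_le_trans _ _ n%:R); last by rewrite ler_nat.
    by near: n; exact: nbhs_infty_gtr.
  - by apply: (integrable_norm Ig).
  - move=> n u _; rewrite /= lee_fin patchE; case: ifP => // _.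
    by rewrite normr0.
have H2 : (\int[mu]_u ((g \_ (I n)) u)%:E)%E @[n --> \oo] --> 0%E.
  under eq_fun do rewrite FTC.
  apply: cvg_EFin; first by near=> n.
  apply/cvgrPdist_le => e e0; near=> n.
  rewrite /= sub0r normrN.
  apply: le_trans (ler_normB _ _) _.
  have B (v : R) : `|v| = n.+1%:R -> `|G v| <= e / 2.
    move=> vn; apply: le_trans (GC v) _.
    rewrite ler_pdivrMr ?oneDsqr_gt0// -real_normK ?num_real// vn.
    have : 2 * `|C| / e <= n.+1%:R.
      apply: ltW; apply: (@lt_le_trans _ _ n%:R); last by rewrite ler_nat.
      by near: n; exact: nbhs_infty_gtr.
    rewrite ler_pdivrMr// => Ce; apply: le_trans (ler_norm _) _.
    have n1 : 1 <= n.+1%:R :> R by rewrite ler1n.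
    have : n.+1%:R * 1 <= n.+1%:R * n.+1%:R :> R by rewrite ler_wpM2l.
    by nra.
  by have := B n.+1%:R; have := B (- n.+1%:R); rewrite normrN normr_nat; lra.
have := cvg_unique _ H1 H2.
by rewrite /Rintegral => ->.
Unshelve. all: by end_near. Qed.

Definition gw u := expR (- (6^-1 * u ^+ 2)).

Lemma is_derive_gw u : is_derive u 1 gw (- (3^-1 * u) * gw u).
Proof.
eapply is_derive_eq.
  eapply (@is_derive_fcomp _ expR (fun u => - (6^-1 * u ^+ 2))); first exact: is_derive_expR.
  eapply is_derive_fN, is_derive_fM; [exact: is_derive_fcst|exact: is_derive_expn].
by rewrite /gw/=; field.
Qed.

Lemma continuous_gw : continuous gw.
Proof. by move=> u; exact: is_derive_cont (is_derive_gw u). Qed.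

(** From [y ^ j / j! <= exp y] at [y = u ^ 2 / 6]. *)
Lemma gw_even_bound (j : nat) : exists2 C, 0 <= C & forall u, u ^+ j.*2 * gw u <= C.
Proof.
exists (6 ^+ j * j`!%:R); first by rewrite mulr_ge0 ?exprn_ge0.
move=> u; set y := 6^-1 * u ^+ 2.
have y0 : 0 <= y by rewrite mulr_ge0 ?sqr_ge0.
have -> : u ^+ j.*2 = 6 ^+ j * y ^+ j by rewrite -exprMn /y mulVKf// -exprM mul2n.
rewrite -mulrA ler_wpM2l ?exprn_ge0// /gw -/y expRN ler_pdivrMr ?expR_gt0//.
rewrite mulrC -ler_pdivrMr ?ltr0n ?fact_gt0//.
case: j => [|j]; first by rewrite expr0 fact0 divr1 -expR0 ler_expR.
by have := expR_ge1Dxn j y0; lra.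
Qed.

(** Odd powers are reduced to even ones by [|u| ^ k <= 1 + u ^ (2 k)]; expanding the product with
    [1 + u ^ 2] leaves the four even powers bounded by [C0], ..., [C3]. *)
Lemma gw_poly_bound (k : nat) : dominated (fun u => u ^+ k * gw u).
Proof.
have [C0 C00 H0] := gw_even_bound 0; have [C1 C10 H1] := gw_even_bound 1.
have [C2 C20 H2] := gw_even_bound k; have [C3 C30 H3] := gw_even_bound k.+1.
exists (C0 + C1 + C2 + C3) => u.
rewrite ler_pdivlMr ?oneDsqr_gt0// normrM (ger0_norm (expR_ge0 _)) normrX.
have w0 : 0 <= gw u := expR_ge0 _.
have -> : `|u| ^+ k * gw u * (1 + u ^+ 2) = gw u * (`|u| ^+ k + u ^+ 2 * `|u| ^+ k) by rewrite /=; ring.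
have A : `|u| ^+ k <= 1 + u ^+ k.*2.
  rewrite -[u ^+ k.*2]ger0_norm ?exprn_even_ge0 ?odd_double// normrX -muln2 exprM.
  by have := sqr_ge0 (`|u| ^+ k - 1); have := sqr_ge0 (`|u| ^+ k); rewrite sqrrB1 mulr2n; lra.
apply: (@le_trans _ _ (gw u * ((1 + u ^+ 2) * (1 + u ^+ k.*2)))).
  by rewrite ler_wpM2l//; have := sqr_ge0 u; nra.
have := H0 u; have := H1 u; have := H2 u; have := H3 u.
have -> : u ^+ k.+1.*2 = u ^+ 2 * u ^+ k.*2 by rewrite doubleS -exprD add2n.
by rewrite (_ : 0.*2 = 0)%N// (_ : 1.*2 = 2)%N// expr0; lra.
Qed.

Lemma dominated_mul_bounded f g : dominated f -> (forall u, `|g u| <= 1) ->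
  dominated (fun u => f u * g u).
Proof.
move=> [C fC] g1; exists C => u; rewrite normrM; apply: le_trans (fC u).
by rewrite ler_piMr.
Qed.

Lemma dominatedD f g : dominated f -> dominated g -> dominated (fun u => f u + g u).
Proof.
move=> [C fC] [D gD]; exists (C + D) => u.
by rewrite mulrDl; apply: le_trans (ler_normD _ _) (lerD _ _).
Qed.

Lemma dominatedZ (c : R) f : dominated f -> dominated (fun u => c * f u).
Proof.
move=> [C fC]; exists (`|c| * C) => u.
by rewrite normrM -mulrA ler_wpM2l.
Qed.

Definition gcos t (k : nat) := \int[mu]_u (u ^+ k * gw u * cos (2 * t * u)).
Definition gsin t (k : nat) := \int[mu]_u (u ^+ k * gw u * sin (2 * t * u)).

Lemma cos_norm1 (x : R) : `|cos x| <= 1.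
Proof. by rewrite ler_norml cos_geN1 cos_le1. Qed.

Lemma sin_norm1 (x : R) : `|sin x| <= 1.
Proof. by rewrite ler_norml sin_geN1 sin_le1. Qed.

Lemma is_derive_cosM (c x : R) : is_derive x 1 (fun u => cos (c * u)) (- c * sin (c * x)).
Proof.
eapply is_derive_eq.
  eapply (@is_derive_fcomp _ cos (fun u => c * u)); first exact: is_derive_cos.
  eapply is_derive_fM; [exact: is_derive_fcst|exact: is_derive_fid].
by rewrite /=; ring.
Qed.

Lemma is_derive_sinM (c x : R) : is_derive x 1 (fun u => sin (c * u)) (c * cos (c * x)).
Proof.
eapply is_derive_eq.
  eapply (@is_derive_fcomp _ sin (fun u => c * u)); first exact: is_derive_sin.
  eapply is_derive_fM; [exact: is_derive_fcst|exact: is_derive_fid].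
by rewrite /=; ring.
Qed.

Lemma is_derive_polygw k u : is_derive u 1 (fun u => u ^+ k * gw u)
  (k%:R * (u ^+ k.-1 * gw u) + - 3^-1 * (u ^+ k.+1 * gw u)).
Proof.
eapply is_derive_eq.
  eapply is_derive_fM; [exact: is_derive_expn|exact: is_derive_gw].
by rewrite exprS; ring.
Qed.

Lemma continuous_polygw k : continuous (fun u => u ^+ k * gw u).
Proof. by move=> u; exact: is_derive_cont (is_derive_polygw k u). Qed.

Lemma integrable_gcos t k : mu.-integrable setT (EFin \o (fun u => u ^+ k * gw u * cos (2 * t * u))).
Proof.
apply: integrable_dominated.
  apply: continuous_measurable_fun => u; apply: cvgM; first exact: continuous_polygw.
  exact: is_derive_cont (is_derive_cosM (2 * t) u).
by apply: dominated_mul_bounded => [|u]; [exact: gw_poly_bound|exact: cos_norm1].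
Qed.

Lemma integrable_gsin t k : mu.-integrable setT (EFin \o (fun u => u ^+ k * gw u * sin (2 * t * u))).
Proof.
apply: integrable_dominated.
  apply: continuous_measurable_fun => u; apply: cvgM; first exact: continuous_polygw.
  exact: is_derive_cont (is_derive_sinM (2 * t) u).
by apply: dominated_mul_bounded => [|u]; [exact: gw_poly_bound|exact: sin_norm1].
Qed.

Lemma Rintegral_lin3 (a b c : R) f g h :
  mu.-integrable setT (EFin \o f) -> mu.-integrable setT (EFin \o g) ->
  mu.-integrable setT (EFin \o h) ->
  \int[mu]_u (a * f u + b * g u + c * h u) =
  a * \int[mu]_u f u + b * \int[mu]_u g u + c * \int[mu]_u h u.
Proof.
move=> If Ig Ih.
have Z (k : R) (q : R -> R) : mu.-integrable setT (EFin \o q) ->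
    mu.-integrable setT (EFin \o (fun u => k * q u)).
  by move=> Iq; apply: (integrableZl measurableT k Iq).
have D (p q : R -> R) : mu.-integrable setT (EFin \o p) -> mu.-integrable setT (EFin \o q) ->
    mu.-integrable setT (EFin \o (fun u => p u + q u)).
  by move=> Ip Iq; apply: (integrableD measurableT Ip Iq).
rewrite RintegralD ?RintegralD ?RintegralZl//; [exact: Z|exact: Z| |exact: Z].
by apply: D; exact: Z.
Qed.

(** Integration by parts, from the derivative of [u ^ k * gw u * sin (2 t u)]. For [k = 0] the
    truncated index [k.-1] is harmless, its coefficient being 0. *)
Lemma gsinS t k : gsin t k.+1 = 3 * k%:R * gsin t k.-1 + 6 * t * gcos t k.
Proof.
have : \int[mu]_u (k%:R * (u ^+ k.-1 * gw u * sin (2 * t * u))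
    + - 3^-1 * (u ^+ k.+1 * gw u * sin (2 * t * u))
    + 2 * t * (u ^+ k * gw u * cos (2 * t * u))) = 0.
  apply: (@Rintegral_derive_eq0 (fun u => u ^+ k * gw u * sin (2 * t * u))).
  - move=> u; eapply is_derive_eq.
      eapply is_derive_fM; [exact: is_derive_polygw|exact: is_derive_sinM].
    by rewrite /=; ring.
  - move=> u; apply: cvgD; first apply: cvgD.
    + apply: cvgM; first exact: cvg_cst.
      apply: cvgM; first exact: continuous_polygw.
      exact: is_derive_cont (is_derive_sinM (2 * t) u).
    + apply: cvgM; first exact: cvg_cst.
      apply: cvgM; first exact: continuous_polygw.
      exact: is_derive_cont (is_derive_sinM (2 * t) u).
    + apply: cvgM; first exact: cvg_cst.
      apply: cvgM; first exact: continuous_polygw.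
      exact: is_derive_cont (is_derive_cosM (2 * t) u).
  - apply: dominatedD; first apply: dominatedD.
    + by apply/dominatedZ/dominated_mul_bounded => [|u]; [exact: gw_poly_bound|exact: sin_norm1].
    + by apply/dominatedZ/dominated_mul_bounded => [|u]; [exact: gw_poly_bound|exact: sin_norm1].
    + by apply/dominatedZ/dominated_mul_bounded => [|u]; [exact: gw_poly_bound|exact: cos_norm1].
  - by apply/dominated_mul_bounded => [|u]; [exact: gw_poly_bound|exact: sin_norm1].
rewrite Rintegral_lin3; [|exact: integrable_gsin|exact: integrable_gsin|exact: integrable_gcos].
by rewrite -/(gsin t k.-1) -/(gsin t k.+1) -/(gcos t k); lra.
Qed.

Lemma gcosS t k : gcos t k.+1 = 3 * k%:R * gcos t k.-1 - 6 * t * gsin t k.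
Proof.
have : \int[mu]_u (k%:R * (u ^+ k.-1 * gw u * cos (2 * t * u))
    + - 3^-1 * (u ^+ k.+1 * gw u * cos (2 * t * u))
    + - (2 * t) * (u ^+ k * gw u * sin (2 * t * u))) = 0.
  apply: (@Rintegral_derive_eq0 (fun u => u ^+ k * gw u * cos (2 * t * u))).
  - move=> u; eapply is_derive_eq.
      eapply is_derive_fM; [exact: is_derive_polygw|exact: is_derive_cosM].
    by rewrite /=; ring.
  - move=> u; apply: cvgD; first apply: cvgD.
    + apply: cvgM; first exact: cvg_cst.
      apply: cvgM; first exact: continuous_polygw.
      exact: is_derive_cont (is_derive_cosM (2 * t) u).
    + apply: cvgM; first exact: cvg_cst.
      apply: cvgM; first exact: continuous_polygw.
      exact: is_derive_cont (is_derive_cosM (2 * t) u).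
    + apply: cvgM; first exact: cvg_cst.
      apply: cvgM; first exact: continuous_polygw.
      exact: is_derive_cont (is_derive_sinM (2 * t) u).
  - apply: dominatedD; first apply: dominatedD.
    + by apply/dominatedZ/dominated_mul_bounded => [|u]; [exact: gw_poly_bound|exact: cos_norm1].
    + by apply/dominatedZ/dominated_mul_bounded => [|u]; [exact: gw_poly_bound|exact: cos_norm1].
    + by apply/dominatedZ/dominated_mul_bounded => [|u]; [exact: gw_poly_bound|exact: sin_norm1].
  - by apply/dominated_mul_bounded => [|u]; [exact: gw_poly_bound|exact: cos_norm1].
rewrite Rintegral_lin3; [|exact: integrable_gcos|exact: integrable_gcos|exact: integrable_gsin].
by rewrite -/(gcos t k.-1) -/(gcos t k.+1) -/(gsin t k); lra.
Qed.

Lemma gcos4 t : gcos t 4 = 27 * (1 - 24 * t ^+ 2 + 48 * t ^+ 4) * gcos t 0.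
Proof.
have S1 := gsinS t 0; have S3 := gsinS t 2.
have C2 := gcosS t 1; have C4 := gcosS t 3; rewrite /= in S1 S3 C2 C4.
by rewrite C4 S3 C2 S1; ring.
Qed.

Lemma gcos6_0 : gcos 0 6 = 405 * gcos 0 0.
Proof.
have C2 := gcosS 0 1; have C4 := gcosS 0 3; have C6 := gcosS 0 5; rewrite /= in C2 C4 C6.
by rewrite C6 C4 C2; ring.
Qed.

Lemma gcos8_0 : gcos 0 8 = 8505 * gcos 0 0.
Proof.
have C8 := gcosS 0 7; rewrite /= gcos6_0 in C8.
by rewrite C8; ring.
Qed.

(** Differentiation under the integral gives [- 2 * gsin t 1], which integration by parts returns to
    [gcos t 0]: a linear differential equation, solved in the next lemma. *)
Lemma is_derive_gcos t : is_derive t 1 (fun t => gcos t 0) (- (12 * t) * gcos t 0).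
Proof.
pose f (t u : R) := u ^+ 0 * gw u * cos (2 * t * u).
have df (s u : R) : is_derive s 1 (f ^~ u) (- 2 * (u ^+ 1 * gw u * sin (2 * s * u))).
  eapply is_derive_eq.
    eapply is_derive_fM; first exact: is_derive_fcst.
    have E : (fun s : R => cos (2 * s * u)) = (fun s => cos ((2 * u) * s)).
      by apply/funext => x; congr cos; ring.
    by rewrite E; exact: is_derive_cosM.
  by rewrite (mulrAC 2 s u) expr0 expr1; ring.
have dfE (s u : R) : partial1of2 f s u = - 2 * (u ^+ 1 * gw u * sin (2 * s * u)).
  by rewrite partial1of2E; exact: derive_val.
have tI : `]t - 1, t + 1[%classic t by rewrite /= in_itv/=; apply/andP; split; lra.
have I0 (s : R) : `]t - 1, t + 1[%classic s -> mu.-integrable setT (EFin \o f s).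
  by move=> _; exact: integrable_gcos.
have [C HC] := gw_poly_bound 1.
have C0 : 0 <= C.
  by have := le_trans (normr_ge0 _) (HC 0); rewrite expr0n addr0 invr1 mulr1.
pose G (u : R) := 2 * C * (1 + u ^+ 2)^-1.
have G0 u : 0 <= G u by rewrite !mulr_ge0// invr_ge0 ltW// oneDsqr_gt0.
have IG : mu.-integrable setT (EFin \o G).
  by apply: (integrableZl measurableT (2 * C) integrable_oneDsqrV).
have GU (s u : R) : `]t - 1, t + 1[%classic s -> setT u -> `|partial1of2 f s u| <= G u.
  move=> _ _; rewrite dfE normrM normrN normr_nat /G -(mulrA 2 C); apply: ler_wpM2l => //.
  by apply: le_trans (HC u); rewrite normrM ler_piMr// sin_norm1.
have df1 (s u : R) : `]t - 1, t + 1[%classic s -> setT u -> derivable (f ^~ u) s 1.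
  by move=> _ _; exact: ex_derive.
apply: DeriveDef.
  exact: (derivable_under_integral measurableT tI I0 df1 G0 IG GU).
rewrite -derive1E (differentiation_under_integral measurableT tI I0 df1 G0 IG GU).
under eq_Rintegral do rewrite dfE.
rewrite RintegralZl//; last exact: integrable_gsin.
by rewrite -/(gsin t 1) gsinS /=; ring.
Qed.

Lemma gcos0E t : gcos t 0 = gcos 0 0 * expR (- (6 * t ^+ 2)).
Proof.
have d (s : R) : is_derive s 1 (fun s => gcos s 0 * expR (6 * s ^+ 2)) 0.
  eapply is_derive_eq.
    eapply is_derive_fM; first exact: is_derive_gcos.
    eapply (@is_derive_fcomp _ expR (fun u => 6 * u ^+ 2)); first exact: is_derive_expR.
    eapply is_derive_fM; [exact: is_derive_fcst|exact: is_derive_expn].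
  by rewrite /=; ring.
have := is_derive_0_is_cst t 0 d.
rewrite expr0n/= mulr0 expR0 mulr1 => <-.
by rewrite -mulrA -expRD addrN expR0 mulr1.
Qed.

End gauss.

(** * The volume of a slab as a Fourier integral *)

Section fourier.
Variable R : realType.
Local Notation mu := (@lebesgue_measure R).
Local Notation leb n := (@lebesgue_tuple R n).

Lemma mul_sqsinc (y : R) : y * sqsinc (y ^+ 2) = sin y.
Proof.
rewrite sqsincE; case: eqP => [->|/eqP y0]; first by rewrite mul0r sin0.
by rewrite mulrC divfK.
Qed.

(* [(1 - cos (c u)) / u ^ 2], extended by continuity at [u = 0]. *)
Definition fejer (c u : R) := c ^+ 2 / 2 * sqsinc ((c * u / 2) ^+ 2) ^+ 2.

Lemma fejer_mul (c u : R) : fejer c u * u ^+ 2 = 1 - cos (c * u).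
Proof.
have -> : c * u = c * u / 2 + c * u / 2 by field.
rewrite cosD -!expr2 cos2sin2 -[in RHS]mul_sqsinc /fejer; by field.
Qed.

Lemma measurable_sqsinc_comp (f : R -> R) : measurable_fun setT f ->
  measurable_fun setT (fun u => sqsinc (f u)).
Proof.
by move=> mf; apply: measurableT_comp mf; apply: continuous_measurable_fun; exact: continuous_sqsinc.
Qed.

Lemma dominated_of_sqr (f : R -> R) (C : R) : (forall u, `|f u| <= 1) ->
  (forall u, `|f u| * u ^+ 2 <= C) -> dominated f.
Proof.
move=> f1 fC; exists (1 + C) => u; rewrite ler_pdivlMr ?oneDsqr_gt0// mulrDr mulr1.
exact: lerD.
Qed.

Lemma sqsincM_dominated (p q : R) : 0 < p -> 0 < q ->
  dominated (fun u => sqsinc (p * u ^+ 2) * sqsinc (q * u ^+ 2)).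
Proof.
move=> p0 q0.
have B (c u : R) : 0 < c -> `|sqsinc (c * u ^+ 2)| ^+ 2 * u ^+ 2 <= c^-1.
  move=> c0; have [->|u0] := eqVneq u 0; first by rewrite expr0n/= mulr0 invr_ge0 ltW.
  have u2 : 0 < u ^+ 2 by rewrite exprn_even_gt0.
  rewrite real_normK ?num_real// -ler_pdivlMr// -invfM; apply: sqsinc_sqr_le.
  exact: mulr_gt0.
apply: (@dominated_of_sqr _ (p^-1 + q^-1)) => u; rewrite normrM.
  by rewrite -[leRHS]mulr1 ler_pM// sqsinc_norm.
have := B p u p0; have := B q u q0.
set x := `|_ (p * _)|; set y := `|_ (q * _)| => Hy Hx.
have := mulr_ge0 (sqr_ge0 (x - y)) (sqr_ge0 u).
have := mulr_ge0 (mulr_ge0 (normr_ge0 _ : 0 <= x) (normr_ge0 _ : 0 <= y)) (sqr_ge0 u).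
by rewrite sqrrB; lra.
Qed.

Lemma fejer_dominated (c : R) : dominated (fejer c).
Proof.
have [->|c0] := eqVneq c 0.
  by exists 0 => u; rewrite /fejer expr0n/= !mul0r normr0.
rewrite (_ : fejer c = fun u => c ^+ 2 / 2 * (sqsinc ((c / 2) ^+ 2 * u ^+ 2) * sqsinc ((c / 2) ^+ 2 * u ^+ 2))).
  apply/dominatedZ/sqsincM_dominated; by rewrite exprn_even_gt0//= mulf_neq0// invr_neq0.
apply/funext => u; rewrite /fejer [sqsinc _ ^+ 2]expr2.
by have -> : (c * u / 2) ^+ 2 = (c / 2) ^+ 2 * u ^+ 2 by field.
Qed.

Lemma measurable_fejer (c : R) : measurable_fun setT (fejer c).
Proof.
apply: measurable_funM => //; apply: measurable_funX.
apply: measurable_sqsinc_comp; apply: measurable_funX; exact: measurable_funM.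
Qed.

Lemma integrable_fejer c : mu.-integrable setT (EFin \o fejer c).
Proof. exact: integrable_dominated (measurable_fejer c) (fejer_dominated c). Qed.

Lemma fejer_ge0 c u : 0 <= fejer c u.
Proof. by rewrite mulr_ge0 ?sqr_ge0// divr_ge0// sqr_ge0. Qed.

(** The classical integral of [(1 - cos u) / u ^ 2], equal to pi. It enters all volumes as the same
    positive factor. *)
Definition fejer_mass : R := \int[mu]_u fejer 1 u.

(** By scaling. The absolute values produced here are what reconstructs lengths of intervals from
    cosines. *)
Lemma Rintegral_fejer c : \int[mu]_u fejer c u = `|c| * fejer_mass.
Proof.
have [->|c0] := eqVneq c 0.
  rewrite normr0 mul0r /fejer; under eq_Rintegral do rewrite expr0n/= !mul0r.
  by rewrite Rintegral_cst//= mul0r.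
have fE u : fejer c u = c ^+ 2 * fejer 1 (c * u + 0).
  by rewrite /fejer addr0 mul1r expr1n; field.
rewrite /fejer_mass /Rintegral.
under eq_integral do rewrite fE EFinM.
have mf : measurable_fun [set: R] (fun u : R => (fejer 1 u)%:E).
  by apply/measurable_EFinP; exact: measurable_fejer.
rewrite ge0_integralZl//=; first last.
- by rewrite lee_fin sqr_ge0.
- by move=> u _; rewrite lee_fin fejer_ge0.
- exact: (measurableT_comp mf (measurable_affine c 0)).
rewrite (ge0_integral_affine 0 c0 mf); last by move=> u; rewrite lee_fin fejer_ge0.
rewrite muleA -EFinM -[X in (_ * X)%E]fineK; last first.
  by apply: integrable_fin_num => //; exact: integrable_fejer.
rewrite -EFinM /= -real_normK ?num_real//; congr (_ * _); field.
by rewrite normr_eq0.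
Qed.

Lemma fejer_mass_gt0 : 0 < fejer_mass.
Proof.
rewrite lt_neqAle eq_sym; apply/andP; split; last first.
  by apply: Rintegral_ge0 => u _; exact: fejer_ge0.
apply/negP => /eqP m0.
have : \int[mu]_(u in `[0, 1]) (1 / 4) <= fejer_mass :> R.
  rewrite /fejer_mass -(setTI `[0, 1]%classic) Rintegral_mkcondr.
  apply: le_Rintegral => //; first last.
  - move=> u _; rewrite patchE; case: ifP => [|_]; last exact: fejer_ge0.
    rewrite inE/= in_itv/= => /andP[u0 u1]; rewrite /fejer expr1n !mul1r.
    have H : 0 <= (u / 2) ^+ 2 by exact: sqr_ge0.
    have := sqsinc_ge H.
    have H1 : (u / 2) ^+ 2 <= 4^-1 by rewrite expr2; nra.
    set s := sqsinc _ => s1.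
    have s2 : 5 / 6 <= s by lra.
    by rewrite expr2; nra.
  - exact: integrable_fejer.
  - apply: integrable_dominated.
      apply: (iffLR (measurable_restrictT _ _)) => //; exact: measurable_itv.
    exists 1 => u; rewrite patchE; case: ifP => [|_]; last first.
      by rewrite normr0 mulr_ge0// invr_ge0 ltW// oneDsqr_gt0.
    rewrite inE/= in_itv/= => /andP[u0 u1]; rewrite ger0_norm; last by lra.
    rewrite ler_pdivlMr ?oneDsqr_gt0//; nra.
rewrite Rintegral_cst//= m0 lebesgue_measure_itv/= lte_fin ltr01 -EFinD/= subr0 mulr1.
lra.
Qed.

(** Product-to-sum formulas give four terms [cos (c u) / u ^ 2], none integrable at 0. Their signs
    cancel, so each cosine may be replaced by minus a Fejer kernel. *)
Lemma sqsinc_pair_fejer (tau w al u : R) :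
  w * al * (cos (2 * tau * u) * (sqsinc (w ^+ 2 * u ^+ 2) * sqsinc (al ^+ 2 * u ^+ 2))) =
  4^-1 * (fejer (2 * tau + (w + al)) u + fejer (2 * tau - (w + al)) u
    - fejer (2 * tau + (w - al)) u - fejer (2 * tau - (w - al)) u).
Proof.
have [->|u0] := eqVneq u 0.
  by rewrite /fejer !mulr0 cos0 expr0n/= !mulr0 !mul0r expr0n/= sqsinc0 !expr1n !mulr1; field.
apply: (mulIf (expf_neq0 2 u0)).
rewrite -!exprMn.
have -> : w * al * (cos (2 * tau * u) * (sqsinc ((w * u) ^+ 2) * sqsinc ((al * u) ^+ 2))) * u ^+ 2 =
  cos (2 * tau * u) * (w * u * sqsinc ((w * u) ^+ 2)) * (al * u * sqsinc ((al * u) ^+ 2)) by ring.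
rewrite !mul_sqsinc; transitivity (4^-1 * (fejer (2 * tau + (w + al)) u * u ^+ 2
  + fejer (2 * tau - (w + al)) u * u ^+ 2 - fejer (2 * tau + (w - al)) u * u ^+ 2
  - fejer (2 * tau - (w - al)) u * u ^+ 2)); last by ring.
rewrite !fejer_mul.
have -> : (2 * tau + (w + al)) * u = 2 * tau * u + (w * u + al * u) by ring.
have -> : (2 * tau - (w + al)) * u = 2 * tau * u - (w * u + al * u) by ring.
have -> : (2 * tau + (w - al)) * u = 2 * tau * u + (w * u - al * u) by ring.
have -> : (2 * tau - (w - al)) * u = 2 * tau * u - (w * u - al * u) by ring.
move: (2 * tau * u) (w * u) (al * u) => A B C.
by rewrite !(cosD, sinD, cosN, sinN); field.
Qed.

(** For [w, al > 0], twice the length of the intersection of [[tau - w/2, tau + w/2]] and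
    [[- al/2, al/2]], in the form in which the four Fejer integrals deliver it. *)
Definition overlap (tau w al : R) := `|tau + (w + al) / 2| + `|tau - (w + al) / 2|
    - `|tau + (w - al) / 2| - `|tau - (w - al) / 2|.

Lemma Rintegral_sqsinc_pair (tau w al : R) : 0 < w -> 0 < al ->
  \int[mu]_u (cos (2 * tau * u) * (sqsinc (w ^+ 2 * u ^+ 2) * sqsinc (al ^+ 2 * u ^+ 2))) =
  fejer_mass / (w * al) * (overlap tau w al / 2).
Proof.
move=> w0 al0.
have wal : w * al != 0 by rewrite mulf_neq0 ?gt_eqF.
apply: (mulfI wal).
have I (c : R) := integrable_fejer c.
rewrite -RintegralZl//; last first.
  apply: integrable_dominated.
    apply: measurable_funM.
      apply: continuous_measurable_fun => u.
      exact: is_derive_cont (is_derive_cosM (2 * tau) u).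
    by apply: measurable_funM; apply: measurable_sqsinc_comp; apply: measurable_funM => //;
      exact: measurable_funX.
  rewrite (_ : (fun _ => _) = fun u => sqsinc (w ^+ 2 * u ^+ 2) * sqsinc (al ^+ 2 * u ^+ 2) * cos (2 * tau * u)).
    apply: dominated_mul_bounded; last by move=> u; exact: cos_norm1.
    by apply: sqsincM_dominated; rewrite exprn_gt0.
  by apply/funext => u; rewrite mulrC.
under eq_Rintegral do rewrite sqsinc_pair_fejer.
have ID (f g : R -> R) : mu.-integrable setT (EFin \o f) -> mu.-integrable setT (EFin \o g) ->
    mu.-integrable setT (EFin \o (fun u => f u + g u)).
  by move=> If Ig; exact: (integrableD measurableT If Ig).
have IB (f g : R -> R) : mu.-integrable setT (EFin \o f) -> mu.-integrable setT (EFin \o g) ->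
    mu.-integrable setT (EFin \o (fun u => f u - g u)).
  by move=> If Ig; exact: (integrableB measurableT If Ig).
have I2 := ID _ _ (I (2 * tau + (w + al))) (I (2 * tau - (w + al))).
have I3 := IB _ _ I2 (I (2 * tau + (w - al))).
rewrite (RintegralZl _ measurableT (IB _ _ I3 (I (2 * tau - (w - al))))).
rewrite (RintegralB measurableT I3 (I _)) (RintegralB measurableT I2 (I _)).
rewrite (RintegralD measurableT (I _) (I _)) !Rintegral_fejer /overlap.
have N2 (x y : R) : `|2 * x + y| = 2 * `|x + y / 2|.
  have -> : 2 * x + y = 2 * (x + y / 2) by field.
  by rewrite normrM ger0_norm.
have N2' (x y : R) : `|2 * x - y| = 2 * `|x - y / 2|.
  have -> : 2 * x - y = 2 * (x - y / 2) by field.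
  by rewrite normrM ger0_norm.
rewrite !N2' !N2; field; by rewrite ?gt_eqF.
Qed.

Lemma normrD_sub_clamp (A x : R) : 0 < A ->
  `|x + A| - `|x - A| = 2 * (if x < - A then - A else if A < x then A else x).
Proof.
move=> A0; case: ltP => h1; last case: ltP => h2.
- by rewrite !ltr0_norm; lra.
- by rewrite !gtr0_norm; lra.
- by rewrite ger0_norm ?ler0_norm; lra.
Qed.

Lemma overlap_clamp (tau w al : R) : 0 < al ->
  overlap tau w al / 2 =
  (if tau + w / 2 < - (al / 2) then - (al / 2) else if al / 2 < tau + w / 2 then al / 2 else tau + w / 2)
  - (if tau - w / 2 < - (al / 2) then - (al / 2) else if al / 2 < tau - w / 2 then al / 2 else tau - w / 2).
Proof.
move=> al0; have A0 : 0 < al / 2 by lra.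
have := normrD_sub_clamp (tau + w / 2) A0; have := normrD_sub_clamp (tau - w / 2) A0.
rewrite /overlap.
have -> : tau + (w + al) / 2 = tau + w / 2 + al / 2 by field.
have -> : tau - (w + al) / 2 = tau - w / 2 - al / 2 by field.
have -> : tau + (w - al) / 2 = tau + w / 2 - al / 2 by field.
have -> : tau - (w - al) / 2 = tau - w / 2 + al / 2 by field.
by move: (if _ then _ else _) (if _ then _ else _) => X Y; lra.
Qed.

Lemma lebesgue_overlap (tau w al : R) : 0 < w -> 0 < al ->
  mu [set x | 0 <= x <= 1 /\ `|al * (x - 2^-1) - tau| <= w / 2] = (overlap tau w al / (2 * al))%:E.
Proof.
move=> w0 al0.
have mA : measurable (`[Num.max (- al / 2) (tau - w / 2), Num.min (al / 2) (tau + w / 2)] : set R).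
  exact: measurable_itv.
have := lebesgue_measure_affine (- al / 2) (lt0r_neq0 al0) mA.
rewrite (_ : _ @^-1` _ = [set x | 0 <= x <= 1 /\ `|al * (x - 2^-1) - tau| <= w / 2]); last first.
  apply/seteqP; split => x /=.
    rewrite in_itv/= ge_max le_min => /andP[/andP[h1 h2] /andP[h3 h4]].
    rewrite ler_norml; split; last by apply/andP; split; lra.
    have := ler_pM2l al0 0 x; have := ler_pM2l al0 x 1; rewrite mulr0 mulr1 => <- <-.
    by apply/andP; split; lra.
  rewrite ler_norml => -[/andP[x0 x1] /andP[h1 h2]].
  rewrite in_itv/= ge_max le_min; have := ler_wpM2l (ltW al0) x0; have := ler_wpM2l (ltW al0) x1.
  by rewrite mulr0 mulr1 => *; apply/andP; split; apply/andP; split; lra.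
move=> ->; rewrite lebesgue_measure_itv/= lte_fin gtr0_norm//.
have -> : overlap tau w al / (2 * al) = al^-1 * (overlap tau w al / 2) by field; rewrite gt_eqF.
case: ifPn => H; rewrite -?EFinD -?EFinM ?mule0; congr EFin.
  congr (_ * _); rewrite overlap_clamp//; move: H; clear mA.
  rewrite /Num.max /Num.min; case: (ltP (- al / 2) (tau - w / 2)) => ?;
  case: (ltP (al / 2) (tau + w / 2)) => ?; case: (ltP (tau + w / 2) (- (al / 2))) => ?;
  case: (ltP (tau - w / 2) (- (al / 2))) => ?; case: (ltP (al / 2) (tau - w / 2)) => ?; move=> ?; lra.
congr (_ * _); rewrite overlap_clamp//; move: H; clear mA.
rewrite -leNgt /Num.max /Num.min; case: (ltP (- al / 2) (tau - w / 2)) => ?;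
  case: (ltP (al / 2) (tau + w / 2)) => ?; case: (ltP (tau + w / 2) (- (al / 2))) => ?;
  case: (ltP (tau - w / 2) (- (al / 2))) => ?; case: (ltP (al / 2) (tau - w / 2)) => ?; move=> ?; lra.
Qed.

Lemma slab_cons m (al : 'I_m.+1 -> R) (tau w x : R) (y : m.-tuple R) :
  slab al tau w (Defs.cons_tuple (x, y)) <->
  0 <= x <= 1 /\ slab (fun i => al (lift ord0 i)) (tau - al ord0 * (x - 2^-1)) w y.
Proof.
rewrite /slab/=.
have -> : \sum_i al i * (tnth (Defs.cons_tuple (x, y)) i - 2^-1) =
    al ord0 * (x - 2^-1) + \sum_i al (lift ord0 i) * (tnth y i - 2^-1).
  rewrite big_ord_recl/=; congr (_ * (_ - _) + _).
  by apply: eq_bigr => i _; rewrite tnthS.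
have -> (p q r : R) : p + q - r = q - (r - p) by ring.
split => [[H1 H2]|[H0 [H1 H2]]].
  split; first by have := H1 ord0; rewrite (tnth_nth 0).
  by split => // i; have := H1 (lift ord0 i); rewrite tnthS.
split => // i; case: (unliftP ord0 i) => [j|] ->; first by rewrite tnthS.
by rewrite (tnth_nth 0).
Qed.

Lemma lebesgue_slabS m (al : 'I_m.+1 -> R) (tau w : R) :
  leb m.+1 (slab al tau w) =
  (\int[mu]_(x in `[0%R, 1%R])
     leb m (slab (fun i => al (lift ord0 i)) (tau - al ord0 * (x - 2^-1))%R w))%E.
Proof.
rewrite lebesgue_tupleS [RHS]integral_mkcond; apply: eq_integral => x _; rewrite patchE.
case: ifPn => [|nx].
  rewrite inE/= in_itv/= => x01; congr lebesgue_tuple.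
  by apply/seteqP; split => y /=; rewrite slab_cons => // -[].
rewrite (_ : [set y | _] = set0) ?measure0//.
apply/seteqP; split => y //=; rewrite slab_cons => -[x01 _].
by move: nx; rewrite notin_setE/= in_itv/=.
Qed.

Lemma lebesgue_slab0 m (tau w : R) :
  leb m (slab (fun=> 0) tau w) = (if `|tau| <= w / 2 then 1 else 0)%:E.
Proof.
elim: m => [|m IH].
  rewrite [LHS]/= diracE; case: ifPn => tw.
    rewrite mem_set// /slab/=; split; first by case.
    by rewrite big_ord0 sub0r normrN.
  rewrite memNset// /slab/= => -[_]; rewrite big_ord0 sub0r normrN.
  exact/negP.
rewrite lebesgue_slabS; under eq_integral do rewrite mul0r subr0 IH.
rewrite integral_cst//= lebesgue_measure_itv/= lte_fin ltr01 -EFinD/= subr0.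
by rewrite -EFinM mulr1.
Qed.

(** Averaging over one more coordinate of the cube multiplies the Fourier side by the characteristic
    function of a centred uniform variable. *)
Lemma integral_cos_slab (tau al u : R) : 0 <= al ->
  (\int[mu]_(x in `[0%R, 1%R]) (cos (2 * (tau - al * (x - 2^-1)) * u))%:E =
   (cos (2 * tau * u) * sqsinc (al ^+ 2 * u ^+ 2))%:E)%E.
Proof.
move=> al0; rewrite -exprMn.
have [be0|be0] := eqVneq (al * u) 0.
  rewrite be0 expr0n/= sqsinc0 mulr1.
  have E (x : R) : 2 * (tau - al * (x - 2^-1)) * u = 2 * tau * u.
    have -> : 2 * (tau - al * (x - 2^-1)) * u = 2 * tau * u - 2 * (x - 2^-1) * (al * u) by ring.
    by rewrite be0 mulr0 subr0.
  under eq_integral do rewrite E.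
  rewrite integral_cst//= lebesgue_measure_itv/= lte_fin ltr01 -EFinD/= subr0.
  by rewrite -EFinM mulr1.
pose F (x : R) := (- (2 * (al * u))^-1) * sin (2 * (tau - al * (x - 2^-1)) * u).
have dA (x : R) : is_derive x 1 (fun x : R => 2 * (tau - al * (x - 2^-1)) * u) (- (2 * (al * u))).
  eapply is_derive_eq.
    eapply is_derive_fM; last exact: is_derive_fcst.
    eapply is_derive_fM; first exact: is_derive_fcst.
    eapply is_derive_fD; first exact: is_derive_fcst.
    eapply is_derive_fN, is_derive_fM; first exact: is_derive_fcst.
    eapply is_derive_fD; [exact: is_derive_fid|exact: is_derive_fcst].
  by rewrite /=; ring.
have dF (x : R) : is_derive x 1 F (cos (2 * (tau - al * (x - 2^-1)) * u)).
  eapply is_derive_eq.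
    eapply is_derive_fM; first exact: is_derive_fcst.
    eapply (@is_derive_fcomp _ sin (fun x : R => 2 * (tau - al * (x - 2^-1)) * u)).
      exact: is_derive_sin.
    exact: dA.
  move: be0; rewrite mulf_eq0 negb_or => /andP[a1 u1].
  by rewrite /=; field; rewrite a1 u1.
have cc : continuous (fun x : R => cos (2 * (tau - al * (x - 2^-1)) * u)).
  move=> x; apply: (@continuous_comp _ _ _ (fun x : R => 2 * (tau - al * (x - 2^-1)) * u) cos).
    exact: is_derive_cont (dA x).
  exact: continuous_cos.
rewrite (@continuous_FTC2 R _ F 0 1) //.
- rewrite -EFinB /F; congr EFin.
  have -> : 2 * (tau - al * (1 - 2^-1)) * u = 2 * tau * u - al * u by field.
  have -> : 2 * (tau - al * (0 - 2^-1)) * u = 2 * tau * u + al * u by field.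
  rewrite sinB sinD -[in LHS](mul_sqsinc (al * u)); field.
  by move: be0; rewrite mulf_eq0 negb_or andbC.
- exact: continuous_subspaceT.
- split.
  + by move=> x _; exact: ex_derive.
  + by apply: cvg_at_right_filter; exact: is_derive_cont.
  + by apply: cvg_at_left_filter; exact: is_derive_cont.
- by move=> x _; rewrite derive1E; exact: derive_val.
Qed.

Lemma sqsinc_prod_dominated (m : nat) (w : R) (al : 'I_m -> R) (i : 'I_m) : 0 < w -> 0 < al i ->
  dominated (fun u => sqsinc (w ^+ 2 * u ^+ 2) * \prod_i sqsinc (al i ^+ 2 * u ^+ 2)).
Proof.
move=> w0 ai0.
have [C HC] := @sqsincM_dominated (w ^+ 2) (al i ^+ 2) (exprn_gt0 _ w0) (exprn_gt0 _ ai0).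
exists C => u; apply: le_trans (HC u).
rewrite !normrM ler_wpM2l// (bigD1 i)//= normrM ler_piMr//.
by rewrite normr_prod; apply: prodr_ile1 => k _; rewrite normr_ge0 sqsinc_norm.
Qed.

Lemma measurable_prod_sqsinc (I : finType) (K : pred I) (x : I -> R) :
  measurable_fun setT (fun u : R => \prod_(k | K k) sqsinc (x k * u ^+ 2)).
Proof.
rewrite (_ : (fun _ => _) = fun u => \prod_k (if K k then sqsinc (x k * u ^+ 2) else 1)).
  apply: measurable_prod => k _; case: (K k) => //.
  apply: measurable_sqsinc_comp.
  by apply: measurable_funM => //; exact: measurable_funX.
by apply/funext => u; rewrite big_mkcond.
Qed.

Lemma measurable_sqsinc_prod (m : nat) (w : R) (al : 'I_m -> R) :
  measurable_fun setT (fun u : R => sqsinc (w ^+ 2 * u ^+ 2) * \prod_i sqsinc (al i ^+ 2 * u ^+ 2)).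
Proof.
apply: measurable_funM; last exact: (measurable_prod_sqsinc xpredT (fun i => al i ^+ 2)).
by apply: measurable_sqsinc_comp; apply: measurable_funM => //; exact: measurable_funX.
Qed.

Lemma measurable_cosM (c : R) : measurable_fun setT (fun u : R => cos (c * u)).
Proof.
apply: continuous_measurable_fun => u; exact: is_derive_cont (is_derive_cosM c u).
Qed.

Lemma integrable_cos_sqsinc_prod (m : nat) (c w : R) (al : 'I_m -> R) (i : 'I_m) : 0 < w -> 0 < al i ->
  mu.-integrable setT (EFin \o (fun u : R => cos (c * u) *
    (sqsinc (w ^+ 2 * u ^+ 2) * \prod_i sqsinc (al i ^+ 2 * u ^+ 2)))).
Proof.
move=> w0 ai0; apply: integrable_dominated.
  by apply: measurable_funM; [exact: measurable_cosM|exact: measurable_sqsinc_prod].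
have [C HC] := sqsinc_prod_dominated w0 ai0.
exists C => u; apply: le_trans (HC u); rewrite normrM ler_piMl//.
exact: cos_norm1.
Qed.

Lemma integral_slab_fubini (tau al : R) (g : R -> R) : 0 <= al -> measurable_fun setT g ->
  mu.-integrable setT (EFin \o g) ->
  (\int[mu]_(x in `[0%R, 1%R]) (\int[mu]_u (cos (2 * (tau - al * (x - 2^-1)) * u) * g u)%:E) =
   \int[mu]_u (cos (2 * tau * u) * sqsinc (al ^+ 2 * u ^+ 2) * g u)%:E)%E.
Proof.
move=> al0 mg Ig.
pose f (z : R * R) := (\1_(`[0, 1]%classic : set R) z.1 * cos (2 * (tau - al * (z.1 - 2^-1)) * z.2) * g z.2)%R.
have mf : measurable_fun setT f.
  apply: measurable_funM; first apply: measurable_funM.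
  - by apply: measurableT_comp => //; exact: measurable_indic.
  - apply: (@measurableT_comp _ _ _ _ _ _ cos).
      by apply: continuous_measurable_fun; exact: continuous_cos.
    apply: measurable_funM => //; apply: measurable_funM => //.
    apply: measurable_funB => //; apply: measurable_funM => //.
    exact: measurable_funB.
  - exact: measurableT_comp mg _.
have mfE : @measurable_fun _ _ (measurableTypeR R * measurableTypeR R)%type _ setT (EFin \o f).
  exact/measurable_EFinP.
pose h (z : R * R) := (\1_(`[0, 1]%classic : set R) z.1 * g z.2)%R.
have mh : @measurable_fun _ _ (measurableTypeR R * measurableTypeR R)%type _ setT (EFin \o h).
  apply/measurable_EFinP; apply: measurable_funM.
    by apply: measurableT_comp => //; exact: measurable_indic.
  exact: measurableT_comp mg _.
have Ih : (mu \x mu)%E.-integrable setT (EFin \o h).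
  apply/(integrable12ltyP mu mu mh).
  rewrite (_ : (\int[mu]_x _)%E = (\int[mu]_x ((\1_(`[0, 1]%classic : set R) x)%:E * \int[mu]_u `|(g u)%:E|))%E).
    have /integrableP[_ Ioo] := Ig.
    rewrite ge0_integralZr//=;
      [|by apply/measurable_EFinP; exact: measurable_indic|exact: integral_ge0].
    rewrite integral_indic//= setIT lebesgue_measure_itv/= lte_fin ltr01 -EFinD/= subr0 mul1e.
    exact: Ioo.
  apply: eq_integral => x _; rewrite -ge0_integralZl//=;
    try (by apply/measurable_EFinP; apply: measurableT_comp); try (by rewrite lee_fin).
  by apply: eq_integral => u _; rewrite /h/= normrM EFinM ger0_norm.
have If : (mu \x mu)%E.-integrable setT (EFin \o f).
  apply: le_integrable Ih => // -[x u] _ /=; rewrite lee_fin /f /h/= !normrM.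
  by rewrite ler_wpM2r// ler_piMr// cos_norm1.
have FB := Fubini If.
rewrite [LHS](_ : _ = \int[mu]_x \int[mu]_y (EFin \o f) (x, y))%E; last first.
  rewrite [LHS]integral_mkcond; apply: eq_integral => x _; rewrite patchE.
  case: ifPn => x01; apply/esym; last first.
    by apply: integral0_eq => u _; rewrite /= /f /= indicE (negbTE x01) !mul0r.
  by apply: eq_integral => u _; rewrite /= /f /= indicE x01 mul1r.
rewrite FB; apply: eq_integral => u _.
have cc : continuous (fun x : R => cos (2 * (tau - al * (x - 2^-1)) * u)).
  move=> x; apply: (@continuous_comp _ _ _ (fun x : R => 2 * (tau - al * (x - 2^-1)) * u) cos).
    apply: cvgM; last exact: cvg_cst.
    apply: cvgM; first exact: cvg_cst.
    apply: cvgB; first exact: cvg_cst.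
    apply: cvgM; first exact: cvg_cst.
    by apply: cvgB; [exact: cvg_id|exact: cvg_cst].
  exact: continuous_cos.
rewrite (EFinM _ (g u)) -integral_cos_slab// -integralZr//; last first.
  by apply: continuous_compact_integrable; [exact: segment_compact|exact: continuous_subspaceT].
rewrite [RHS]integral_mkcond; apply: eq_integral => x _; rewrite patchE /= /f /= indicE.
by case: ifPn => x01; rewrite ?mul1r ?mul0r.
Qed.

Lemma integrableZl_EFin (k : R) (f : R -> R) : mu.-integrable setT (EFin \o f) ->
  mu.-integrable setT (EFin \o (fun u => k * f u)).
Proof. by move=> If; exact: (integrableZl measurableT k If). Qed.

(** Induction on the coordinates, each contributing one factor through Fubini. The base case is a
    slab with a single positive coefficient: with none, the lone factor [sqsinc (w ^ 2 * u ^ 2)] is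
    not absolutely integrable. Vanishing coefficients contribute factors equal to 1. *)
Lemma lebesgue_slabE m (al : 'I_m -> R) (tau w : R) : 0 < w -> (forall i, 0 <= al i) ->
  (exists i, 0 < al i) ->
  leb m (slab al tau w) =
  (w / fejer_mass * \int[mu]_u (cos (2 * tau * u) *
     (sqsinc (w ^+ 2 * u ^+ 2) * \prod_i sqsinc (al i ^+ 2 * u ^+ 2))))%:E.
Proof.
move=> w0; elim: m al tau => [al tau _ [[]]//|m IH al tau al0 [i ai0]].
rewrite lebesgue_slabS.
have fm := fejer_mass_gt0.
have [/existsP[j aj0]|/existsPn noj] := boolP [exists j, 0 < al (lift ord0 j)].
  pose g u := w / fejer_mass * (sqsinc (w ^+ 2 * u ^+ 2) * \prod_i sqsinc (al (lift ord0 i) ^+ 2 * u ^+ 2)).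
  have mg : measurable_fun setT g by apply: measurable_funM => //; exact: measurable_sqsinc_prod.
  have dg : dominated g by apply: dominatedZ; exact: (@sqsinc_prod_dominated _ _ (fun i => al (lift ord0 i)) j).
  have Ig := integrable_dominated mg dg.
  have Ic (c : R) : mu.-integrable setT (EFin \o (fun u => cos (c * u) * g u)).
    apply: integrable_dominated.
      by apply: measurable_funM => //; exact: measurable_cosM.
    rewrite (_ : (fun _ => _) = fun u => g u * cos (c * u)); last by apply/funext => u; rewrite mulrC.
    by apply: dominated_mul_bounded => // u; exact: cos_norm1.
  transitivity (\int[mu]_(x in `[0%R, 1%R])
     (\int[mu]_u (cos (2 * (tau - al ord0 * (x - 2^-1)) * u) * g u)%:E))%E.
    apply: eq_integral => x _; rewrite IH//; last by exists j.
    rewrite -RintegralZl//; last exact: (@integrable_cos_sqsinc_prod _ _ _ (fun i => al (lift ord0 i)) j).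
    rewrite fineK; last first.
      apply: integrable_fin_num => //; apply: integrableZl_EFin.
      exact: (@integrable_cos_sqsinc_prod _ _ _ (fun i => al (lift ord0 i)) j).
    by apply: eq_integral => u _; rewrite /g mulrCA.
  rewrite integral_slab_fubini// -RintegralZl//; last exact: (@integrable_cos_sqsinc_prod _ _ _ _ i).
  rewrite fineK; last first.
    apply: integrable_fin_num => //; apply: integrableZl_EFin.
    exact: (@integrable_cos_sqsinc_prod _ _ _ _ i).
  apply: eq_integral => u _; rewrite big_ord_recl /g; congr EFin; ring.
(* Here the first coefficient is the only positive one, and the volume is the length of an overlap
   of intervals. *)
have z : (fun j => al (lift ord0 j)) = fun=> 0.
  by apply/funext => j; apply/eqP; rewrite eq_le al0 andbT leNgt noj.
have a00 : 0 < al ord0.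
  move: ai0; case: (unliftP ord0 i) => [j|] -> //.
  by rewrite (congr1 (@^~ j) z) ltxx.
under eq_integral do rewrite z lebesgue_slab0.
rewrite [LHS](_ : _ = mu [set x | 0 <= x <= 1 /\ `|al ord0 * (x - 2^-1) - tau| <= w / 2]); last first.
  set B := [set x : R | `|al ord0 * (x - 2^-1) - tau| <= w / 2].
  have mB : measurable B.
    have mf : measurable_fun [set: R] (fun x : R => `|al ord0 * (x - 2^-1) - tau|).
      apply: measurableT_comp => //; apply: measurable_funB => //; apply: measurable_funM => //.
      exact: measurable_funB.
    have := mf measurableT _ (measurable_itv `]-oo, w / 2]).
    by rewrite setTI; congr measurable; apply/seteqP; split => z' /=; rewrite in_itv.
  transitivity (\int[mu]_(x in `[0%R, 1%R]) (\1_B x)%:E)%E.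
    apply: eq_integral => x _; rewrite indicE; congr EFin.
    rewrite distrC; case: ifPn => H; first by rewrite mem_set.
    by rewrite memNset// => /=; exact/negP.
  rewrite integral_indic//; congr (lebesgue_measure _).
  by apply/seteqP; split => x /=; rewrite in_itv/= => -[? ?]; split.
rewrite lebesgue_overlap//.
have pE u : \prod_i sqsinc (al i ^+ 2 * u ^+ 2) = sqsinc (al ord0 ^+ 2 * u ^+ 2).
  rewrite big_ord_recl big1 ?mulr1// => j _.
  by rewrite (congr1 (@^~ j) z) expr0n/= mul0r sqsinc0.
under eq_Rintegral do rewrite pE.
rewrite Rintegral_sqsinc_pair//; congr EFin; field.
by rewrite !gt_eqF.
Qed.

End fourier.

(** * The effect of a move on the volume *)

Section pair_step.
Variable R : realType.
Local Notation mu := (@lebesgue_measure R).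

Lemma prod_sqsinc_norm (I : finType) (K : pred I) (x : I -> R) u :
  `|\prod_(k | K k) sqsinc (x k * u ^+ 2)| <= 1.
Proof. by rewrite normr_prod; apply: prodr_ile1 => i _; rewrite normr_ge0 sqsinc_norm. Qed.

Lemma prod_sqsinc_dominated (I : finType) (K : pred I) (x : I -> R) p q : p != q ->
  K p -> K q -> 0 < x p -> 0 < x q ->
  dominated (fun u => \prod_(k | K k) sqsinc (x k * u ^+ 2)).
Proof.
move=> pq Kp Kq xp xq; have [C HC] := sqsincM_dominated xp xq; exists C => u.
apply: le_trans (HC u).
rewrite (bigD1 p)//= (bigD1 q)/=; last by rewrite Kq eq_sym.
rewrite mulrA normrM ler_piMr//.
exact: (prod_sqsinc_norm [pred k | (K k && (k != p)) && (k != q)]).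
Qed.

Lemma integrable_cosM_dominated (c : R) (f : R -> R) : measurable_fun setT f -> dominated f ->
  mu.-integrable setT (EFin \o (fun u => cos (c * u) * f u)).
Proof.
move=> mf df; apply: integrable_dominated.
  by apply: measurable_funM => //; exact: measurable_cosM.
rewrite (_ : (fun _ => _) = fun u => f u * cos (c * u)); last by apply/funext => u; rewrite mulrC.
by apply: dominated_mul_bounded => // u; exact: cos_norm1.
Qed.

Definition cosint (t : R) (f : R -> R) := \int[mu]_u (cos (2 * t * u) * f u).

Lemma cosint_lin (t a b : R) (f g : R -> R) :
  measurable_fun setT f -> dominated f -> measurable_fun setT g -> dominated g ->
  cosint t (fun u => a * f u + b * g u) = a * cosint t f + b * cosint t g.
Proof.
move=> mf df mg dg.
have If := integrable_cosM_dominated (2 * t) mf df.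
have Ig := integrable_cosM_dominated (2 * t) mg dg.
rewrite /cosint -!RintegralZl// -RintegralD//; try exact: integrableZl_EFin.
by apply: eq_Rintegral => u _; ring.
Qed.

Lemma gcos_cosint (t : R) k : gcos t k = cosint t (fun u => u ^+ k * gw u).
Proof. by rewrite /gcos /cosint; apply: eq_Rintegral => u _; rewrite mulrC. Qed.

Lemma measurable_polygw k : measurable_fun setT (fun u : R => u ^+ k * gw u).
Proof. by apply: continuous_measurable_fun; exact: continuous_polygw. Qed.

Lemma measurable_oneDsqrV : measurable_fun setT (fun u : R => (1 + u ^+ 2)^-1).
Proof. by apply: continuous_measurable_fun; exact: continuous_oneDsqrV. Qed.

Lemma cosint_bound (t : R) (f g : R -> R) : measurable_fun setT f ->
  measurable_fun setT g -> dominated g -> (forall u, `|f u| <= g u) ->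
  `|cosint t f| <= \int[mu]_u g u.
Proof.
move=> mf mg dg fg.
have df : dominated f.
  by have [C HC] := dg; exists C => u; apply: le_trans (HC u); apply: le_trans (ler_norm _).
have If := integrable_cosM_dominated (2 * t) mf df.
apply: le_trans (le_normr_Rintegral _ If) _ => //.
apply: le_Rintegral => //; first by apply: (integrable_norm If).
  exact: integrable_dominated.
move=> u _ /=; rewrite normrM; apply: le_trans (fg u).
by rewrite ler_piMl// cos_norm1.
Qed.

Lemma gcos00 : gcos 0 0 = Num.sqrt 6 * Num.sqrt pi :> R.
Proof.
have s6 : 0 < Num.sqrt (6 : R) by rewrite sqrtr_gt0.
rewrite /gcos; under eq_Rintegral do rewrite mulr0 mul0r cos0 mulr1 expr0 mul1r.
have m : measurable_fun setT (EFin \o @gauss_fun R).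
  by apply/measurable_EFinP; exact: measurable_gauss_fun.
have s0 : (Num.sqrt (6 : R))^-1 != 0 by rewrite invr_neq0// gt_eqF.
have := ge0_integral_affine 0 s0 m.
rewrite /= integralT_gauss => H; rewrite /Rintegral.
rewrite (_ : (\int[mu]_u (gw u)%:E)%E = (Num.sqrt 6 * Num.sqrt pi)%:E)//.
rewrite EFinM -[in RHS](ger0_norm (ltW s6)) -[in RHS](invrK (Num.sqrt 6)) normfV -H//.
  apply: eq_integral => u _; rewrite /gw /gauss_fun addr0 exprMn exprVn sqr_sqrtr//.
by move=> u; rewrite lee_fin gauss_fun_ge0.
Qed.

Lemma gcos00_gt0 : 0 < gcos 0 0 :> R.
Proof. by rewrite gcos00 mulr_gt0// sqrtr_gt0// pi_gt0. Qed.

(** After squaring, [pi ^ 2 < 27/2 * pi]. *)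
Lemma pi_lt_gcos00 : pi < 3 / 2 * gcos 0 0 :> R.
Proof.
have p4 : (pi : R) < 4 by have := @pihalf_lt2 R; lra.
have p0 := @pi_gt0 R; have K0 := gcos00_gt0.
have K2 : gcos 0 0 ^+ 2 = 6 * pi :> R by rewrite gcos00 exprMn !sqr_sqrtr// ltW.
rewrite -ltr_sqr ?nnegrE ?(ltW p0)//; last by apply: mulr_ge0; [|exact: ltW].
rewrite exprMn K2; nra.
Qed.

(** One third of the fourth Hermite polynomial [y ^ 4 - 6 y ^ 2 + 3] at [y = 2 sqrt 3 t]. It appears
    because the fourth cosine moment of a Gaussian is a fourth derivative of its Fourier
    transform. *)
Definition hermite4 (t : R) := 1 - 24 * t ^+ 2 + 48 * t ^+ 4.

Definition Phi (t : R) (d : nat) (x : 'I_d -> R) := cosint t (fun u => \prod_k sqsinc (x k * u ^+ 2)).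

(** The error is below [w K * (20.655 + 1.5)], hence below [3/10 * 74 w K = 22.2 w K], which the
    main term is assumed to reach. *)
Lemma sign_of_main_term (P E K J w p : R) : 0 < w -> 0 < E -> 0 < K -> p < 3 / 2 * K ->
  `|J + 3 / 10 * (P * E * K)| <= w * (20655 / 1000 * K + p) ->
  74 * w <= `|P| * E -> P * J < 0.
Proof.
move=> w0 E0 K0 pK H N.
have {}H : `|J + 3 / 10 * (P * E * K)| < 3 / 10 * (74 * w * K).
  apply: le_lt_trans H _; rewrite (_ : 3 / 10 * _ = w * (222 / 10 * K)); last by lra.
  by rewrite ltr_pM2l//; lra.
have NK : 74 * w * K <= `|P| * E * K by rewrite ler_pM2r.
have [P0|P0|P0] := ltgtP P 0.
- rewrite ltr0_norm// in NK; rewrite nmulr_rlt0//.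
  move: H; rewrite ltr_norml => /andP[H _]; move: H NK.
  by rewrite !mulNr; clear; set a := P * E * K; set b := 74 * w * K; lra.
- rewrite gtr0_norm// in NK; rewrite pmulr_rlt0//.
  move: H; rewrite ltr_norml => /andP[_ H]; move: H NK; clear.
  by set a := P * E * K; set b := 74 * w * K; lra.
- have : 0 < 74 * w * K by apply: mulr_gt0 => //; apply: mulr_gt0.
  by rewrite P0 normr0 !mul0r in NK; rewrite ltNge NK.
Qed.

(** The pointwise bound is integrated: the sixth and eighth moments of the weight are 405 and 8505
    times the total mass, whence [3/100 * 405 + 8505/1000 = 20655/1000], and the last term
    integrates to pi. *)
Lemma cosint_kernel_sign (t : R) (n : nat) (q : R -> R) : (0 < n)%N ->
  74 / n%:R <= `|hermite4 t| * expR (- (6 * t ^+ 2)) -> measurable_fun setT q ->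
  (forall u, `|q u + gw u * (90^-1 * u ^+ 4)| <=
     n%:R^-1 * (gw u * (3 / 100 * u ^+ 6 + 1000^-1 * u ^+ 8) + (1 + u ^+ 2)^-1)) ->
  dominated q ->
  hermite4 t * cosint t q < 0.
Proof.
move=> n0 nbig mq qb dq.
have i0 : 0 < n%:R^-1 :> R by rewrite invr_gt0 ltr0n.
pose e u := q u + gw u * (90^-1 * u ^+ 4).
have E4 : cosint t e = cosint t q + 90^-1 * gcos t 4.
  rewrite gcos_cosint -[cosint t q]mul1r -cosint_lin//.
  - by congr cosint; apply/funext => u; rewrite /e; ring.
  - exact: measurable_polygw.
  - exact: gw_poly_bound.
pose h u : R := 3 / 100 * (u ^+ 6 * gw u) + 1000^-1 * (u ^+ 8 * gw u) + 1 * (1 + u ^+ 2)^-1.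
pose g u : R := n%:R^-1 * h u.
have m6 := measurable_polygw 6; have m8 := measurable_polygw 8; have m1 := measurable_oneDsqrV.
have d6 := @gw_poly_bound R 6; have d8 := @gw_poly_bound R 8.
have d1 : dominated (fun u : R => (1 + u ^+ 2)^-1).
  by exists 1 => u; rewrite mul1r ger0_norm// invr_ge0 ltW// oneDsqr_gt0.
have mh : measurable_fun setT h.
  apply: measurable_funD; [apply: measurable_funD|]; apply: measurable_funM => //.
have dh : dominated h.
  by apply: dominatedD; [apply: dominatedD|]; exact: dominatedZ.
have mg : measurable_fun setT g by exact: measurable_funM.
have dg : dominated g.
  exact: dominatedZ.
have me : measurable_fun setT e.
  apply: measurable_funD => //; apply: measurable_funM.
    by apply: continuous_measurable_fun; exact: continuous_gw.
  by apply: measurable_funM => //; exact: measurable_funX.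
have := @cosint_bound t e g me mg dg.
have -> : \int[mu]_u g u = n%:R^-1 * (20655 / 1000 * gcos 0 0 + pi).
  rewrite /g RintegralZl//; last exact: integrable_dominated.
  rewrite /h Rintegral_lin3; [|exact: integrable_dominated..].
  have G k : \int[mu]_u (u ^+ k * gw u) = gcos 0 k.
    by rewrite /gcos; apply: eq_Rintegral => u _; rewrite mulr0 mul0r cos0 mulr1.
  have -> : \int[mu]_u (1 + u ^+ 2)^-1 = pi by rewrite /Rintegral integralT_oneDsqrV.
  by rewrite !G gcos6_0 gcos8_0; field; rewrite pnatr_eq0 -lt0n.
move=> H; have {}H : `|cosint t e| <= n%:R^-1 * (20655 / 1000 * gcos 0 0 + pi).
  apply: H => u; apply: le_trans (qb u) _; rewrite /g /h ler_pM2l// le_eqVlt; apply/orP; left.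
  by apply/eqP; ring.
move: H; rewrite E4 gcos4 gcos0E -/(hermite4 t) => H.
apply: sign_of_main_term i0 (expR_gt0 _) gcos00_gt0 pi_lt_gcos00 _ nbig.
apply: le_trans H; rewrite le_eqVlt; apply/orP; left; apply/eqP.
by congr (`|_ + _|); field.
Qed.

(** The case [D = m] is allowed, so a move may start from a vanishing coordinate. Among the
    untouched coordinates at least [n - 2] must be close to [1/n], while the others may vanish: this
    covers faces of any codimension. *)
Lemma Phi_pair_step (t : R) (n d : nat) (x x' : 'I_d -> R) (i j : 'I_d) (m D D' : R) : (124 <= n)%N ->
  74 / n%:R <= `|hermite4 t| * expR (- (6 * t ^+ 2)) -> i != j ->
  0 <= D' -> D' < D -> D <= m -> m <= 101 / 100 / n%:R ->
  (forall k, k != i -> k != j -> x' k = x k) ->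
  (forall k, k != i -> k != j -> 0 <= x k <= 101 / 100 / n%:R) ->
  \sum_(k | (k != i) && (k != j)) x k = 1 - 2 * m ->
  (n - 2 <= #|[set k | (k != i) && (k != j) & (99 / 100 / n%:R <= x k)%R]|)%N ->
  x i = m - D -> x j = m + D -> x' i = m - D' -> x' j = m + D' ->
  hermite4 t * (Phi t x - Phi t x') < 0.
Proof.
move=> n124 nbig ij D'0 D'D Dm mn xx' xb xs xbig xi xj x'i x'j.
have n0 : 0 < n%:R :> R by rewrite ltr0n (leq_trans _ n124).
pose K : pred 'I_d := fun k => (k != i) && (k != j).
(* Two positive untouched coordinates make the common factor [A] integrable, whatever the moved
   coordinates are. *)
have /card_gt1P[p [q [pS qS pq]]] : (1 < #|[set k | K k & (99 / 100 / n%:R <= x k)%R]|)%N.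
  by apply: leq_trans xbig; rewrite ltn_subRL; exact: leq_trans n124.
move: pS qS; rewrite !inE => /andP[Kp xp] /andP[Kq xq].
have c0 : 0 < 99 / 100 / n%:R :> R by rewrite divr_gt0.
have {}xp := lt_le_trans c0 xp; have {}xq := lt_le_trans c0 xq.
pose A u := \prod_(k | K k) sqsinc (x k * u ^+ 2).
have mA : measurable_fun setT A := measurable_prod_sqsinc K x.
have dA : dominated A := prod_sqsinc_dominated pq Kp Kq xp xq.
have ms c : measurable_fun setT (fun u : R => sqsinc (c * u ^+ 2)).
  by apply: measurable_sqsinc_comp; apply: measurable_funM => //; exact: measurable_funX.
pose B (y z u : R) := A u * (sqsinc (y * u ^+ 2) * sqsinc (z * u ^+ 2)).
have mB y z : measurable_fun setT (B y z) by apply: measurable_funM => //; exact: measurable_funM.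
have dB y z : dominated (B y z).
  apply: dominated_mul_bounded => // u; rewrite normrM mulr_ile1// sqsinc_norm//.
have PhiE y : (forall k, k != i -> k != j -> y k = x k) -> Phi t y = cosint t (B (y i) (y j)).
  move=> yx; congr cosint; apply/funext => u.
  rewrite (bigD1 i)//= (bigD1 j)/=; last by rewrite eq_sym.
  rewrite mulrA mulrC; congr (_ * _); apply: eq_bigr => k /andP[ki kj].
  by rewrite yx.
rewrite (PhiE x)// (PhiE x')// xi xj x'i x'j.
have DD : 0 < D ^+ 2 - D' ^+ 2.
  by rewrite subr_gt0 ltr_sqr ?nnegrE// (le_trans D'0 (ltW D'D)).
pose qq u := (D ^+ 2 - D' ^+ 2)^-1 * B (m - D) (m + D) u + - (D ^+ 2 - D' ^+ 2)^-1 * B (m - D') (m + D') u.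
have qE : cosint t (B (m - D) (m + D)) - cosint t (B (m - D') (m + D')) = (D ^+ 2 - D' ^+ 2) * cosint t qq.
  rewrite /qq cosint_lin//; field; exact: lt0r_neq0.
rewrite qE mulrCA pmulr_rlt0//.
apply: (@cosint_kernel_sign t n); [by apply: leq_trans n124|exact: nbig|..].
- by apply: measurable_funD; exact: measurable_funM.
- move=> u.
  have m0 : 0 <= m by rewrite (le_trans _ Dm)// (le_trans D'0 (ltW D'D)).
  have := @pair_kernel_bound R d n K x m (u ^+ 2) D D' n124 m0 mn.
  move=> H; have {}H := H _ xs xbig (sqr_ge0 u) D'0 D'D Dm.
  rewrite -!exprM in H.
  rewrite (_ : qq u + _ = \prod_(k | K k) sqsinc (x k * u ^+ 2) *
        ((sqsinc ((m - D) * u ^+ 2) * sqsinc ((m + D) * u ^+ 2) -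
          sqsinc ((m - D') * u ^+ 2) * sqsinc ((m + D') * u ^+ 2)) /
         (D ^+ 2 - D' ^+ 2)) + expR (- (6^-1 * u ^+ 2)) * (90^-1 * u ^+ (2 * 2))).
    by apply: H => k /andP[ki kj]; exact: xb.
  by rewrite /qq /B /A /gw; ring.
- by apply: dominatedD; exact: dominatedZ.
Qed.

End pair_step.

(** * Local extrema *)

Section local_extrema.
Variable R : realType.

(** The coordinate [j] is eliminated, and its factor [(a 0 j)^-1] cancels the width of the slab; [k]
    ensures integrability. The result no longer depends on the choice of [j]. *)
Lemma section_volumeE (d : nat) (t : R) (a : 'rV[R]_d) j k : sphere_orthant a ->
  j != k -> 0 < a 0 j -> 0 < a 0 k ->
  section_volume t a = ((fejer_mass R)^-1 * Phi t (fun i => a 0 i ^+ 2))%:E.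
Proof.
case: d a j k => [|m] a j k; first by case: j.
move=> sa jk aj ak; rewrite (section_volume_slab t sa aj) lebesgue_slabE//.
- have fm := fejer_mass_gt0 R.
  rewrite -EFinM; congr EFin; rewrite mulrA mulrA mulVf ?gt_eqF// mul1r.
  congr (_ * _); apply: eq_Rintegral => u _.
  rewrite mulrN mulNr cosN; congr (_ * _).
  by rewrite (bigD1_ord j).
- by move=> i; case: sa.
- by move: ak; case: (unliftP j k) jk => [i ->|->]; [exists i|rewrite eqxx].
Qed.

Lemma deviation_signs (n : nat) (x : 'I_n -> R) (c : R) : \sum_k (x k - c) = 0 ->
  (exists k, x k != c) -> exists i j, x i < c /\ c < x j.
Proof.
move=> s0 [k xk].
have [/existsP[i xi]|/existsPn ni] := boolP [exists i, x i < c]; last first.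
  have x0 i : 0 <= x i - c by rewrite subr_ge0 leNgt ni.
  have /psumr_eq0P : forall i, true -> 0 <= x i - c by [].
  by move=> /(_ s0 k isT)/eqP; rewrite subr_eq0 (negbTE xk).
have [/existsP[j xj]|/existsPn nj] := boolP [exists i, c < x i]; first by exists i, j.
have /psumr_eq0P : forall i, true -> 0 <= c - x i by move=> l _; rewrite subr_ge0 leNgt nj.
move=> H; have : \sum_k (c - x k) = 0.
  by apply/eqP; rewrite -oppr_eq0 -sumrN -[X in _ == X]s0; apply/eqP; apply: eq_bigr => l _; rewrite opprB.
by move=> /H /(_ k isT)/eqP; rewrite subr_eq0 eq_sym (negbTE xk).
Qed.

Lemma card_setD2 (n : nat) (A K : {set 'I_n}) (i j : 'I_n) :
  {subset A :\: [set i; j] <= K} -> (#|A| - 2 <= #|K|)%N.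
Proof.
move=> /fintype.subsetP/subset_leq_card; apply: leq_trans.
rewrite cardsD leq_sub2l// (leq_trans (subset_leq_card (subsetIr _ _)))// cards2.
by case: (i != j).
Qed.

(* Replacing [x i < c < x j] by [c] and [x i + x j - c] strictly decreases the
   number of coordinates that differ from the mean [c]. *)
Lemma Phi_smoothing (t : R) (n : nat) (x : 'I_n -> R) : (124 <= n)%N ->
  74 / n%:R <= `|hermite4 t| * expR (- (6 * t ^+ 2)) ->
  \sum_k x k = 1 -> (forall k, 99 / 100 / n%:R <= x k <= 101 / 100 / n%:R) ->
  (exists k, x k != n%:R^-1) ->
  hermite4 t * (Phi t x - Phi t (fun _ : 'I_n => n%:R^-1)) < 0.
Proof.
move=> n124 nbig.
have n0 : 0 < n%:R :> R by rewrite ltr0n (leq_trans _ n124).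
set c : R := n%:R^-1.
have c0 : 0 < c by rewrite invr_gt0.
have [p] := ubnP #|[pred k | x k != c]|.
elim: p => // p IH in x *; rewrite ltnS => xp sx xb xc.
have [i [j [xi xj]]] : exists i j, x i < c /\ c < x j.
  apply: deviation_signs xc; rewrite sumrB sx sumr_const card_ord -mulr_natr /c mulVf ?subrr//.
  by rewrite gt_eqF.
have ij : i != j by apply: contraTneq (lt_trans xi xj) => ->; rewrite ltxx.
(* With this [D'], one of [m - D'] and [m + D'] equals [c]: the former if [c <= m], the latter
   otherwise. *)
pose m := (x i + x j) / 2; pose D := (x j - x i) / 2; pose D' := `|m - c|.
pose y k := if k == i then m - D' else if k == j then m + D' else x k.
have yi : y i = m - D' by rewrite /y eqxx.
have yj : y j = m + D' by rewrite /y eq_sym (negbTE ij) eqxx.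
have yk k : k != i -> k != j -> y k = x k by rewrite /y => /negbTE -> /negbTE ->.
have D'0 : 0 <= D' := normr_ge0 _.
have D'D : D' < D by rewrite /D' /D /m ltr_norml; apply/andP; split; lra.
have /andP[xi1 xi2] := xb i; have /andP[xj1 xj2] := xb j.
have Dm : D <= m by rewrite /D /m; move: c0 xi1; rewrite -/c; clear; lra.
have mn : m <= 101 / 100 / n%:R by rewrite /m; move: xi2 xj2; rewrite -/c; clear; lra.
have sK : \sum_(k | (k != i) && (k != j)) x k = 1 - 2 * m.
  by move: sx; rewrite (bigD1 i)//= (bigD1 j)/=; [rewrite /m; lra|rewrite eq_sym].
have step : hermite4 t * (Phi t x - Phi t y) < 0.
  apply: (@Phi_pair_step R t n n x y i j m D D') => //.
  - move=> k _ _; have /andP[H1 ->] := xb k; rewrite andbT; apply: le_trans H1.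
    by rewrite -/c; move: c0; clear; lra.
  - rewrite -[n in (n - 2)%N]card_ord -cardsT; apply: (@card_setD2 _ _ _ i j) => k.
    rewrite !inE negb_or andbT => ->; by have /andP[-> _] := xb k.
  - by rewrite /m /D; lra.
  - by rewrite /m /D; lra.
(* As [D' < D], the new values lie between [x i] and [x j], so the window around [1/n] is preserved
   and the induction can go on. *)
have yb k : 99 / 100 / n%:R <= y k <= 101 / 100 / n%:R.
  rewrite /y /D' /m; rewrite -/c in xi1 xi2 xj1 xj2 *.
  case: eqP => _; last case: eqP => _ //.
    move: xi xj xi1 xj2; clear; case: (ger0P ((x i + x j) / 2 - c)) => h *; apply/andP; split; lra.
  move: xi xj xi1 xj2; clear; case: (ger0P ((x i + x j) / 2 - c)) => h *; apply/andP; split; lra.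
have sy : \sum_k y k = 1.
  rewrite (bigD1 i)//= (bigD1 j)/=; last by rewrite eq_sym.
  rewrite (eq_bigr x) => [|k /andP[ki kj]]; last by rewrite yk.
  by rewrite sK yi yj; lra.
have [/existsP[k ykc]|/existsPn ny] := boolP [exists k, y k != c]; last first.
  suff <- : y = fun=> c by exact: step.
  by apply/funext => k; apply/eqP; have := ny k; rewrite negbK.
have {IH} := IH y.
have yp : (#|[pred k | y k != c]| < p)%N.
  apply: leq_trans xp; apply: proper_card; apply/properP; split.
    apply/fintype.subsetP => l; rewrite !inE/=; have [->|li] := eqVneq l i; first by rewrite (lt_eqF xi).
    by have [->|lj] := eqVneq l j; [rewrite (gt_eqF xj)|rewrite yk].
  have [mc|mc] := leP 0 (m - c).
    by exists i; rewrite !inE/= ?(lt_eqF xi)// yi /D' ger0_norm// opprB addrC subrK eqxx.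
  by exists j; rewrite !inE/= ?(gt_eqF xj)// yj /D' ltr0_norm// opprB addrC subrK eqxx.
move=> /(_ yp sy yb (ex_intro _ k ykc)); move: step; clear.
by rewrite !mulrBr; lra.
Qed.

Lemma gamma_sqr : gamma_minus ^+ 2 = (1 - Num.sqrt (2 / 3)) / 4 :> R /\
  gamma_plus ^+ 2 = (1 + Num.sqrt (2 / 3)) / 4 :> R.
Proof.
have s1 : Num.sqrt (2 / 3) <= 1 :> R.
  by rewrite -[leRHS]sqrtr1 ler_sqrt//; lra.
have s0 : 0 <= Num.sqrt (2 / 3) :> R by [].
rewrite /gamma_minus /gamma_plus !exprMn !sqr_sqrtr; [|lra..].
by split; field.
Qed.

Lemma hermite4_factor (t : R) :
  hermite4 t = 48 * ((t ^+ 2 - gamma_minus ^+ 2) * (t ^+ 2 - gamma_plus ^+ 2)).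
Proof.
have [-> ->] := gamma_sqr; have : Num.sqrt (2 / 3) ^+ 2 = 2 / 3 :> R by rewrite sqr_sqrtr; lra.
rewrite /hermite4; set s := Num.sqrt _ => s2.
have -> : 48 * ((t ^+ 2 - (1 - s) / 4) * (t ^+ 2 - (1 + s) / 4)) = 48 * t ^+ 4 - 24 * t ^+ 2 + 3 * (1 - s ^+ 2).
  by field.
by rewrite s2; lra.
Qed.

Lemma gamma_ge0 : 0 <= gamma_minus :> R /\ 0 <= gamma_plus :> R.
Proof. by rewrite /gamma_minus /gamma_plus; split; apply: mulr_ge0. Qed.

Lemma gamma_minus_le_plus : gamma_minus <= gamma_plus :> R.
Proof.
have [g0 g1] := gamma_ge0; have [m p] := gamma_sqr.
rewrite -ler_sqr// m p; have : 0 <= Num.sqrt (2 / 3) :> R by [].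
lra.
Qed.

Lemma hermite4_gt0 (t : R) : 0 <= t -> t < gamma_minus \/ gamma_plus < t -> 0 < hermite4 t.
Proof.
move=> t0; have [g0 g1] := gamma_ge0; have gg := gamma_minus_le_plus.
have gs : gamma_minus ^+ 2 <= gamma_plus ^+ 2 :> R by rewrite ler_sqr.
rewrite hermite4_factor => -[h|h]; rewrite pmulr_rgt0//.
  have h2 : t ^+ 2 < gamma_minus ^+ 2 by rewrite ltr_sqr.
  by rewrite nmulr_lgt0; lra.
have h2 : gamma_plus ^+ 2 < t ^+ 2 by rewrite ltr_sqr.
by apply: mulr_gt0; lra.
Qed.

Lemma hermite4_lt0 (t : R) : gamma_minus < t -> t < gamma_plus -> hermite4 t < 0.
Proof.
have [g0 g1] := gamma_ge0 => h1 h2; have t0 := le_trans g0 (ltW h1).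
rewrite hermite4_factor pmulr_rlt0// pmulr_rlt0 ?subr_gt0 ?subr_lt0 ltr_sqr//.
Qed.

End local_extrema.

(** * The diagonal point and its neighbours on the sphere *)

Section theorem_cases.
Variable R : realType.

Lemma large_dimension (t : R) (n : nat) : 0 <= t -> hermite4 t != 0 ->
  Num.max 124 (expR (6 * t ^+ 2) * ((74 + 84 * t) / `|hermite4 t|)) <= n%:R ->
  (124 <= n)%N /\ 74 / n%:R <= `|hermite4 t| * expR (- (6 * t ^+ 2)).
Proof.
move=> t0 h0; rewrite ge_max => /andP[n124 H]; split; first by rewrite -(ler_nat R).
have n0 : 0 < n%:R :> R by apply: lt_le_trans n124.
have e0 := expR_gt0 (6 * t ^+ 2).
rewrite expRN; rewrite ler_pdivrMr//; rewrite mulrAC ler_pdivlMr//.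
rewrite mulrA ler_pdivrMr ?normr_gt0// in H.
rewrite [leRHS]mulrC; apply: le_trans H.
rewrite mulrC ler_pM2l//; lra.
Qed.

(** [|sqrt x - sqrt y|] is at most [sqrt x + sqrt y], so its square is at most [|x - y|]. Unlike a
    Lipschitz bound this holds near 0, where a vanishing coordinate is perturbed. *)
Lemma sqrt_dist (x y e : R) : 0 <= x -> 0 <= y -> 0 < e -> `|x - y| < e ^+ 2 ->
  `|Num.sqrt x - Num.sqrt y| < e.
Proof.
move=> x0 y0 e0 xy; rewrite -ltr_sqr ?nnegrE ?(ltW e0)//; apply: le_lt_trans xy.
rewrite -{2}(sqr_sqrtr x0) -{2}(sqr_sqrtr y0) subr_sqr normrM expr2 ler_wpM2l//.
have := sqrtr_ge0 x; have := sqrtr_ge0 y; rewrite ler_norml => p q.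
by rewrite ger0_norm ?addr_ge0//; apply/andP; split; lra.
Qed.

Lemma ball_rowP (d : nat) (a b : 'rV[R]_d) (e : R) : 0 < e ->
  ball a e b <-> forall k, `|a 0 k - b 0 k| < e.
Proof.
move=> e0; split => [[_ H] k|H]; first exact: H.
by split => // i j; rewrite ord1; exact: H.
Qed.

Lemma hermite4_neq0 (t : R) : 0 <= t -> t <> gamma_minus -> t <> gamma_plus -> hermite4 t != 0.
Proof.
move=> t0 tm tp; have [tm'|mt|//] := ltgtP t gamma_minus.
  by rewrite gt_eqF// hermite4_gt0//; left.
have [tp'|pt|//] := ltgtP t gamma_plus; first by rewrite lt_eqF// hermite4_lt0.
by rewrite gt_eqF// hermite4_gt0//; right.
Qed.

Section near_diagonal.
Variables (t : R) (d n : nat) (a : 'rV[R]_d) (I : {set 'I_d}).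
Hypothesis n124 : (124 <= n)%N.
Hypothesis nbig : 74 / n%:R <= `|hermite4 t| * expR (- (6 * t ^+ 2)).
Hypothesis Icard : #|I| = n.
Hypothesis aI : forall i, a 0 i = if i \in I then (Num.sqrt n%:R)^-1 else 0.

Lemma diagonal_sqr k : a 0 k ^+ 2 = if k \in I then n%:R^-1 else 0.
Proof. by rewrite aI; case: ifP => _; rewrite ?expr0n// exprVn sqr_sqrtr. Qed.

Lemma two_in_face : exists i j, [/\ i \in I, j \in I & i != j].
Proof.
have /card_gt1P[i [j [Ii Ij ij]]] : (1 < #|I|)%N by rewrite Icard (leq_trans _ n124).
by exists i, j.
Qed.

Lemma diagonal_sphere : sphere_orthant a.
Proof.
have n0 : 0 < n%:R :> R by rewrite ltr0n (leq_trans _ n124).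
split; last by move=> k; rewrite aI; case: ifP => // _; rewrite invr_ge0.
under eq_bigr do rewrite diagonal_sqr.
by rewrite -big_mkcond sumr_const Icard -(mulr_natr n%:R^-1) mulVf// gt_eqF.
Qed.

Lemma Phi_local_diagonal : n = d ->
  \forall b \near a, sphere_orthant b -> b <> a ->
    exists va vb, [/\ section_volume t a = va%:E, section_volume t b = vb%:E &
      hermite4 t * (vb - va) < 0].
Proof.
move=> nd; have n0 : 0 < n%:R :> R by rewrite ltr0n (leq_trans _ n124).
have IT k : k \in I.
  by have /eqP -> : I == finset.setT by rewrite eqEcard finset.subsetT cardsT card_ord Icard nd leqnn.
pose s := (Num.sqrt (n%:R : R))^-1.
have s0 : 0 < s by rewrite invr_gt0 sqrtr_gt0.
have s2 : s ^+ 2 = n%:R^-1 by rewrite exprVn sqr_sqrtr// ltW.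
have aE k : a 0 k = s by rewrite aI IT.
(* This radius suffices because [(299/300) ^ 2 > 99/100] and [(301/300) ^ 2 < 101/100]. *)
have s3 : 0 < s / 300 by lra.
apply/nbhs_ballP; exists (s / 300); first exact: s3.
move=> b /(ball_rowP _ _ s3) H sb ba.
have bk k : 0 < b 0 k /\ 99 / 100 / n%:R <= b 0 k ^+ 2 <= 101 / 100 / n%:R.
  have := H k; rewrite aE ltr_norml => /andP[h1 h2].
  have h3 : s * (299 / 300) < b 0 k by lra.
  have h4 : b 0 k < s * (301 / 300) by lra.
  split; first by lra.
  by rewrite -s2; apply/andP; split; nra.
have [i [j [Ii Ij ij]]] := two_in_face.
have sa := diagonal_sphere.
have F0 : 0 < (fejer_mass R)^-1 by rewrite invr_gt0 fejer_mass_gt0.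
exists ((fejer_mass R)^-1 * Phi t (fun k => a 0 k ^+ 2)), ((fejer_mass R)^-1 * Phi t (fun k => b 0 k ^+ 2)).
split; first by rewrite (section_volumeE t sa ij)// aE.
  by rewrite (section_volumeE t sb ij)//; apply: (bk _).1.
rewrite -mulrBr mulrCA pmulr_rlt0//.
rewrite (_ : (fun k => a 0 k ^+ 2) = fun=> n%:R^-1); last by apply/funext => k; rewrite aE s2.
move: n124 nbig bk; rewrite nd => n124' nbig' bk.
apply: Phi_smoothing => //.
- by case: sb.
- by move=> k; exact: (bk k).2.
- apply: contrapT => nx; apply: ba; apply/rowP => k.
  have [//|/eqP nk] := eqVneq (b 0 k) (a 0 k).
  exfalso; apply: nx; exists k; rewrite (_ : d%:R^-1 = s ^+ 2); last (by rewrite s2 nd); apply/negP => /eqP bs; apply: nk.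
  rewrite aE; apply/eqP; move/eqP: bs; rewrite eqrXn2// ltW//; exact: (bk k).1.
Qed.

(** Transfers points from squared coordinates to the sphere: a distance below [e ^ 2] between the
    squares gives a distance below [e]. The indices [p] and [q] supply the two positive coordinates
    of the volume formula. *)
Lemma perturbation (x : 'I_d -> R) (e : R) p q : 0 < e ->
  (forall k, 0 <= x k) -> \sum_k x k = 1 -> (forall k, `|a 0 k ^+ 2 - x k| < e ^+ 2) ->
  p != q -> 0 < x p -> 0 < x q ->
  exists b, [/\ ball a e b, sphere_orthant b &
    section_volume t b = ((fejer_mass R)^-1 * Phi t x)%:E].
Proof.
move=> e0 x0 sx xa pq xp xq.
pose b := \row_k Num.sqrt (x k).
have b2 k : b 0 k ^+ 2 = x k by rewrite mxE sqr_sqrtr.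
have sb : sphere_orthant b.
  by split; [under eq_bigr do rewrite b2|move=> k; rewrite mxE].
exists b; split => //.
  apply/ball_rowP => // k; rewrite mxE.
  by have := sqrt_dist (sqr_ge0 _) (x0 k) e0 (xa k); rewrite sqrtr_sqr (ger0_norm (diagonal_sphere.2 k)).
rewrite (section_volumeE t sb pq) ?mxE ?sqrtr_gt0//.
by congr (_ * Phi _ _)%:E; apply/funext => k; rewrite b2.
Qed.

Lemma Phi_not_extremal (e : R) : (n < d)%N -> 0 < e ->
  exists va b vb b' vb', [/\ section_volume t a = va%:E,
    [/\ ball a e b, sphere_orthant b & section_volume t b = vb%:E],
    [/\ ball a e b', sphere_orthant b' & section_volume t b' = vb'%:E],
    hermite4 t * (va - vb) < 0 & hermite4 t * (vb' - va) < 0].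
Proof.
move=> nd e0; have n0 : 0 < n%:R :> R by rewrite ltr0n (leq_trans _ n124).
have F0 : 0 < (fejer_mass R)^-1 by rewrite invr_gt0 fejer_mass_gt0.
have [i [j [Ii Ij ij]]] := two_in_face.
have [l lI] : exists l, l \notin I.
  apply/existsP; rewrite -negb_forall; apply/negP => /forallP H.
  have /eqP : #|I| = d.
    by rewrite -[RHS]card_ord -cardsT; apply: eq_card => k; rewrite inE H.
  by rewrite Icard ltn_eqF.
have li : l != i by apply: contraNneq lI => ->.
have lj : l != j by apply: contraNneq lI => ->.
set c : R := n%:R^-1.
have c0 : 0 < c by rewrite invr_gt0.
have a2 k : a 0 k ^+ 2 = if k \in I then c else 0 := diagonal_sqr k.
have a2b k : 0 <= a 0 k ^+ 2 <= 101 / 100 / n%:R.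
  by rewrite a2 -/c; case: ifP => _; apply/andP; split => //; lra.
have sa2 : \sum_k a 0 k ^+ 2 = 1 := diagonal_sphere.1.
have cardK p q : (n - 2 <= #|[set k | (k != p) && (k != q) & (99 / 100 / n%:R <= a 0 k ^+ 2)%R]|)%N.
  rewrite -[X in (X - 2)%N]Icard; apply: (@card_setD2 _ _ _ p q) => k; rewrite !inE negb_or => /andP[-> kI] /=.
  by rewrite a2 kI -/c; lra.
(* [c / 4] keeps [c / 2 - de] non-negative and the perturbed coordinates positive; [e ^ 2 / 2] keeps
   the squares strictly within [e ^ 2]. *)
pose de := Num.min (c / 4) (e ^+ 2 / 2).
have e20 : 0 < e ^+ 2 by rewrite exprn_gt0.
have d0 : 0 < de by rewrite lt_min; apply/andP; split; lra.
have dc : de <= c / 4 by rewrite ge_min lexx.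
have dse : de < e ^+ 2 by rewrite gt_min; apply/orP; right; lra.
have cde0 : 0 < c - de by lra.
have cde1 : 0 < c + de by lra.
have c2de : 0 <= c / 2 - de by lra.
have c2de' : c / 2 - de < c / 2 by lra.
have cn : c <= 101 / 100 / n%:R by rewrite -/c; lra.
have c2n : c / 2 <= 101 / 100 / n%:R by rewrite -/c; lra.
have cc : 99 / 100 / n%:R <= c by rewrite -/c; lra.
have c2 : c = 2 * (c / 2) by lra.
have dec : de <= c by lra.
have cD : c - de + (c + de) = c + c by lra.
have ext p q (u v : R) : p != q -> let x k := if k == p then u else if k == q then v else a 0 k ^+ 2 in
    u + v = a 0 p ^+ 2 + a 0 q ^+ 2 -> \sum_k x k = 1.
  move=> pq x uv; rewrite (bigD1 p)//= (bigD1 q)/=; last by rewrite eq_sym.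
  rewrite (eq_bigr (fun k => a 0 k ^+ 2)) => [|k /andP[kp kq]]; last by rewrite /x (negbTE kp) (negbTE kq).
  rewrite /x eqxx eq_sym (negbTE pq) eqxx addrA uv -sa2 [RHS](bigD1 p)//= [X in _ = _ + X](bigD1 q)/= ?addrA//.
  by rewrite eq_sym.
have sK p q : p != q -> \sum_(k | (k != p) && (k != q)) a 0 k ^+ 2 = 1 - (a 0 p ^+ 2 + a 0 q ^+ 2).
  move=> pq; rewrite -sa2 [X in X - _](bigD1 p)//= [X in _ + X - _](bigD1 q)/=; last by rewrite eq_sym.
  lra.
have ai : a 0 i ^+ 2 = c by rewrite a2 Ii.
have aj : a 0 j ^+ 2 = c by rewrite a2 Ij.
have al : a 0 l ^+ 2 = 0 by rewrite a2 (negbTE lI).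
(* [x] shifts mass from [i] in the face to [l] outside it, so the diagonal point is the less equal
   of the two; [y] unbalances [i] and [j] inside the face, so the diagonal point is the more equal
   one. Hence the opposite signs. *)
pose x k := if k == l then de else if k == i then c - de else a 0 k ^+ 2.
pose y k := if k == i then c - de else if k == j then c + de else a 0 k ^+ 2.
have xl : x l = de by rewrite /x eqxx.
have xi : x i = c - de by rewrite /x eq_sym (negbTE li) eqxx.
have yi : y i = c - de by rewrite /y eqxx.
have yj : y j = c + de by rewrite /y eq_sym (negbTE ij) eqxx.
have dn : `|de| < e ^+ 2 by rewrite gtr0_norm.
have [b [ab sb vb]] : exists b, [/\ ball a e b, sphere_orthant b &
    section_volume t b = ((fejer_mass R)^-1 * Phi t x)%:E].
  apply: (@perturbation x e l i) => //.
  - move=> k; rewrite /x; case: eqP => _; first exact: ltW.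
    by case: eqP => _; [exact: ltW|exact: sqr_ge0].
  - by apply: ext => //; rewrite al ai add0r addrC subrK.
  - move=> k; rewrite /x; case: eqP => [->|_]; first by rewrite al sub0r normrN.
    by case: eqP => [->|_]; [rewrite ai opprB addrC subrK|rewrite subrr normr0].
  - by rewrite xl.
  - by rewrite xi.
have [b' [ab' sb' vb']] : exists b, [/\ ball a e b, sphere_orthant b &
    section_volume t b = ((fejer_mass R)^-1 * Phi t y)%:E].
  apply: (@perturbation y e i j) => //.
  - move=> k; rewrite /y; case: eqP => _; first exact: ltW.
    by case: eqP => _; [exact: ltW|exact: sqr_ge0].
  - by apply: ext => //; rewrite aj ai.
  - move=> k; rewrite /y; case: eqP => [->|_]; first by rewrite ai opprB addrC subrK.
    by case: eqP => [->|_]; [rewrite aj opprD addNKr normrN|rewrite subrr normr0].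
  - by rewrite yi.
  - by rewrite yj.
exists ((fejer_mass R)^-1 * Phi t (fun k => a 0 k ^+ 2)), b,
  ((fejer_mass R)^-1 * Phi t x), b', ((fejer_mass R)^-1 * Phi t y).
have ap k : k \in I -> 0 < a 0 k.
  by move=> kI; rewrite aI kI invr_gt0 sqrtr_gt0.
split => //.
- by rewrite (section_volumeE t diagonal_sphere ij)//; exact: ap.
- rewrite -mulrBr mulrCA pmulr_rlt0//.
  (* The pair [(0, c)] has mean and half-difference [c / 2]: the boundary case [D = m]. *)
  apply: (@Phi_pair_step R t n d _ _ l i (c / 2) (c / 2) (c / 2 - de)) => //.
  + by move=> k kl ki; rewrite /x (negbTE kl) (negbTE ki).
  + by rewrite sK// al ai add0r -c2.
  + by rewrite al subrr.
  + by rewrite ai -splitr.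
  + by rewrite xl subKr.
  + by rewrite xi addrA -splitr.
- rewrite -mulrBr mulrCA pmulr_rlt0//.
  apply: (@Phi_pair_step R t n d _ _ i j c de 0) => //.
  + by move=> k ki kj; rewrite /y (negbTE ki) (negbTE kj).
  + by move=> k ki kj; rewrite /y (negbTE ki) (negbTE kj); exact: a2b.
  + rewrite (eq_bigr (fun k => a 0 k ^+ 2)) => [|k /andP[kp kq]]; last by rewrite /y (negbTE kp) (negbTE kq).
    by rewrite sK// aj ai mulr2n mulrDl !mul1r.
  + rewrite -[X in (X - 2)%N]Icard; apply: (@card_setD2 _ _ _ i j) => k; rewrite !inE negb_or => /andP[/andP[ki kj] kI].
    by rewrite ki kj /y (negbTE ki) (negbTE kj) a2 kI /=.
  + by rewrite ai subr0.
  + by rewrite aj addr0.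
Qed.

End near_diagonal.
End theorem_cases.

Theorem theorem6p6 (R : realType) (t : R) (d n : nat) (a : 'rV[R]_d)
  (t_ge0 : 0 <= t) (t_gamma_minus : t <> gamma_minus)
  (t_gamma_plus : t <> gamma_plus)
  (d_gt0 : (0 < d)%N) (n_le_d : (n <= d)%N)
  (n_large : Num.max 124 (expR (6 * t ^+ 2) *
     ((74 + 84 * t) / `|1 - 24 * t ^+ 2 + 48 * t ^+ 4|)) <= n%:R)
  (a_sphere : sphere_orthant a)
  (a_diagonal : normal_along_face_diagonal n a) :
  [/\ (t < gamma_minus \/ gamma_plus < t) -> n = d ->
        strictly_locally_maximal (section_volume t) a,
      gamma_minus < t -> t < gamma_plus -> n = d ->
        strictly_locally_minimal (section_volume t) a
    & (n < d)%N -> not_locally_extremal (section_volume t) a].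
Proof.
have h0 := hermite4_neq0 t_ge0 t_gamma_minus t_gamma_plus.
have [n124 nbig] := large_dimension t_ge0 h0 n_large.
have [I [Icard aI]] := a_diagonal.
split => [tout nd|tm tp nd|nd].
- have := Phi_local_diagonal n124 nbig Icard aI nd; apply: filterS => b H sb ba.
  have [va [vb [-> ->]]] := H sb ba.
  by rewrite pmulr_rlt0 ?hermite4_gt0// subr_lt0 lte_fin.
- have := Phi_local_diagonal n124 nbig Icard aI nd; apply: filterS => b H sb ba.
  have [va [vb [-> ->]]] := H sb ba.
  by rewrite nmulr_rlt0 ?hermite4_lt0// subr_gt0 lte_fin.
move=> N /nbhs_ballP[e /= e0 eN].
have [va [b [vb [b' [vb' [-> [ab sb vbE] [ab' sb' vb'E] H H']]]]]] :=
  Phi_not_extremal n124 nbig Icard aI nd e0.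
have Nb := eN _ ab; have Nb' := eN _ ab'.
have [hn|hp|hE] := ltgtP (hermite4 t) 0; last by rewrite hE eqxx in h0.
- rewrite nmulr_rlt0// subr_gt0 in H; rewrite nmulr_rlt0// subr_gt0 in H'.
  by exists b, b'; rewrite vbE vb'E !lte_fin.
- rewrite pmulr_rlt0// subr_lt0 in H; rewrite pmulr_rlt0// subr_lt0 in H'.
  by exists b', b; rewrite vbE vb'E !lte_fin.
Qed.
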